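(* Let $\Gamma\subseteq \mathrm{PSL}_2(\mathbb{R})$ be a Fuchsian group of the first kind with $\mathrm{vol}(\Gamma\backslash\mathbb{H})<\infty$, and let $k\geq 4$ be an even integer. Let $\Gamma_0$ be a subgroup of $\Gamma$ and $\phi$ a holomorphic function on $\mathbb{H}$ with $\phi|_k\gamma=\phi$ for all $\gamma\in\Gamma_0$. Let $L\in \mathrm{Hom}_0(\Gamma,\mathbb{C})$ with $L(\gamma)=0$ for all $\gamma\in\Gamma_0$. If $$\int_{\Gamma_0\backslash\mathbb{H}}\Big(1+|\Lambda_L^+(z)|+|\Lambda_L^-(z)|\Big)|\phi(z)|\,y^{k/2}\,d\mu z<\infty,$$ then the series $$P[\phi,L](z):=\sum_{\gamma\in\Gamma_0\backslash\Gamma}L(\gamma)\,(\phi|_k\gamma)(z)$$ converges absolutely and uniformly on compact subsets of $\mathbb{H}$ to an element of $S^2_k(\Gamma)$.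
   Context: $\mathbb{H}$ is the upper half plane, $z=x+iy$, $d\mu z=dx\,dy/y^2$. For $\gamma=\begin{pmatrix}a&b\\c&d\end{pmatrix}$, $j(\gamma,z)=cz+d$ and $(f|_k\gamma)(z)=f(\gamma z)j(\gamma,z)^{-k}$, extended linearly to the group ring. A cusp of $\Gamma$ is a point of $\mathbb{R}\cup\{\infty\}$ fixed by a parabolic element (non-identity element with $|\mathrm{tr}|=2$); for a cusp $\mathfrak a$ with stabilizer $\Gamma_{\mathfrak a}$ choose $\sigma_{\mathfrak a}\in \mathrm{SL}_2(\mathbb{R})$ with $\sigma_{\mathfrak a}\infty=\mathfrak a$ and $\sigma_{\mathfrak a}^{-1}\Gamma_{\mathfrak a}\sigma_{\mathfrak a}=\{\pm\begin{pmatrix}1&m\\0&1\end{pmatrix}:m\in\mathbb{Z}\}$. A function $f$ decays rapidly at $\mathfrak a$ if $(f|_k\sigma_{\mathfrak a})(z)=O(e^{-cy})$ as $y\to\infty$ uniformly in $x$, for some $c>0$. The spaces $S^n_k(\Gamma)$ are defined recursively: $S^0_k=\{0\}$; for $n\ge1$, $S^n_k$ consists of holomorphic $f:\mathbb{H}\to\mathbb{C}$ such that $f|_k(\gamma-1)\in S^{n-1}_k$ for all $\gamma\in\Gamma$, $f|_k(\pi-1)=0$ for all parabolic $\pi\in\Gamma$, and $f$ decays rapidly at every cusp. $S_k=S^1_k$ is the space of weight $k$ cusp forms. $\mathrm{Hom}_0(\Gamma,\mathbb{C})$ is the space of homomorphisms $\Gamma\to\mathbb{C}$ vanishing on all parabolic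 elements. For $L\in\mathrm{Hom}_0(\Gamma,\mathbb{C})$ there are unique $f^+,f^-\in S_2(\Gamma)$ with $L(\gamma)=\int_z^{\gamma z}f^+(w)\,dw+\overline{\int_z^{\gamma z}f^-(w)\,dw}$ for all $\gamma\in\Gamma$, $z\in\mathbb{H}$ (Eichler–Shimura); set $\Lambda_L^{\pm}(z)=\int_i^z f^{\pm}(w)\,dw$. *)

(* Defs.v *)
From HB Require Import structures.
From mathcomp Require Import all_boot all_order all_algebra.
From mathcomp Require Import finmap.
From mathcomp Require Import complex.
From mathcomp Require Import all_classical all_reals all_analysis.
From mathcomp Require Import summability.

Set Implicit Arguments.
Unset Strict Implicit.
Unset Printing Implicit Defensive.

Import Order.TTheory GRing.Theory Num.Theory.
Import numFieldNormedType.Exports.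

Local Open Scope classical_set_scope.
Local Open Scope ring_scope.
Local Open Scope complex_scope.

(* The norm and the topology of the complex numbers are carried by the regular
   algebra R[i]^o.  Functions on the upper half plane H are represented by
   total functions R[i]^o -> R[i]^o; their values outside H are irrelevant. *)
Notation Cplx R := (R[i]^o).

Section HigherOrderForms.
Context {R : realType}.
Local Notation C := (Cplx R).

(* The modulus, as an element of R (`|z| lives in R[i]). *)
Definition cabs (z : C) : R := ComplexField.Normc.normc z.

Definition upper : set C := [set z : C | 0 < complex.Im z].

Definition holomorphic (f : C -> C) : Prop :=
  forall z, upper z -> derivable f z 1.

Definition autj (g : 'M[R]_2) (z : C) : C :=
  (g 1 0)%:C * z + (g 1 1)%:C.

Definition moebius (g : 'M[R]_2) (z : C) : C :=
  ((g 0 0)%:C * z + (g 0 1)%:C) / autj g z.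

Definition slash (k : nat) (f : C -> C) (g : 'M[R]_2) (z : C) : C :=
  f (moebius g z) * autj g z ^- k.

(* A subgroup of PSL_2(R) is represented by its preimage in SL_2(R), that is, by
   a subgroup of SL_2(R) that contains -1.  Cosets, homomorphisms to the
   additive group of R[i], and the action on H are the same for both. *)
Record psl2_subgroup (G : set 'M[R]_2) : Prop := PSL2Subgroup {
  psl2_det : forall g, G g -> \det g = 1 ;
  psl2_1 : G 1%:M ;
  psl2_mul : forall g h, G g -> G h -> G (g *m h) ;
  psl2_inv : forall g, G g -> G (invmx g) ;
  psl2_opp : forall g, G g -> G (- g) }.

(* Points of R u {oo}, with None for oo. *)
Definition bdry_act (g : 'M[R]_2) (a : option R) : option R :=
  match a with
  | Some x => if g 1 0 * x + g 1 1 == 0 then None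
              else Some ((g 0 0 * x + g 0 1) / (g 1 0 * x + g 1 1))
  | None => if g 1 0 == 0 then None else Some (g 0 0 / g 1 0)
  end.

(* First kind: every point of R u {oo} is a limit, in the Riemann sphere, of
   points of an orbit G z with z in H. *)
Record fuchsian_first_kind (G : set 'M[R]_2) : Prop := FuchsianFirstKind {
  fuchsian_subgroup : psl2_subgroup G ;
  fuchsian_discrete : G `<=` isolated G ;
  fuchsian_limit : forall a : option R, exists2 z : C, upper z &
    closure (Some @` [set moebius g z | g in G]
               : set (one_point_compactification C))
            (omap (fun x : R => x%:C : C) a) }.

(* The integral of g over F with respect to dx dy / y^2. *)
Definition hyp_integral (F : set C) (g : C -> R) : \bar R :=
  (\int[(@lebesgue_measure R \x @lebesgue_measure R)]_(p in
      [set p : R * R | F (p.1 +i* p.2 : C)%R])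
    (g (p.1 +i* p.2 : C)%R / p.2 ^+ 2)%R%:E)%E.

(* A Borel set of representatives for G \ H. *)
Record fundamental_set (G : set 'M[R]_2) (F : set C) : Prop := FundamentalSet {
  fundamental_upper : F `<=` upper ;
  fundamental_measurable :
    measurable ([set p | F (p.1 +i* p.2 : C)]
                  : set (measurableTypeR R * measurableTypeR R)) ;
  fundamental_repr : forall z, upper z ->
    exists! w, F w /\ exists2 g, G g & w = moebius g z }.

(* Finiteness of the integral of g >= 0 over G \ H.  If g is not G-invariant,
   this means finiteness for some choice of representatives. *)
Definition quotient_integral_finite (G : set 'M[R]_2) (g : C -> R) : Prop :=
  exists2 F, fundamental_set G F & (hyp_integral F g < +oo)%E.

Definition finite_covolume (G : set 'M[R]_2) : Prop :=
  quotient_integral_finite G (fun=> 1).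

(* The element of PSL_2(R) represented by g is parabolic. *)
Definition parabolic (g : 'M[R]_2) : Prop :=
  [/\ \det g = 1, g <> 1%:M, g <> - 1%:M & `|\tr g| = 2].

Definition cusp (G : set 'M[R]_2) (a : option R) : Prop :=
  exists g, [/\ G g, parabolic g & bdry_act g a = a].

Definition translation (m : int) : 'M[R]_2 := 1%:M + m%:~R *: delta_mx 0 1.

Record scaling_matrix (G : set 'M[R]_2) (a : option R) (s : 'M[R]_2) : Prop :=
  ScalingMatrix {
  scaling_det : \det s = 1 ;
  scaling_infty : bdry_act s None = a ;
  scaling_stab :
    [set invmx s *m g *m s | g in [set g | G g /\ bdry_act g a = a]] =
    [set h | exists m : int, h = translation m \/ h = - translation m] }.

(* A scaling matrix at a given cusp is unique up to sign and up to a real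
   translation on the right, so the condition does not depend on its choice. *)
Definition rapid_decay (k : nat) (G : set 'M[R]_2) (f : C -> C)
    (a : option R) : Prop :=
  forall s, scaling_matrix G a s ->
  exists c B : R, 0 < c /\
    \forall y \near +oo, forall x : R,
      cabs (slash k f s (x +i* y)) <= B * expR (- (c * y)).

(* The space S^n_k(G). *)
Fixpoint cusp_form (n k : nat) (G : set 'M[R]_2) (f : C -> C) : Prop :=
  match n with
  | 0%N => forall z, upper z -> f z = 0
  | n'.+1 =>
    [/\ holomorphic f,
        forall g, G g -> cusp_form n' k G (fun z => slash k f g z - f z),
        forall g, G g -> parabolic g ->
          forall z, upper z -> slash k f g z - f z = 0
      & forall a, cusp G a -> rapid_decay k G f a]
  end.

(* Hom_0(G, C); only the values of L on G matter. *)
Record hom0 (G : set 'M[R]_2) (L : 'M[R]_2 -> C) : Prop := Hom0 {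
  hom0_mul : forall g h, G g -> G h -> L (g *m h) = L g + L h ;
  hom0_parabolic : forall g, G g -> parabolic g -> L g = 0 }.

(* The integral of f(w) dw along the segment from a to b. *)
Definition cint (f : C -> C) (a b : C) : C :=
  let h (t : R) : C := f (a + t%:C * (b - a)) * (b - a) in
  (\int[lebesgue_measure]_(t in `[0%R, 1%R]) complex.Re (h t))%R +i*
  (\int[lebesgue_measure]_(t in `[0%R, 1%R]) complex.Im (h t))%R.

(* (fp, fm) is the pair (f^+, f^-) that the Eichler-Shimura isomorphism
   attaches to L. *)
Record eichler_shimura (G : set 'M[R]_2) (L : 'M[R]_2 -> C) (fp fm : C -> C) :
    Prop := EichlerShimura {
  es_plus : cusp_form 1 2 G fp ;
  es_minus : cusp_form 1 2 G fm ;
  es_period : forall g z, G g -> upper z ->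
    L g = cint fp z (moebius g z) + conjc (cint fm z (moebius g z)) }.

Definition Lambda (f : C -> C) (z : C) : C := cint f 'i z.

(* T is a set of representatives of the cosets G0 t in G0 \ G. *)
Record coset_transversal (G0 G T : set 'M[R]_2) : Prop := CosetTransversal {
  transversal_sub : T `<=` G ;
  transversal_repr : forall g, G g ->
    exists! t, T t /\ exists2 d, G0 d & g = d *m t }.

(* The term of the series P[phi, L] at the coset of g. *)
Definition pseries_term (k : nat) (phi : C -> C) (L : 'M[R]_2 -> C)
    (g : 'M[R]_2) (z : C) : C :=
  L g * slash k phi g z.

(* The unordered sum of the u g, for g in T, converges to P absolutely and
   uniformly on compact subsets of H.  The uniform convergence is that of the
   net of the partial sums over all the finite subsets of T. *)
Definition abs_unif_cvg_sum (T : set 'M[R]_2) (u : 'M[R]_2 -> C -> C)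
    (P : C -> C) : Prop :=
  (forall z, upper z -> (\esum_(g in T) (cabs (u g z))%:E < +oo)%E) /\
  (forall K : set C, compact K -> K `<=` upper ->
     {uniform K, (fun (A : {fset T}) (z : C) =>
                    partial_sum (fun g : T => u (val g) z) A) @ totally
                 --> P}).

End HigherOrderForms.

(* Main.v *)
(** Put [w = 1 + |L|].  Since [L(g)] is the difference of the values at [g z] and [z] of
    [Lambda^+ + conj Lambda^-], unfolding the integral hypothesis bounds
    [sum_t w(t) int_D |phi|_k t| y^(k/2) dmu] over the cosets [G0 t], for each set [D] on which
    [Lambda^+] and [Lambda^-] are bounded and which meets only finitely many of its
    translates.  By the area mean value inequality this sum controls the values of
    [w(t) |phi|_k t|] at the points of [D] away from its boundary, so the series [P] of [L] and the
    series [P0] of the constant [1] converge normally, and [P|g = P - L(g) P0], [P0|g = P0].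

    At a cusp, [D] is a vertical strip in the coordinate of the scaling matrix: Shimizu's
    lemma gives the finiteness, and the exponential decay of [f^+] and [f^-] the
    boundedness of [Lambda^+] and [Lambda^-].  So [h = P|s] is bounded, it is periodic, and its
    mean over a period, which does not depend on the height, vanishes because
    [k >= 4] makes [h] integrable over the strip.  A bounded periodic holomorphic
    function with mean zero decays exponentially, by the Cauchy estimates.

    Cauchy's theory is derived for squares, from Goursat's lemma for triangles. *)

Require Import Defs.
From HB Require Import structures.
From mathcomp Require Import all_boot all_order all_algebra.
From mathcomp Require Import finmap.
From mathcomp Require Import complex.
From mathcomp Require Import all_classical all_reals all_analysis.
From mathcomp Require Import summability measurable_realfun ring lra.

Set Implicit Arguments.
Unset Strict Implicit.
Unset Printing Implicit Defensive.

Import Order.TTheory GRing.Theory Num.Theory.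
Import numFieldNormedType.Exports.

Local Open Scope classical_set_scope.
Local Open Scope ring_scope.
Local Open Scope complex_scope.

Local Arguments cabs : simpl never.
Local Arguments cint : simpl never.
Local Arguments moebius : simpl never.
Local Arguments autj : simpl never.
Local Arguments slash : simpl never.

(** * Contour integrals along segments and Goursat's theorem *)

Section Modulus.
Context {R : realType}.
Local Notation C := (Cplx R).
Local Notation mu := (@lebesgue_measure R).

(** Since [L] vanishes on [G0], the coefficient and the size of a term depend only on its coset. At
    each point p, the representative d t can therefore be chosen so that d t p lies in the given
    fundamental set of [G0]; there the integrand of the hypothesis dominates 1 + |L(t)|, up to a
    constant that depends on the size of Lambda^+ and Lambda^- at p. The weight contains 1 besides
    |L| because P|g has the coefficients L(t) = L(t g) - L(g): the plain series P0 appears, and it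
    must itself be a cusp form. The condition k >= 4 enters through y^(k/2) dmu = y^(k/2-2) dx dy,
    which dominates dx dy on y >= 1. This converts hyperbolic mass into the Euclidean mass of the
    mean value inequality. Squares replace discs because their sides are parallel to the axes:
    varying the size of a square turns integrals along its sides into area integrals by Tonelli
    alone. Invariance of the measure is reduced in the same way to one-dimensional substitutions.
    Constants are crude throughout; only their independence of the point and of the coset
    matters. *)

Lemma cabs_ge0 (z : C) : 0 <= cabs z.
Proof. by case: z => a b; exact: sqrtr_ge0. Qed.

Lemma cabs0 : cabs (0 : C) = 0.
Proof. exact: ComplexField.Normc.normc0. Qed.

Lemma cabs1 : cabs (1 : C) = 1.
Proof. exact: ComplexField.Normc.normc1. Qed.

Lemma cabs_eq0 (z : C) : (cabs z == 0) = (z == 0).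
Proof.
apply/eqP/eqP => [/ComplexField.Normc.eq0_normc//|->]; exact: cabs0.
Qed.

Lemma cabs_gt0 (z : C) : (0 < cabs z) = (z != 0).
Proof. by rewrite lt_def cabs_ge0 andbT cabs_eq0. Qed.

Lemma cabsD (x y : C) : cabs (x + y) <= cabs x + cabs y.
Proof. exact: le_normcD. Qed.

Lemma cabsN (x : C) : cabs (- x) = cabs x.
Proof. exact: normcN. Qed.

Lemma cabsB (x y : C) : cabs (x - y) <= cabs x + cabs y.
Proof. by rewrite -(cabsN y); exact: cabsD. Qed.

Lemma cabsBC (x y : C) : cabs (x - y) = cabs (y - x).
Proof. by rewrite -cabsN opprB. Qed.

Lemma cabsM (x y : C) : cabs (x * y) = cabs x * cabs y.
Proof. exact: ComplexField.Normc.normcM. Qed.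

Lemma cabsV (x : C) : cabs x^-1 = (cabs x)^-1.
Proof. exact: ComplexField.Normc.normcV. Qed.

Lemma cabsX (x : C) n : cabs (x ^+ n) = cabs x ^+ n.
Proof. by elim: n => [|n IH]; rewrite ?expr0 ?cabs1// !exprS cabsM IH. Qed.

Lemma cabsr (x : R) : cabs (x%:C : C) = `|x|.
Proof. by rewrite /cabs /= expr0n addr0 sqrtr_sqr. Qed.

Lemma sqr_cabs (z : C) : cabs z ^+ 2 = complex.Re z ^+ 2 + complex.Im z ^+ 2.
Proof. by case: z => a b; rewrite /cabs /= sqr_sqrtr// addr_ge0// sqr_ge0. Qed.

Lemma Re_le_cabs (z : C) : `|complex.Re z| <= cabs z.
Proof.
rewrite -ler_sqr ?nnegrE ?cabs_ge0 ?normr_ge0// sqr_cabs.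
by rewrite real_normK ?num_real// lerDl sqr_ge0.
Qed.

Lemma Im_le_cabs (z : C) : `|complex.Im z| <= cabs z.
Proof.
rewrite -ler_sqr ?nnegrE ?cabs_ge0 ?normr_ge0// sqr_cabs.
by rewrite real_normK ?num_real// lerDr sqr_ge0.
Qed.

Lemma cabs_le_ReIm (z : C) : cabs z <= `|complex.Re z| + `|complex.Im z|.
Proof.
rewrite -ler_sqr ?nnegrE ?cabs_ge0 ?addr_ge0// sqr_cabs sqrrD.
by rewrite !real_normK ?num_real// -addrA lerD2l lerDr mulrn_wge0// mulr_ge0.
Qed.

Lemma cabsC (z : C) : cabs (conjc z) = cabs z.
Proof. by case: z => a b; rewrite /cabs /= sqrrN. Qed.

Lemma cabs_sum (I : Type) (r : seq I) (P : pred I) (F : I -> C) :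
  cabs (\sum_(i <- r | P i) F i) <= \sum_(i <- r | P i) cabs (F i).
Proof.
apply: (big_ind2 (fun x (y : R) => cabs x <= y)); rewrite ?cabs0//.
by move=> x1 x2 y1 y2 h1 h2; apply: le_trans (cabsD _ _) _; exact: lerD.
Qed.

Lemma cabs_norm (z : C) : `|z| = (cabs z)%:C.
Proof. by []. Qed.

Lemma nbhsCP (z : C) (P : set C) :
  nbhs z P <-> exists2 d : R, 0 < d & forall w : C, cabs (w - z) < d -> P w.
Proof.
split=> [/nbhs_ballP[e /= e0 eP]|[d d0 dP]].
  have [ie re] : complex.Im e = 0 /\ 0 < complex.Re e.
    by move: e0; rewrite ltcE /= => /andP[/eqP].
  exists (complex.Re e) => // w we; apply: eP; rewrite -ball_normE /ball_ /=.
  rewrite cabs_norm ltcE /= ie eqxx /=.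
  by rewrite cabsBC.
apply/nbhs_ballP; exists (d%:C : R[i]); first by rewrite /= ltcE /= eqxx.
move=> w; rewrite -ball_normE /ball_ /= cabs_norm ltcE /= eqxx /= => zw.
by apply: dP; rewrite cabsBC.
Qed.

Lemma nbhsRP (x : R) (P : set R) :
  nbhs x P <-> exists2 d : R, 0 < d & forall y, `|y - x| < d -> P y.
Proof.
split=> [/nbhs_ballP[e /= e0 eP]|[d d0 dP]].
  by exists e => // y ye; apply: eP; rewrite -ball_normE /ball_ /= distrC.
apply/nbhs_ballP; exists d => //= y; rewrite -ball_normE /ball_ /= => xy.
by apply: dP; rewrite distrC.
Qed.

Lemma contCP (f : C -> C) (z : C) : {for z, continuous f} <->
  forall e : R, 0 < e -> exists2 d : R, 0 < d &
    forall w, cabs (w - z) < d -> cabs (f w - f z) < e.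
Proof.
split=> [cf e e0|H].
  have /cf/nbhsCP[d d0 dP] : nbhs (f z) [set w | cabs (w - f z) < e].
    by apply/nbhsCP; exists e.
  by exists d.
move=> P /nbhsCP[e e0 eP]; apply/nbhsCP.
have [d d0 dP] := H _ e0; exists d => // w /dP; exact: eP.
Qed.

Lemma contRCP (g : R -> C) (t : R) : {for t, continuous g} <->
  forall e : R, 0 < e -> exists2 d : R, 0 < d &
    forall s, `|s - t| < d -> cabs (g s - g t) < e.
Proof.
split=> [cf e e0|H].
  have /cf/nbhsRP[d d0 dP] : nbhs (g t) [set w | cabs (w - g t) < e].
    by apply/nbhsCP; exists e.
  by exists d.
move=> P /nbhsCP[e e0 eP]; apply/nbhsRP.
have [d d0 dP] := H _ e0; exists d => // w /dP; exact: eP.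
Qed.

Lemma contCRP (g : C -> R) (z : C) : {for z, continuous g} <->
  forall e : R, 0 < e -> exists2 d : R, 0 < d &
    forall w, cabs (w - z) < d -> `|g w - g z| < e.
Proof.
split=> [cf e e0|H].
  have /cf/nbhsCP[d d0 dP] : nbhs (g z) [set w | `|w - g z| < e].
    by apply/nbhsRP; exists e.
  by exists d.
move=> P /nbhsRP[e e0 eP]; apply/nbhsCP.
have [d d0 dP] := H _ e0; exists d => // w /dP; exact: eP.
Qed.

Lemma continuous_Re : continuous (fun z : C => complex.Re z).
Proof.
move=> z; apply/contCRP => e e0; exists e => // w; apply: le_lt_trans.
by rewrite -raddfB; exact: Re_le_cabs.
Qed.

Lemma continuous_Im : continuous (fun z : C => complex.Im z).
Proof.
move=> z; apply/contCRP => e e0; exists e => // w; apply: le_lt_trans.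
by rewrite -raddfB; exact: Im_le_cabs.
Qed.

Lemma continuous_cabs : continuous (cabs : C -> R).
Proof.
move=> z; apply/contCRP => e e0; exists e => // w; apply: le_lt_trans.
rewrite ler_norml; apply/andP; split.
  rewrite (cabsBC w z); have := cabsD (z - w) w; rewrite subrK; lra.
by have := cabsD (w - z) z; rewrite subrK; lra.
Qed.

Lemma continuous_real_complex : continuous (fun x : R => (x%:C : C)).
Proof.
move=> x; apply/contRCP => e e0; exists e => // w.
by rewrite -rmorphB cabsr.
Qed.

(** Multiplying out the difference quotient removes the division: w = z is not excluded, and bounds
    on integrals give this form directly. *)
Definition cder (f : C -> C) (z d : C) : Prop :=
  forall e : R, 0 < e -> exists2 r : R, 0 < r & forall w : C, cabs (w - z) < r ->
    cabs (f w - f z - d * (w - z)) <= e * cabs (w - z).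

Lemma cder_is_derive f z d : cder f z d -> is_derive (z : C) (1 : C) f d.
Proof.
move=> H.
suff cv : (fun h : C => h^-1 *: (f (h *: (1 : C) + z) - f z)) @ (0 : C)^' --> d.
  apply: DeriveDef.
    by apply/cvg_ex; exists d; exact: cv.
  by apply: cvg_lim; [exact: norm_hausdorff|exact: cv].
move=> P /nbhsCP[e e0 eP].
have e20 : 0 < e / 2 by rewrite divr_gt0.
have [r r0 rP] := H _ e20.
apply/nbhsCP; exists r => // h hr hN0; apply: eP.
have hz : cabs (h + z - z) < r by rewrite addrK; move: hr; rewrite subr0.
have := rP _ hz; rewrite addrK => le1.
have ch : 0 < cabs h by rewrite cabs_gt0.
have -> : h^-1 *: (f (h *: (1:C) + z) - f z) - d
   = h^-1 * (f (h + z) - f z - d * h).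
  rewrite [h *: (1:C)]mulr1 [h^-1 *: _]/GRing.scale /=.
  have hh : h != 0 by [].
  by field.
rewrite cabsM cabsV mulrC ltr_pdivrMr//.
apply: le_lt_trans le1 _; rewrite ltr_pM2r// ltr_pdivrMr// mulr2n mulrDr mulr1.
by rewrite ltrDl.
Qed.

Lemma is_derive_cder f z d : is_derive (z : C) (1 : C) f d -> cder f z d.
Proof.
move=> [df dd] e e0.
have cv : (fun h : C => h^-1 *: (f (h *: (1 : C) + z) - f z)) @ (0 : C)^' --> d.
  by rewrite -dd; exact: df.
have /cv/nbhsCP[r r0 rP] : nbhs d [set w : C | cabs (w - d) < e].
  by apply/nbhsCP; exists e.
exists r => // w wz.
have [->|wz0] := eqVneq w z; first by rewrite !subrr mulr0 subrr cabs0 mulr0.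
have h0 : w - z != 0 by rewrite subr_eq0.
have hr : cabs (w - z - 0) < r by rewrite subr0.
have /= := rP _ hr h0.
rewrite [(w - z) *: (1:C)]mulr1 [_^-1 *: _]/GRing.scale /= subrK => le1.
have -> : f w - f z - d * (w - z)
   = ((w - z)^-1 * (f w - f z) - d) * (w - z).
  by field.
by rewrite cabsM ler_wpM2r ?cabs_ge0// ltW.
Qed.

Lemma derivable_cder (f : C -> C) (z : C) : derivable f z 1 <-> exists d, cder f z d.
Proof.
split=> [df|[d /cder_is_derive[]]//].
by exists ('D_1 f z); apply: is_derive_cder; exact: DeriveDef.
Qed.

Lemma derivable_contC (f : C -> C) (z : C) : derivable f z 1 -> {for z, continuous f}.
Proof. by move/derivable1_diffP; exact: differentiable_continuous. Qed.

(** Continuity is two-sided even at 0 and 1, which suits integrands that are continuous in a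
    neighbourhood of the segment. *)
Record cont01 (g : R -> C) : Prop :=
  Cont01 { cont01P : forall t : R, 0 <= t <= 1 -> {for t, continuous g} }.

(** * Integrals over the unit interval and along segments *)

Lemma ReD (z w : C) : complex.Re (z + w) = complex.Re z + complex.Re w.
Proof. by case: z w => [? ?] [? ?]. Qed.

Lemma ImD (z w : C) : complex.Im (z + w) = complex.Im z + complex.Im w.
Proof. by case: z w => [? ?] [? ?]. Qed.

Definition cint01 (g : R -> C) : C :=
  (\int[mu]_(t in `[0%R, 1%R]) complex.Re (g t))%R +i*
  (\int[mu]_(t in `[0%R, 1%R]) complex.Im (g t))%R.

Definition seg (a b : C) (t : R) : C := a + t%:C * (b - a).

Local Arguments seg : simpl never.

Local Arguments cint01 : simpl never.

Lemma cintE (f : C -> C) a b :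
  cint f a b = cint01 (fun t => f (seg a b t) * (b - a)).
Proof. by []. Qed.

Lemma continuous_seg a b : continuous (seg a b).
Proof.
move=> t.
apply: (@continuousD _ _ _ (cst a : R -> C) (fun t : R => t%:C * (b - a) : C) t).
  exact: cst_continuous.
apply: (@continuousM _ _ (fun t : R => t%:C : C) (cst (b - a) : R -> C) t).
  exact: continuous_real_complex.
exact: cst_continuous.
Qed.

Lemma within01 (u : R -> R) :
  (forall t : R, 0 <= t <= 1 -> {for t, continuous u}) ->
  {within `[0%R, 1%R], continuous u}.
Proof.
move=> cu; apply: continuous_in_subspaceT => t.
by rewrite inE/= in_itv/=; exact: cu.
Qed.

Lemma int01 (u : R -> R) :
  (forall t : R, 0 <= t <= 1 -> {for t, continuous u}) ->
  mu.-integrable `[0%R, 1%R] (EFin \o u).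
Proof.
move=> cu; apply: (@continuous_compact_integrable R u).
  exact: segment_compact.
exact: within01.
Qed.

Lemma cont01_Re g : cont01 g ->
  forall t : R, 0 <= t <= 1 -> {for t, continuous (fun t => complex.Re (g t))}.
Proof.
move=> [cg] t /cg ct.
by apply: (@continuous_comp _ _ _ g (fun z : C => complex.Re z)) => //; exact: continuous_Re.
Qed.

Lemma cont01_Im g : cont01 g ->
  forall t : R, 0 <= t <= 1 -> {for t, continuous (fun t => complex.Im (g t))}.
Proof.
move=> [cg] t /cg ct.
by apply: (@continuous_comp _ _ _ g (fun z : C => complex.Im z)) => //; exact: continuous_Im.
Qed.

Lemma cont01_cabs g : cont01 g ->
  forall t : R, 0 <= t <= 1 -> {for t, continuous (fun t => cabs (g t))}.
Proof.
move=> [cg] t /cg ct.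
by apply: (@continuous_comp _ _ _ g (fun z : C => cabs z)) => //; exact: continuous_cabs.
Qed.

Lemma cont01B g h : cont01 g -> cont01 h -> cont01 (fun t => g t - h t).
Proof. by move=> [cg] [ch]; split=> t t01; apply: continuousB; [exact: cg|exact: ch]. Qed.

Lemma cont01N g : cont01 g -> cont01 (fun t => - g t).
Proof. by move=> [cg]; split=> t t01; apply: continuousN; exact: cg. Qed.

Lemma cont01M g h : cont01 g -> cont01 h -> cont01 (fun t => g t * h t).
Proof. by move=> [cg] [ch]; split=> t t01; apply: continuousM; [exact: cg|exact: ch]. Qed.

Lemma cont01_comp g (u : R -> R) : continuous u ->
  (forall t, 0 <= t <= 1 -> 0 <= u t <= 1) -> cont01 g -> cont01 (fun t => g (u t)).
Proof.
move=> cu u01 [cg]; split=> t t01.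
exact: (@continuous_comp R R C u g t (cu t) (cg _ (u01 _ t01))).
Qed.

Lemma cont01_cst (c : C) : cont01 (fun=> c).
Proof. by split=> t _; exact: cst_continuous. Qed.

Lemma cont01V g : cont01 g -> (forall t, 0 <= t <= 1 -> g t != 0) ->
  cont01 (fun t => (g t)^-1).
Proof. by move=> [cg] g0; split=> t t01; apply: continuousV; [exact: g0|exact: cg]. Qed.

Lemma cont01_seg a b (f : C -> C) :
  (forall t : R, 0 <= t <= 1 -> {for seg a b t, continuous f}) ->
  cont01 (fun t => f (seg a b t)).
Proof.
move=> cf; split=> t t01; apply: (@continuous_comp _ _ _ (seg a b) f).
  exact: continuous_seg.
exact: cf.
Qed.

Lemma cint01D g h : cont01 g -> cont01 h -> cint01 (fun t => g t + h t) = cint01 g + cint01 h.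
Proof.
move=> cg ch; rewrite /cint01 /=; congr (_ +i* _); rewrite -RintegralD//.
- by apply: eq_Rintegral => t _; rewrite ReD.
- exact/int01/cont01_Re.
- exact/int01/cont01_Re.
- by apply: eq_Rintegral => t _; rewrite ImD.
- exact/int01/cont01_Im.
- exact/int01/cont01_Im.
Qed.

Lemma cint01Z c g : cont01 g -> cint01 (fun t => c * g t) = c * cint01 g.
Proof.
move=> cg; have [ir ii] := (int01 (cont01_Re cg), int01 (cont01_Im cg)).
have Z (u : R -> R) (k : R) : mu.-integrable `[0%R, 1%R] (EFin \o u) ->
   mu.-integrable `[0%R, 1%R] (EFin \o (fun x => k * u x)).
  by move=> iu; exact: (@integrableZl _ _ _ _ _ _ k _ iu).
case: c => a b; rewrite /cint01 /GRing.mul /=; congr (_ +i* _).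
  rewrite -!RintegralZl// -RintegralB//; try exact: Z.
  by apply: eq_Rintegral => t _; case: (g t).
rewrite -!RintegralZl// -RintegralD//; try exact: Z.
by apply: eq_Rintegral => t _; case: (g t).
Qed.

Lemma eq_cint01 g h : (forall t, 0 <= t <= 1 -> g t = h t) -> cint01 g = cint01 h.
Proof.
move=> gh; rewrite /cint01; congr (_ +i* _); apply: eq_Rintegral => t;
  by rewrite inE/= in_itv/= => /gh ->.
Qed.

Lemma cint01N g : cont01 g -> cint01 (fun t => - g t) = - cint01 g.
Proof.
move=> cg; rewrite -mulN1r -cint01Z//; apply: eq_cint01 => t _; by rewrite mulN1r.
Qed.

Lemma cint01B g h : cont01 g -> cont01 h -> cint01 (fun t => g t - h t) = cint01 g - cint01 h.
Proof.
move=> cg ch; by rewrite cint01D ?cint01N//; exact: cont01N.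
Qed.

Lemma mu01 : fine (mu (`[0%R, 1%R] : set R)) = 1.
Proof. by rewrite lebesgue_measure_itv/= lte_fin ltr01 oppr0 adde0. Qed.

Lemma cint01_cst c : cint01 (fun=> c) = c.
Proof. by case: c => a b; rewrite /cint01 /= !Rintegral_cst// mu01 !mulr1. Qed.

(** Real and imaginary parts are bounded separately, whence the factor 2. It propagates to the later
    constants. *)
Lemma cint01_bound g (M : R) : cont01 g ->
  (forall t, 0 <= t <= 1 -> cabs (g t) <= M) -> cabs (cint01 g) <= 2 * M.
Proof.
move=> cg gM.
have B (u : R -> R) : (forall t : R, 0 <= t <= 1 -> {for t, continuous u}) ->
    (forall t, 0 <= t <= 1 -> `|u t| <= M) ->
    `|\int[mu]_(t in `[0%R, 1%R]) u t| <= M.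
  move=> cu uM; apply: (le_trans (le_normr_Rintegral _ _)) => //; first exact: int01.
  have -> : M = (\int[mu]_(t in `[0%R, 1%R]) (cst M) t)%R.
    by rewrite Rintegral_cst// mu01 mulr1.
  apply: le_Rintegral => //.
  - by apply: int01 => t /cu ct; apply: continuous_comp => //; exact: norm_continuous.
  - by apply: int01 => t _; exact: cst_continuous.
apply: (le_trans (cabs_le_ReIm _)); rewrite mulr2n mulrDl mul1r lerD//.
  apply: B; first exact: cont01_Re.
  by move=> t /gM; apply: le_trans; exact: Re_le_cabs.
apply: B; first exact: cont01_Im.
by move=> t /gM; apply: le_trans; exact: Im_le_cabs.
Qed.

Lemma cint01_le_int g : cont01 g ->
  cabs (cint01 g) <= 2 * (\int[mu]_(t in `[0%R, 1%R]) cabs (g t))%R.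
Proof.
move=> cg.
have B (u : R -> R) : (forall t : R, 0 <= t <= 1 -> {for t, continuous u}) ->
    (forall t, 0 <= t <= 1 -> `|u t| <= cabs (g t)) ->
    `|\int[mu]_(t in `[0%R, 1%R]) u t| <= \int[mu]_(t in `[0%R, 1%R]) cabs (g t).
  move=> cu uM; apply: (le_trans (le_normr_Rintegral _ _)) => //; first exact: int01.
  apply: le_Rintegral => //.
  - by apply: int01 => t /cu ct; apply: continuous_comp => //; exact: norm_continuous.
  - by apply: int01; exact: cont01_cabs.
apply: (le_trans (cabs_le_ReIm _)); rewrite mulr2n mulrDl mul1r lerD//.
  apply: B; first exact: cont01_Re.
  by move=> t _; exact: Re_le_cabs.
apply: B; first exact: cont01_Im.
by move=> t _; exact: Im_le_cabs.
Qed.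

Lemma int01_rev (u : R -> R) :
  (forall t : R, 0 <= t <= 1 -> {for t, continuous u}) ->
  (\int[mu]_(t in `[0%R, 1%R]) u (1 - t))%R = (\int[mu]_(t in `[0%R, 1%R]) u t)%R.
Proof.
move=> cu; rewrite (@Rintegration_by_substitution_onem R u 1) ?ler01 ?lexx//.
  by rewrite unstable.onem1.
exact: within01.
Qed.

Lemma int_affine (u : R -> R) (a b : R) : a < b ->
  (forall t : R, a <= t <= b -> {for t, continuous u}) ->
  (\int[mu]_(t in `[a, b]) u t)%R =
  (b - a) * (\int[mu]_(t in `[0%R, 1%R]) u (a + t * (b - a)))%R.
Proof.
move=> ab cu; have ba : 0 < b - a by rewrite subr_gt0.
pose F t : R := a + t * (b - a).
have dF (t : R) : is_derive t (1 : R) F (b - a).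
  apply: is_derive_eq; rewrite add0r scaler0 add0r.
  by rewrite mul1r [_%:A]mulr1.
have dF1 : (F^`())%classic = cst (b - a).
  by apply/funext => t; rewrite derive1E; exact: derive_val.
have F0 : F 0 = a by rewrite /F mul0r addr0.
have F1 : F 1 = b by rewrite /F mul1r addrC subrK.
have cF : continuous F.
  move=> t; apply: differentiable_continuous; apply/derivable1_diffP.
  by have [] := dF t.
rewrite -RintegralZl//; last first.
  apply: (@int01 (fun t => u (F t))) => t /andP[t0 t1].
  apply: (@continuous_comp _ _ _ F u); first exact: cF.
  by apply: cu; rewrite /F; apply/andP; split; nra.
rewrite /Rintegral; congr fine.
have := @integration_by_substitution_increasing R F u 0 1 ler01.
rewrite F0 F1 dF1 => ->.
- by apply: eq_integral => t _; rewrite /= mulrC.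
- by move=> x y _ _ xy; rewrite /F ltrD2l ltr_pM2r.
- by move=> x _; exact: cst_continuous.
- exact: is_cvg_cst.
- exact: is_cvg_cst.
- split.
  + by move=> x _; have [] := dF x.
  + by apply: cvg_at_right_filter; exact: cF.
  + by apply: cvg_at_left_filter; exact: cF.
- apply: continuous_in_subspaceT => t.
  by rewrite inE/= in_itv/=; exact: cu.
Qed.

Lemma int01_mid (u : R -> R) :
  (forall t : R, 0 <= t <= 1 -> {for t, continuous u}) ->
  (\int[mu]_(t in `[0%R, 1%R]) u t)%R =
  (\int[mu]_(t in `[0%R, 1%R]) u (t / 2))%R / 2 +
  (\int[mu]_(t in `[0%R, 1%R]) u (2^-1 + t / 2))%R / 2.
Proof.
move=> cu.
have i1 := int01 cu.
have h01 : (0 : R) < 2^-1 by rewrite invr_gt0.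
have h1 : (2^-1 : R) < 1 by rewrite invf_lt1// ltr1n.
have := @Rintegral_itvB R u (BLeft 0) (BRight 1) 2^-1 i1.
rewrite !bnd_simp => /(_ (ltW h01) (ltW h1)) /eqP; rewrite subr_eq => /eqP ->.
rewrite addrC; congr (_ + _).
  rewrite int_affine//; last first.
    by move=> t /andP[t0 t1]; apply: cu; rewrite t0 (le_trans t1)// ltW.
  rewrite subr0 mulrC; congr (_ * _); apply: eq_Rintegral => t _.
  by rewrite add0r.
rewrite Rintegral_itv_obnd_cbnd; last first.
  apply: (integrableS _ _ _ i1) => //; apply: subset_itvr.
  by rewrite bnd_simp ltW.
rewrite int_affine//; last first.
  by move=> t /andP[t0 t1]; apply: cu; rewrite t1 (le_trans _ t0)// ltW.
have -> : 1 - 2^-1 = 2^-1 :> R by field.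
by rewrite mulrC.
Qed.

Lemma cint01_rev g : cont01 g -> cint01 (fun t => g (1 - t)) = cint01 g.
Proof.
move=> cg; rewrite /cint01; congr (_ +i* _).
  by rewrite -[RHS]int01_rev//; exact: cont01_Re.
by rewrite -[RHS]int01_rev//; exact: cont01_Im.
Qed.

Lemma cint01_mid g : cont01 g ->
  cint01 g = (cint01 (fun t => g (t / 2)) + cint01 (fun t => g (2^-1 + t / 2))) / 2.
Proof.
move=> cg; rewrite {1}/cint01 (int01_mid (cont01_Re cg)) (int01_mid (cont01_Im cg)).
have -> : (2 : C)^-1 = (2^-1 : R)%:C by rewrite rmorphV ?unitfE// rmorph_nat.
by apply/eqP; rewrite eq_complex /= !mulr0 subr0 add0r !mulrDl !eqxx.
Qed.

Lemma seg_rev a b t : seg b a t = seg a b (1 - t).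
Proof. by rewrite /seg rmorphB rmorph1; ring. Qed.

Lemma cint_rev (f : C -> C) a b :
  (forall t : R, 0 <= t <= 1 -> {for seg a b t, continuous f}) ->
  cint f b a = - cint f a b.
Proof.
move=> cf; have cs := cont01_seg cf.
have cg : cont01 (fun t => f (seg a b t) * (b - a)).
  exact: (cont01M cs (cont01_cst (b - a))).
rewrite !cintE -cint01N// -[RHS]cint01_rev; last exact: cont01N.
by apply: eq_cint01 => t _; rewrite seg_rev; ring.
Qed.

Lemma cint_mid (f : C -> C) a b :
  (forall t : R, 0 <= t <= 1 -> {for seg a b t, continuous f}) ->
  cint f a b = cint f a ((a + b) / 2) + cint f ((a + b) / 2) b.
Proof.
move=> cf; have cs := cont01_seg cf.
have cg : cont01 (fun t => f (seg a b t) * (b - a)).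
  exact: (cont01M cs (cont01_cst (b - a))).
have h (t : R) : 0 <= t <= 1 -> 0 <= t / 2 <= 1.
  by move=> /andP[t0 t1]; apply/andP; split; lra.
have h' (t : R) : 0 <= t <= 1 -> 0 <= 2^-1 + t / 2 <= 1.
  by move=> /andP[t0 t1]; apply/andP; split; lra.
rewrite !cintE cint01_mid// mulrDl; congr (_ + _).
  rewrite mulrC -cint01Z.
    apply: eq_cint01 => t _; rewrite mulrCA; congr (f _ * _); last by field.
    by rewrite /seg rmorphM /= fmorphV rmorph_nat; field.
  apply: (@cont01_comp _ (fun t : R => t / 2) _ h cg).
  exact: mulrr_continuous.
rewrite mulrC -cint01Z.
  apply: eq_cint01 => t _; rewrite mulrCA; congr (f _ * _); last by field.
  by rewrite /seg rmorphD rmorphM /= fmorphV rmorph_nat; field.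
apply: (@cont01_comp _ (fun t : R => 2^-1 + t / 2) _ h' cg) => t.
by apply: cvgD; [exact: cvg_cst|exact: mulrr_continuous].
Qed.

(** The reflection t |-> 1 - t gives I = 1 - I. *)
Lemma cint01_id : cint01 (fun t => t%:C) = 2^-1.
Proof.
have ct : cont01 (fun t : R => t%:C : C).
  by split=> t _; exact: continuous_real_complex.
have := cint01_rev ct.
have -> : cint01 (fun t => (1 - t)%:C) = 1 - cint01 (fun t => t%:C).
  rewrite -[X in X - _](cint01_cst 1) -cint01B//; last exact: cont01_cst.
  by apply: eq_cint01 => t _; rewrite rmorphB rmorph1.
move=> h; apply: (@mulfI _ (2 : C)); first by rewrite pnatr_eq0.
rewrite divff ?pnatr_eq0// mulr2n mulrDl mul1r -{1}h; ring.
Qed.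

(** The right-hand side is the increment of an explicit primitive, so affine functions integrate to
    0 over closed triangles. *)
Lemma cint_affine p d a b :
  cint (fun w : C => p + d * w) a b = (p * b + d * b ^+ 2 / 2) - (p * a + d * a ^+ 2 / 2).
Proof.
have ct : cont01 (fun t : R => t%:C : C).
  by split=> t _; exact: continuous_real_complex.
rewrite cintE.
transitivity (cint01 (fun t => (p + d * a) * (b - a) + (d * (b - a) ^+ 2) * t%:C)).
  by apply: eq_cint01 => t _; rewrite /seg; ring.
rewrite cint01D; last 2 first.
- exact: cont01_cst.
- exact: (cont01M (cont01_cst _) ct).
by rewrite cint01_cst cint01Z// cint01_id; field.
Qed.

Lemma cintB (f g : C -> C) a b :
  (forall t : R, 0 <= t <= 1 -> {for seg a b t, continuous f}) ->
  (forall t : R, 0 <= t <= 1 -> {for seg a b t, continuous g}) ->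
  cint (fun w => f w - g w) a b = cint f a b - cint g a b.
Proof.
move=> cf cg; have c := cont01_cst (b - a).
rewrite !cintE -cint01B; last 2 first.
- exact: (cont01M (cont01_seg cf) c).
- exact: (cont01M (cont01_seg cg) c).
by apply: eq_cint01 => t _; rewrite mulrBl.
Qed.

Lemma cint_bound (f : C -> C) a b (M : R) :
  (forall t : R, 0 <= t <= 1 -> {for seg a b t, continuous f}) ->
  (forall t : R, 0 <= t <= 1 -> cabs (f (seg a b t)) <= M) ->
  cabs (cint f a b) <= 2 * M * cabs (b - a).
Proof.
move=> cf fM; rewrite cintE -mulrA; apply: cint01_bound.
  exact: (cont01M (cont01_seg cf) (cont01_cst _)).
by move=> t t01; rewrite cabsM ler_wpM2r ?cabs_ge0// fM.
Qed.

Definition segconvex (U : set C) :=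
  forall a b (t : R), U a -> U b -> 0 <= t <= 1 -> U (seg a b t).

Definition triangle_int (f : C -> C) (T : C * C * C) : C :=
  cint f T.1.1 T.1.2 + cint f T.1.2 T.2 + cint f T.2 T.1.1.

Local Arguments triangle_int : simpl never.

Definition perim (T : C * C * C) : R :=
  cabs (T.1.2 - T.1.1) + cabs (T.2 - T.1.2) + cabs (T.1.1 - T.2).

Definition triangle_in (U : set C) (T : C * C * C) := [/\ U T.1.1, U T.1.2 & U T.2].

Lemma cabs_half (x : C) : cabs (x / 2) = cabs x / 2.
Proof.
rewrite cabsM cabsV; congr (_ / _).
by rewrite -(rmorph_nat (real_complex R)) cabsr ger0_norm// ler0n.
Qed.

Lemma seg_half (a b : C) : (a + b) / 2 = seg a b 2^-1.
Proof. by rewrite /seg fmorphV rmorph_nat; field. Qed.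

(** The midpoints of the sides cut the triangle into four of half the perimeter, the inner sides
    cancel, and one of the four carries at least a quarter of the integral. The last conclusion
    bounds the displacement of the first vertex, so that iteration gives a Cauchy sequence. *)
Lemma goursat_step (U : set C) (f : C -> C) T :
  segconvex U -> (forall z, U z -> {for z, continuous f}) -> triangle_in U T ->
  exists T', [/\ triangle_in U T', perim T' = perim T / 2,
    cabs (triangle_int f T) <= 4 * cabs (triangle_int f T') & cabs (T'.1.1 - T.1.1) <= perim T].
Proof.
move=> cU cf; case: T => [[a b] c] [/= Ua Ub Uc].
have hh : 0 <= (2^-1 : R) <= 1.
  by rewrite invr_ge0 ler0n /= invf_le1 ?ler1n.
have c2 (x y : C) : U x -> U y -> forall t : R, 0 <= t <= 1 -> {for seg x y t, continuous f}.
  by move=> Ux Uy t t01; apply: cf; exact: cU.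
pose m1 := (a + b) / 2; pose m2 := (b + c) / 2; pose m3 := (c + a) / 2.
have [U1 U2 U3] : [/\ U m1, U m2 & U m3].
  by rewrite /m1 /m2 /m3 !seg_half; split; exact: cU.
have e1 : cabs (m1 - a) = cabs (b - a) / 2.
  by rewrite -cabs_half /m1; congr cabs; field.
have e2 : cabs (b - m1) = cabs (b - a) / 2.
  by rewrite -cabs_half /m1; congr cabs; field.
have e3 : cabs (m2 - b) = cabs (c - b) / 2.
  by rewrite -cabs_half /m2; congr cabs; field.
have e4 : cabs (c - m2) = cabs (c - b) / 2.
  by rewrite -cabs_half /m2; congr cabs; field.
have e5 : cabs (m3 - c) = cabs (a - c) / 2.
  by rewrite -cabs_half /m3; congr cabs; field.
have e6 : cabs (a - m3) = cabs (a - c) / 2.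
  by rewrite -cabs_half /m3; congr cabs; field.
have e7 : cabs (m2 - m1) = cabs (a - c) / 2.
  by rewrite -cabs_half -cabsN /m1 /m2; congr cabs; field.
have e8 : cabs (m3 - m2) = cabs (b - a) / 2.
  by rewrite -cabs_half -cabsN /m3 /m2; congr cabs; field.
have e9 : cabs (m1 - m3) = cabs (c - b) / 2.
  by rewrite -cabs_half -cabsN /m1 /m3; congr cabs; field.
have s : triangle_int f (a, b, c) = triangle_int f (a, m1, m3) + triangle_int f (m1, b, m2) +
    triangle_int f (m3, m2, c) + triangle_int f (m1, m2, m3).
  rewrite /triangle_int; rewrite (cint_mid (c2 _ _ Ua Ub)) (cint_mid (c2 _ _ Ub Uc)) (cint_mid (c2 _ _ Uc Ua)).
  rewrite -/m1 -/m2 -/m3.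
  rewrite (cint_rev (c2 _ _ U3 U1)) (cint_rev (c2 _ _ U1 U2)) (cint_rev (c2 _ _ U2 U3)).
  by ring.
have := cabsD (triangle_int f (a, m1, m3) + triangle_int f (m1, b, m2) + triangle_int f (m3, m2, c)) (triangle_int f (m1, m2, m3)).
have := cabsD (triangle_int f (a, m1, m3) + triangle_int f (m1, b, m2)) (triangle_int f (m3, m2, c)).
have := cabsD (triangle_int f (a, m1, m3)) (triangle_int f (m1, b, m2)).
rewrite -s => h1 h2 h3.
have [p1 p2 p3] : [/\ 0 <= cabs (b - a), 0 <= cabs (c - b) & 0 <= cabs (a - c)].
  by split; exact: cabs_ge0.
have e1' := cabsBC m3 m1; have e2' := cabsBC m2 m3; have e3' := cabsBC m1 m2.
have e4' := cabsBC m1 b; have e5' := cabsBC m3 a.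
have e6' := cabsBC m2 c.
have ea : cabs (a - a) = 0 by rewrite subrr cabs0.
have [l1|l1] := leP (cabs (triangle_int f (a, b, c))) (4 * cabs (triangle_int f (a, m1, m3))).
  exists (a, m1, m3); split; rewrite /perim //=.
    by rewrite e1 e1' e9 e6; clear -p1 p2 p3; lra.
  by rewrite ea; clear -p1 p2 p3; lra.
have [l2|l2] := leP (cabs (triangle_int f (a, b, c))) (4 * cabs (triangle_int f (m1, b, m2))).
  exists (m1, b, m2); split; rewrite /perim //=.
    by rewrite e2 e3 e3' e7; clear -p1 p2 p3; lra.
  by rewrite e1; clear -p1 p2 p3; lra.
have [l3|l3] := leP (cabs (triangle_int f (a, b, c))) (4 * cabs (triangle_int f (m3, m2, c))).
  exists (m3, m2, c); split; rewrite /perim //=.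
    by rewrite e2' e8 e4 e5; clear -p1 p2 p3; lra.
  by rewrite e5' e6; clear -p1 p2 p3; lra.
exists (m1, m2, m3); split; rewrite /perim //=.
- by rewrite e7 e8 e9; clear -p1 p2 p3; lra.
- by clear -h1 h2 h3 l1 l2 l3; lra.
- by rewrite e1; clear -p1 p2 p3; lra.
Qed.

(** With d n = 2 p / 2^n, a step is at most d n / 2 = d n - d n.+1, so the intervals
    [u n - d n, u n + d n] are nested. The limit is the supremum of their left ends. *)
Lemma geo_cauchy_lim (u : nat -> R) (p : R) :
  (forall n, `|u n.+1 - u n| <= p / 2 ^+ n) ->
  exists l, forall n, `|u n - l| <= 2 * p / 2 ^+ n.
Proof.
move=> H; pose d n := 2 * p / 2 ^+ n.
have dS n : d n.+1 = d n / 2.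
  rewrite /d exprS; field; rewrite expf_neq0 ?pnatr_eq0//.
have dE n : p / 2 ^+ n = d n / 2.
  by rewrite /d; field; rewrite expf_neq0 ?pnatr_eq0.
have Hn n : - (d n / 2) <= u n.+1 - u n <= d n / 2.
  by rewrite -ler_norml -dE.
have p0 : 0 <= p by have := le_trans (normr_ge0 _) (H 0); rewrite expr0 divr1.
have d0 n : 0 <= d n by rewrite /d mulr_ge0 ?invr_ge0 ?exprn_ge0 ?mulr_ge0.
have xle m n : (m <= n)%N -> u m - d m <= u n - d n /\ u n + d n <= u m + d m.
  move=> /subnK <-; elim: (n - m)%N => [//|j [IH1 IH2]].
  rewrite addSn; have := Hn (j + m)%N; rewrite dS; move: (d0 (j + m)%N) => ? /andP[? ?].
  by split; lra.
have xy m n : u m - d m <= u n + d n.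
  have [mn|/ltnW nm] := leqP m n.
    by have [h _] := xle _ _ mn; move: (d0 n) => ?; lra.
  by have [_ h] := xle _ _ nm; move: (d0 m) => ?; lra.
pose X := [set u n - d n | n in [set: nat]].
have X0 : X !=set0 by exists (u 0%N - d 0%N); exists 0%N.
have ub n : ubound X (u n + d n) by move=> _ [m _ <-]; exact: xy.
have hX : has_sup X by split=> //; exists (u 0%N + d 0%N).
exists (sup X) => n.
have h1 : u n - d n <= sup X by apply: sup_upper_bound => //; exists n.
have h2 : sup X <= u n + d n by apply: ge_sup => //; exact: ub.
by rewrite -/(d n) ler_norml; apply/andP; split; lra.
Qed.

Lemma pow2_arch (x r : R) : 0 < r -> exists n, x / 2 ^+ n < r.
Proof.
move=> r0; exists (Num.truncn (x / r)).+1.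
rewrite ltr_pdivrMr ?exprn_gt0// mulrC -ltr_pdivrMr//.
apply: (lt_trans (truncnS_gt _)); rewrite -natrX ltr_nat.
exact: ltn_expl.
Qed.

Lemma le_eps0 (x K : R) : 0 <= x -> 0 <= K -> (forall e, 0 < e -> x <= K * e) -> x = 0.
Proof.
move=> x0 K0 H; apply/eqP; rewrite eq_le x0 andbT leNgt; apply/negP => xp.
have K1 : 0 < K + 1 by lra.
have := H (x / (K + 1)) (divr_gt0 xp K1).
rewrite leNgt => /negP; apply; rewrite mulrA ltr_pdivrMr// mulrC ltr_pM2l//; lra.
Qed.

(** Closedness puts the limit z of the nested triangles in [U]. Near z the function differs from its
    tangent by e |w - z|, which on a triangle of perimeter p / 2^n integrates to O(e p^2 / 4^n);
    this compensates the factor 4^n of the subdivisions. *)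
Theorem goursat (U : set C) (f : C -> C) a b c :
  closed U -> segconvex U -> (forall z, U z -> derivable f z 1) ->
  U a -> U b -> U c -> cint f a b + cint f b c + cint f c a = 0.
Proof.
move=> clU cU df Ua Ub Uc.
have cf z : U z -> {for z, continuous f} by move/df; exact: derivable_contC.
have /choice[nx nxP] T : exists T', triangle_in U T -> [/\ triangle_in U T', perim T' = perim T / 2,
    cabs (triangle_int f T) <= 4 * cabs (triangle_int f T') & cabs (T'.1.1 - T.1.1) <= perim T].
  have [h|h] := pselect (triangle_in U T); last by exists T.
  by have [T' ?] := goursat_step cU cf h; exists T'.
pose T n := iter n nx (a, b, c); pose p := perim (a, b, c).
have T0 : triangle_in U (a, b, c) by [].
have UT n : triangle_in U (T n) by elim: n => [//|n /nxP[]].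
have p0 : 0 <= p by rewrite /p /perim !addr_ge0 ?cabs_ge0.
have pT n : perim (T n) = p / 2 ^+ n.
  elim: n => [|n IH]; first by rewrite expr0 divr1.
  have [_ /= -> _ _] := nxP _ (UT n); rewrite IH exprS; field.
  by rewrite expf_neq0 ?pnatr_eq0.
have tT n : cabs (triangle_int f (a, b, c)) <= 4 ^+ n * cabs (triangle_int f (T n)).
  elim: n => [|n IH]; first by rewrite expr0 mul1r.
  apply: (le_trans IH); rewrite exprSr -mulrA ler_wpM2l ?exprn_ge0//.
  by have [_ _ +] := nxP _ (UT n).
have aT n : cabs ((T n.+1).1.1 - (T n).1.1) <= p / 2 ^+ n.
  by rewrite -pT; have [_ _ _] := nxP _ (UT n).
have [x Hx] := @geo_cauchy_lim (fun n => complex.Re (T n).1.1) p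
  (fun n => le_trans (eq_ind _ (fun z => z <= _) (Re_le_cabs _) _ (congr1 Num.norm (raddfB _ _ _))) (aT n)).
have [y Hy] := @geo_cauchy_lim (fun n => complex.Im (T n).1.1) p
  (fun n => le_trans (eq_ind _ (fun z => z <= _) (Im_le_cabs _) _ (congr1 Num.norm (raddfB _ _ _))) (aT n)).
pose z : C := x +i* y.
have az n : cabs ((T n).1.1 - z) <= 4 * p / 2 ^+ n.
  apply: (le_trans (cabs_le_ReIm _)).
  have := lerD (Hx n) (Hy n); rewrite /z; case: (T n).1.1 => u v /= h.
  by apply: (le_trans h); rewrite le_eqVlt; apply/orP; left; apply/eqP; field;
    rewrite expf_neq0 ?pnatr_eq0.
have Uz : U z.
  apply: clU => B /nbhsCP[r r0 rB].
  have [n np] := pow2_arch (4 * p) r0.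
  exists (T n).1.1; split; first by have [] := UT n.
  by apply: rB; apply: le_lt_trans (az n) _.
have [d dz] := (derivable_cder f z).1 (df _ Uz).
apply/eqP; rewrite -cabs_eq0; apply/eqP.
have p2 : 0 <= p ^+ 2 by rewrite exprn_ge0.
apply: (@le_eps0 _ (12 * p ^+ 2)); [exact: cabs_ge0|lra|].
move=> e e0; have [r r0 rP] := dz _ e0.
(* With q = p / 2^n, the initial vertex of an edge is within 4 q plus one side of z, and the edge
   adds one more side; sides are at most q, so the whole edge is within 6 q. *)
have [n np] := pow2_arch (6 * p) r0.
pose q := p / 2 ^+ n.
have q0 : 0 <= q by rewrite mulr_ge0 ?invr_ge0 ?exprn_ge0.
have e4q : 4 * p / 2 ^+ n = 4 * q by rewrite /q mulrA.
have e6q : 6 * p / 2 ^+ n = 6 * q by rewrite /q mulrA.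
have [Uan Ubn Ucn] := UT n; have := az n; have := pT n; have := tT n.
rewrite e4q -/q; move: np; rewrite e6q.
set an := (T n).1.1 in Uan *; set bn := (T n).1.2 in Ubn *; set cn := (T n).2 in Ucn *.
rewrite /perim -/an -/bn -/cn => qr tn pn an4.
(* The tangent of f at z, whose three edge integrals cancel by [cint_affine]. *)
pose g w := (f z - d * z) + d * w.
have cg w : {for w, continuous g}.
  apply: (@continuousD _ _ _ (cst (f z - d * z) : C -> C) (fun w : C => d * w : C) w).
    exact: cst_continuous.
  by apply: (@continuousM _ _ (cst d : C -> C) id w); [exact: cst_continuous|exact: cvg_id].
have c2 (x1 y1 : C) : U x1 -> U y1 -> forall t : R, 0 <= t <= 1 -> {for seg x1 y1 t, continuous f}.
  by move=> Ux Uy t t01; apply: cf; exact: cU.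
have cfg (x1 y1 : C) : U x1 -> U y1 -> forall t : R, 0 <= t <= 1 -> {for seg x1 y1 t, continuous (fun w => f w - g w)}.
  by move=> Ux Uy t t01; apply: (@continuousB _ _ _ f g); [exact: c2|exact: cg].
have bd (x1 y1 : C) : U x1 -> U y1 -> cabs (x1 - z) + cabs (y1 - x1) <= 6 * q ->
    cabs (cint (fun w => f w - g w) x1 y1) <= 2 * (e * (6 * q)) * cabs (y1 - x1).
  move=> Ux Uy h; apply: cint_bound; first exact: cfg.
  move=> t /andP[t0 t1].
  have h1 : cabs (seg x1 y1 t - z) <= 6 * q.
    have -> : seg x1 y1 t - z = (x1 - z) + t%:C * (y1 - x1) by rewrite /seg; ring.
    apply: (le_trans (cabsD _ _)); apply: (le_trans _ h).
    by rewrite lerD2l cabsM cabsr ger0_norm// ler_piMl// cabs_ge0.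
  have -> : f (seg x1 y1 t) - g (seg x1 y1 t) =
    f (seg x1 y1 t) - f z - d * (seg x1 y1 t - z) by rewrite /g; ring.
  apply: (le_trans (rP _ _)); first exact: le_lt_trans qr.
  by rewrite ler_wpM2l// ltW.
have tE : triangle_int f (T n) = cint (fun w => f w - g w) an bn + cint (fun w => f w - g w) bn cn
   + cint (fun w => f w - g w) cn an.
  rewrite (cintB (c2 _ _ Uan Ubn) (fun t _ => cg _)) (cintB (c2 _ _ Ubn Ucn) (fun t _ => cg _)) (cintB (c2 _ _ Ucn Uan) (fun t _ => cg _)).
  by rewrite /g !cint_affine /triangle_int -/an -/bn -/cn; ring.
move: pn; set A := cabs (bn - an); set B := cabs (cn - bn); set D := cabs (an - cn) => pn.
have [A0 B0 D0] : [/\ 0 <= A, 0 <= B & 0 <= D] by split; exact: cabs_ge0.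
have hb : cabs (bn - z) <= 4 * q + A.
  have := cabsD (an - z) (bn - an); rewrite -/A (_ : an - z + (bn - an) = bn - z); [by clear -an4; lra|by ring].
have hc : cabs (cn - z) <= 4 * q + D.
  have := cabsD (an - z) (cn - an); rewrite (cabsBC cn an) -/D (_ : an - z + (cn - an) = cn - z); [by clear -an4; lra|by ring].
have h1 := bd an bn Uan Ubn ltac:(rewrite -/A; clear -an4 pn A0 B0 D0 q0; lra).
have h2 := bd bn cn Ubn Ucn ltac:(rewrite -/B; clear -hb pn A0 B0 D0 q0; lra).
have h3 := bd cn an Ucn Uan ltac:(rewrite -/D; clear -hc pn A0 B0 D0 q0; lra).
have tb : cabs (triangle_int f (T n)) <= 2 * (e * (6 * q)) * q.
  rewrite tE; apply: (le_trans (cabsD _ _)).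
  have := cabsD (cint (fun w => f w - g w) an bn) (cint (fun w => f w - g w) bn cn).
  move: h1 h2 h3; rewrite -/A -/B -/D => h1 h2 h3 h4.
  have -> : 2 * (e * (6 * q)) * q = 2 * (e * (6 * q)) * A + 2 * (e * (6 * q)) * B + 2 * (e * (6 * q)) * D.
    by rewrite -!mulrDr pn.
  by clear -h1 h2 h3 h4; lra.
apply: (le_trans tn).
apply: (@le_trans _ _ (4 ^+ n * (2 * (e * (6 * q)) * q))).
  by rewrite ler_wpM2l ?exprn_ge0.
have -> : 4 ^+ n = 2 ^+ n * 2 ^+ n :> R by rewrite -exprMn; congr (_ ^+ _); ring.
rewrite le_eqVlt; apply/orP; left; apply/eqP; rewrite /q; field.
by rewrite expf_neq0 ?pnatr_eq0.
Qed.

End Modulus.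

Local Arguments triangle_int : simpl never.
Local Arguments seg : simpl never.
Local Arguments cint01 : simpl never.

(** * Cauchy estimates on squares, primitives, periodic functions *)

Section Cauchy.
Context {R : realType}.
Local Notation C := (Cplx R).
Local Notation mu := (@lebesgue_measure R).

(** * Integrals over the boundary of a square *)

Definition boxC (a b c d : R) : set C :=
  [set z | a <= complex.Re z <= b /\ c <= complex.Im z <= d].

Lemma boxC_closed a b c d : closed (boxC a b c d).
Proof.
have -> : boxC a b c d = ((fun z : C => complex.Re z) @^-1` `[a, b])
    `&` ((fun z : C => complex.Im z) @^-1` `[c, d]).
  by apply/seteqP; split=> z; rewrite /boxC /= !in_itv.
apply: closedI; apply: preimage_closed; try exact: interval_closed.
- by move=> z _; exact: continuous_Re.
- by move=> z _; exact: continuous_Im.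
Qed.

Lemma seg_Re (a b : C) t : complex.Re (seg a b t) =
  complex.Re a + t * (complex.Re b - complex.Re a).
Proof. by case: a b => [? ?] [? ?]; rewrite /seg /=; ring. Qed.

Lemma seg_Im (a b : C) t : complex.Im (seg a b t) =
  complex.Im a + t * (complex.Im b - complex.Im a).
Proof. by case: a b => [? ?] [? ?]; rewrite /seg /=; ring. Qed.

Lemma convex_itv (a b x y t : R) : a <= x <= b -> a <= y <= b -> 0 <= t <= 1 ->
  a <= x + t * (y - x) <= b.
Proof. by move=> /andP[? ?] /andP[? ?] /andP[? ?]; apply/andP; split; nra. Qed.

Lemma boxC_convex a b c d : segconvex (boxC a b c d).
Proof.
move=> x y t [x1 x2] [y1 y2] t01; split.
  by rewrite seg_Re; exact: convex_itv.
by rewrite seg_Im; exact: convex_itv.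
Qed.

(** The triangles A B b and A b a share the diagonal from A to b; Goursat's lemma applies to
    both. *)
Lemma trapezoid (U : set C) (f : C -> C) A B a b :
  closed U -> segconvex U -> (forall z, U z -> derivable f z 1) ->
  U A -> U B -> U a -> U b ->
  cint f A B = cint f A a + cint f a b - cint f B b.
Proof.
move=> clU cU df UA UB Ua Ub.
have c2 (x y : C) : U x -> U y -> forall t : R, 0 <= t <= 1 -> {for seg x y t, continuous f}.
  by move=> Ux Uy t t01; apply: derivable_contC; apply: df; exact: cU.
have h1 := goursat clU cU df UA UB Ub.
have h2 := goursat clU cU df UA Ub Ua.
have h3 := cint_rev (c2 _ _ Ub UA).
have h4 := cint_rev (c2 _ _ Ub Ua).
have h5 := cint_rev (c2 _ _ Ua UA).
rewrite h4 h5.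
have -> : cint f A B = (cint f A B + cint f B b + cint f b A)
   + (cint f A b + cint f b a + cint f a A) - cint f B b - cint f b a - cint f a A.
  by rewrite h3; ring.
by rewrite h1 h2; ring.
Qed.

(** Counterclockwise from the lower left corner. The default case identifies corner 4 with corner 0,
    so the four sides in [sqint] close up. *)
Definition unit_corner (j : nat) : C :=
  match j with
  | 1%N => 1 +i* -1 | 2%N => 1 +i* 1 | 3%N => (-1) +i* 1 | _ => (-1) +i* -1
  end.

Definition corner (z0 : C) (s : R) j : C := z0 + s%:C * unit_corner j.

Definition sqint (f : C -> C) (z0 : C) (s : R) : C :=
  \sum_(j < 4) cint f (corner z0 s j) (corner z0 s j.+1).

Definition sqbox (z0 : C) (s : R) : set C :=
  boxC (complex.Re z0 - s) (complex.Re z0 + s) (complex.Im z0 - s) (complex.Im z0 + s).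

Definition onsq (z0 : C) (s : R) (w : C) : Prop :=
  sqbox z0 s w /\ (`|complex.Re (w - z0)| = s \/ `|complex.Im (w - z0)| = s).

Lemma edge_onsq z0 (s : R) j (t : R) : 0 <= s -> (j < 4)%N -> 0 <= t <= 1 ->
  onsq z0 s (seg (corner z0 s j) (corner z0 s j.+1) t).
Proof.
case: z0 => x y s0 + /andP[t0 t1].
rewrite /onsq /sqbox /boxC /seg /corner; case: j => [|[|[|[|//]]]] _ /=.
- by split; [split; apply/andP; split; nra|right; rewrite -[RHS]ger0_norm// -[RHS]normrN; congr `|_|; ring].
- by split; [split; apply/andP; split; nra|left; rewrite -[RHS]ger0_norm//; congr `|_|; ring].
- by split; [split; apply/andP; split; nra|right; rewrite -[RHS]ger0_norm//; congr `|_|; ring].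
- by split; [split; apply/andP; split; nra|left; rewrite -[RHS]ger0_norm// -[RHS]normrN; congr `|_|; ring].
Qed.

Lemma onsq_dist z0 s w : onsq z0 s w -> s <= cabs (w - z0).
Proof.
by case=> _ [<-|<-]; [exact: Re_le_cabs|exact: Im_le_cabs].
Qed.

Lemma edge_len z0 (s : R) j : 0 <= s -> (j < 4)%N ->
  cabs (corner z0 s j.+1 - corner z0 s j) <= 2 * s.
Proof.
move=> s0 j4; have -> : corner z0 s j.+1 - corner z0 s j = s%:C * (unit_corner j.+1 - unit_corner j).
  by rewrite /corner; ring.
rewrite cabsM cabsr ger0_norm// mulrC ler_wpM2r//.
apply: (le_trans (cabs_le_ReIm _)).
by case: j j4 => [|[|[|[|//]]]] _ /=; rewrite ?subrr ?normr0 ?addr0 ?add0r ?opprK ?normrN;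
  rewrite -?opprD ?normrN ger0_norm.
Qed.

Lemma edge_cont (f : C -> C) z0 s j : 0 <= s -> (j < 4)%N ->
  (forall w, onsq z0 s w -> {for w, continuous f}) ->
  forall t : R, 0 <= t <= 1 -> {for seg (corner z0 s j) (corner z0 s j.+1) t, continuous f}.
Proof. by move=> s0 j4 cf t t01; apply: cf; exact: edge_onsq. Qed.

(** There are 4 sides of length 2 s, and [cint_bound] contributes another factor 2. *)
Lemma sqint_bound (f : C -> C) z0 s M : 0 <= s ->
  (forall w, onsq z0 s w -> {for w, continuous f}) ->
  (forall w, onsq z0 s w -> cabs (f w) <= M) ->
  cabs (sqint f z0 s) <= 16 * M * s.
Proof.
move=> s0 cf fM.
have E j : (j < 4)%N -> cabs (cint f (corner z0 s j) (corner z0 s j.+1)) <= 4 * M * s.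
  move=> j4; apply: (le_trans (cint_bound (edge_cont s0 j4 cf) (M := M) _)).
    by move=> t t01; apply: fM; exact: edge_onsq.
  have M0 : 0 <= M.
    by apply: (le_trans (cabs_ge0 _)); apply: fM; apply: (@edge_onsq _ _ j 0) => //; rewrite lexx ler01.
  have := edge_len z0 s0 j4; set l := cabs _ => h.
  have : 2 * M * l <= 2 * M * (2 * s) by rewrite ler_wpM2l// mulr_ge0.
  by lra.
rewrite /sqint; apply: (le_trans (cabs_sum _ _ _)).
apply: (@le_trans _ _ (\sum_(j < 4) 4 * M * s)).
  by apply: ler_sum => j _; exact: E (ltn_ord j).
by rewrite !big_ord_recr big_ord0 /=; lra.
Qed.

Lemma sqintB (f g : C -> C) z0 s : 0 <= s ->
  (forall w, onsq z0 s w -> {for w, continuous f}) ->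
  (forall w, onsq z0 s w -> {for w, continuous g}) ->
  sqint (fun w => f w - g w) z0 s = sqint f z0 s - sqint g z0 s.
Proof.
move=> s0 cf cg; rewrite /sqint -sumrB; apply: eq_bigr => j _.
exact: (cintB (edge_cont s0 (ltn_ord j) cf) (edge_cont s0 (ltn_ord j) cg)).
Qed.

Lemma cintZ (f : C -> C) k a b :
  (forall t : R, 0 <= t <= 1 -> {for seg a b t, continuous f}) ->
  cint (fun w => k * f w) a b = k * cint f a b.
Proof.
move=> cf; rewrite !cintE -cint01Z; last exact: (cont01M (cont01_seg cf) (cont01_cst _)).
by apply: eq_cint01 => t _; rewrite mulrA.
Qed.

Lemma sqintZ (f : C -> C) k z0 s : 0 <= s ->
  (forall w, onsq z0 s w -> {for w, continuous f}) ->
  sqint (fun w => k * f w) z0 s = k * sqint f z0 s.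
Proof.
move=> s0 cf; rewrite /sqint mulr_sumr; apply: eq_bigr => j _.
exact: (cintZ _ (edge_cont s0 (ltn_ord j) cf)).
Qed.

(** The region between the squares is cut into four trapezoids by joining corresponding corners. The
    rectangles [U j], below, right of, above and left of the small square, are convex, avoid w1 and
    contain one trapezoid each; the joining segments cancel in the sum. *)
Lemma sqint_deform (f : C -> C) z0 S w1 e :
  0 < e -> complex.Re z0 - S <= complex.Re w1 - e ->
  complex.Re w1 + e <= complex.Re z0 + S ->
  complex.Im z0 - S <= complex.Im w1 - e ->
  complex.Im w1 + e <= complex.Im z0 + S ->
  (forall w, sqbox z0 S w -> w != w1 -> derivable f w 1) ->
  sqint f z0 S = sqint f w1 e.
Proof.
move=> e0 h1 h2 h3 h4 df.
pose U j : set C := match j with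
 | 0%N => boxC (complex.Re z0 - S) (complex.Re z0 + S) (complex.Im z0 - S) (complex.Im w1 - e)
 | 1%N => boxC (complex.Re w1 + e) (complex.Re z0 + S) (complex.Im z0 - S) (complex.Im z0 + S)
 | 2%N => boxC (complex.Re z0 - S) (complex.Re z0 + S) (complex.Im w1 + e) (complex.Im z0 + S)
 | _ => boxC (complex.Re z0 - S) (complex.Re w1 - e) (complex.Im z0 - S) (complex.Im z0 + S)
 end.
have T j : (j < 4)%N -> cint f (corner z0 S j) (corner z0 S j.+1) =
   cint f (corner z0 S j) (corner w1 e j) + cint f (corner w1 e j) (corner w1 e j.+1)
   - cint f (corner z0 S j.+1) (corner w1 e j.+1).
  move=> j4; apply: (@trapezoid (U j)).
  - by case: j j4 => [|[|[|[|//]]]] _ /=; exact: boxC_closed.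
  - by case: j j4 => [|[|[|[|//]]]] _ /=; exact: boxC_convex.
  - move=> z Uz; apply: df.
      by case: j j4 Uz => [|[|[|[|//]]]] _ /= [/andP[? ?] /andP[? ?]]; split; apply/andP; split; lra.
    apply/eqP => zw; move: Uz; rewrite zw.
    by case: j j4 => [|[|[|[|//]]]] _ /= [/andP[? ?] /andP[? ?]]; lra.
  - case: j j4 => [|[|[|[|//]]]] _ /=; rewrite /boxC /corner; clear -e0 h1 h2 h3 h4;
    case: z0 w1 h1 h2 h3 h4 => [x y] [u v] /= h1 h2 h3 h4; split; apply/andP; split; lra.
  - case: j j4 => [|[|[|[|//]]]] _ /=; rewrite /boxC /corner; clear -e0 h1 h2 h3 h4;
    case: z0 w1 h1 h2 h3 h4 => [x y] [u v] /= h1 h2 h3 h4; split; apply/andP; split; lra.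
  - case: j j4 => [|[|[|[|//]]]] _ /=; rewrite /boxC /corner; clear -e0 h1 h2 h3 h4;
    case: z0 w1 h1 h2 h3 h4 => [x y] [u v] /= h1 h2 h3 h4; split; apply/andP; split; lra.
  - case: j j4 => [|[|[|[|//]]]] _ /=; rewrite /boxC /corner; clear -e0 h1 h2 h3 h4;
    case: z0 w1 h1 h2 h3 h4 => [x y] [u v] /= h1 h2 h3 h4; split; apply/andP; split; lra.
rewrite /sqint (eq_bigr _ (fun (j : 'I_4) _ => T j (ltn_ord j))) sumrB big_split /=.
rewrite addrAC -[RHS]add0r; congr (_ + _).
rewrite !big_ord_recr !big_ord0 /=.
have -> : corner z0 S 4 = corner z0 S 0 by [].
have -> : corner w1 e 4 = corner w1 e 0 by [].
by ring.
Qed.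

(* This is 2 pi i, but only csq <> 0 matters. *)
Definition csq : C := sqint (fun w => w^-1) 0 1.

Lemma continuous_inv_at (a w : C) : w != a -> {for w, continuous (fun w : C => (w - a)^-1)}.
Proof.
move=> wa; apply: (@continuousV _ _ (fun w : C => w - a) w).
  by rewrite subr_eq0.
by apply: (@continuousB _ _ _ id (cst a : C -> C) w); [exact: cvg_id|exact: cst_continuous].
Qed.

Lemma seg_corner_neq0 j (t : R) : (j < 4)%N -> 0 <= t <= 1 -> seg (unit_corner j) (unit_corner j.+1) t != 0.
Proof.
move=> j4 t01; have := @edge_onsq 0 1 j t ler01 j4 t01.
rewrite /corner !add0r !mul1r => /onsq_dist; rewrite subr0.
by apply: contraTneq => ->; rewrite cabs0 -ltNge ltr01.
Qed.

(** The form dw / (w - w1) is invariant under homotheties centred at w1. *)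
Lemma sqint_inv w1 e : 0 < e -> sqint (fun w => (w - w1)^-1) w1 e = csq.
Proof.
move=> e0; rewrite /csq /sqint.
have e0' : (e%:C : C) != 0 by rewrite -cabs_eq0 cabsr normr_eq0 gt_eqF.
have E j : (j < 4)%N -> cint (fun w => (w - w1)^-1) (corner w1 e j) (corner w1 e j.+1)
    = cint (fun w => w^-1) (corner 0 1 j) (corner 0 1 j.+1).
  move=> j4; rewrite !cintE; apply: eq_cint01 => t t01.
  have h := seg_corner_neq0 j4 t01.
  have -> : seg (corner w1 e j) (corner w1 e j.+1) t - w1 = e%:C * seg (unit_corner j) (unit_corner j.+1) t.
    by rewrite /seg /corner; ring.
  have -> : seg (corner 0 1 j) (corner 0 1 j.+1) t = seg (unit_corner j) (unit_corner j.+1) t.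
    by rewrite /seg /corner; ring.
  have -> : corner w1 e j.+1 - corner w1 e j = e%:C * (unit_corner j.+1 - unit_corner j) by rewrite /corner; ring.
  have -> : corner 0 1 j.+1 - corner 0 1 j = unit_corner j.+1 - unit_corner j by rewrite /corner; ring.
  by field; rewrite e0' h.
by apply: eq_bigr => j _; exact: E (ltn_ord j).
Qed.

(** Multiplication by i permutes the sides and preserves dw / w, so [csq] is four times the integral
    along the bottom side. Its integrand there is 2 / (x - i), with imaginary part 2 / (x^2 + 1) >=
    1 for |x| <= 1. *)
Lemma csq_neq0 : csq != 0.
Proof.
have E j : (j < 4)%N -> cint (fun w => w^-1) (corner 0 1 j) (corner 0 1 j.+1)
    = cint (fun w => w^-1) (unit_corner 0) (unit_corner 1).
  move=> j4; rewrite !cintE; apply: eq_cint01 => t t01.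
  have -> : seg (corner 0 1 j) (corner 0 1 j.+1) t = seg (unit_corner j) (unit_corner j.+1) t.
    by rewrite /seg /corner; ring.
  have -> : corner 0 1 j.+1 - corner 0 1 j = unit_corner j.+1 - unit_corner j by rewrite /corner; ring.
  have h := seg_corner_neq0 j4 t01; have h0 := seg_corner_neq0 (isT : (0 < 4)%N) t01.
  apply: (mulfI h0); apply: (mulfI h).
  rewrite !mulrA (mulrC (seg (unit_corner j) _ _) (seg (unit_corner 0) _ _)) mulfK// mulrC -[RHS]mulrA.
  rewrite [RHS]mulrA mulfK//.
  clear h h0.
  by case: j j4 => [|[|[|[|//]]]] _; rewrite /seg /unit_corner; apply/eqP; rewrite eq_complex /=; apply/andP; split; apply/eqP; ring.
have -> : csq = 4 * cint (fun w => w^-1) (unit_corner 0) (unit_corner 1).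
  rewrite /csq /sqint (eq_bigr _ (fun (j : 'I_4) _ => E j (ltn_ord j))).
  by rewrite sumr_const card_ord mulr_natl.
rewrite mulf_neq0 ?pnatr_eq0//.
have ImCI g : complex.Im (cint01 g) = (\int[mu]_(t in `[0%R, 1%R]) complex.Im (g t))%R by [].
suff h : complex.Im (cint (fun w => w^-1) (unit_corner 0) (unit_corner 1)) != 0.
  by apply: contraNneq h => ->.
rewrite cintE ImCI.
rewrite gt_eqF//; apply: (@lt_le_trans _ _ 1) => //.
have c1 : cont01 (fun t => (seg (unit_corner 0) (unit_corner 1) t)^-1 * (unit_corner 1 - unit_corner 0)).
  apply: cont01M; last exact: cont01_cst.
  apply: cont01V.
    by split=> t _; exact: continuous_seg.
  by move=> t; exact: seg_corner_neq0.
apply: (@le_trans _ _ (\int[mu]_(t in `[0%R, 1%R]) (cst 1 : R -> R) t)%R).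
  by rewrite Rintegral_cst// mu01 mulr1.
apply: le_Rintegral => //.
- by apply: int01 => t _; exact: cst_continuous.
- by apply: int01; exact: (cont01_Im c1).
- move=> t /=; rewrite in_itv/= => /andP[t0 t1].
  rewrite /seg /=.
  set x := (X in X ^+ 2 + _); set y := (X in _ + X ^+ 2).
  have ye : y = -1 by rewrite /y; ring.
  have xe : x = 2 * t - 1 by rewrite /x; ring.
  have x2 : x ^+ 2 <= 1 by rewrite xe; nra.
  have D0 : 0 < x ^+ 2 + y ^+ 2 by rewrite ye; nra.
  have D1 : x ^+ 2 + y ^+ 2 <= 2 by rewrite ye; nra.
  have h1 : 2^-1 <= (x ^+ 2 + y ^+ 2)^-1 by rewrite lef_pV2 ?posrE.
  rewrite -/x -/y ye in h1 *; set q := (x ^+ 2 + (-1) ^+ 2)^-1 in h1 *.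
  lra.
Qed.

Lemma sqbox_cabs z0 S w : cabs (w - z0) <= S -> sqbox z0 S w.
Proof.
move=> h; have := le_trans (Re_le_cabs _) h; have := le_trans (Im_le_cabs _) h.
rewrite !raddfB /= !ler_norml => /andP[? ?] /andP[? ?].
by split; apply/andP; split; lra.
Qed.

Lemma sqbox_dist z0 S w : sqbox z0 S w -> cabs (w - z0) <= 2 * S.
Proof.
move=> [/andP[a b] /andP[c d]]; apply: (le_trans (cabs_le_ReIm _)).
rewrite !raddfB /= mulr2n mulrDl mul1r lerD// ler_norml; apply/andP; split; lra.
Qed.

Lemma sqbox_center z0 S : 0 <= S -> sqbox z0 S z0.
Proof. by move=> S0; apply: sqbox_cabs; rewrite subrr cabs0. Qed.

Lemma sub_sqbox z0 S w e : cabs (w - z0) + 2 * e <= S -> 0 <= e -> sqbox w e `<=` sqbox z0 S.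
Proof.
move=> h e0 z /sqbox_dist hz; apply: sqbox_cabs.
rewrite -(subrK w z) -addrA; apply: (le_trans (cabsD _ _)); lra.
Qed.

Lemma onsq_contM (f g : C -> C) z0 S :
  (forall w, onsq z0 S w -> {for w, continuous f}) ->
  (forall w, onsq z0 S w -> {for w, continuous g}) ->
  forall w, onsq z0 S w -> {for w, continuous (fun w => f w * g w)}.
Proof. by move=> cf cg w ow; apply: continuousM; [exact: cf|exact: cg]. Qed.

Lemma onsq_neq z0 S w w1 : cabs (w1 - z0) < S -> onsq z0 S w -> w != w1.
Proof. by move=> h /onsq_dist h2; apply: contraTneq h => <-; rewrite -leNgt. Qed.

Lemma onsq_inv z0 S w w1 : cabs (w1 - z0) < S -> onsq z0 S w ->
  cabs (w - w1)^-1 <= (S - cabs (w1 - z0))^-1.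
Proof.
move=> h ow; have hd := onsq_dist ow.
have h0 : 0 < S - cabs (w1 - z0) by rewrite subr_gt0.
have : S - cabs (w1 - z0) <= cabs (w - w1).
  have := cabsD (w - w1) (w1 - z0); rewrite addrA subrK; lra.
move=> h1; rewrite cabsV lef_pV2// posrE//; exact: lt_le_trans h1.
Qed.

Lemma onsq_cont_inv z0 S w1 : cabs (w1 - z0) < S ->
  forall w, onsq z0 S w -> {for w, continuous (fun w : C => (w - w1)^-1)}.
Proof. by move=> h w ow; apply: continuous_inv_at; exact: onsq_neq ow. Qed.

Lemma derivable_inv (a w : C) : w != a -> derivable (fun w : C => (w - a)^-1) w 1.
Proof.
move=> wa; apply: (@derivableV _ _ (fun w : C => w - a)); first by rewrite subr_eq0.
by apply: (@derivableB _ _ _ id (cst a)); [exact: derivable_id|exact: derivable_cst].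
Qed.

(** The contour is shrunk to a square of half-side e about w1. There f differs from f(w1) by at most
    eta and the kernel is at most 1 / e, while [sqint_bound] contributes 16 e: the error is 16
    eta. *)
Lemma cauchy_formula (f : C -> C) z0 S w1 :
  (forall w, sqbox z0 S w -> derivable f w 1) -> cabs (w1 - z0) < S ->
  csq * f w1 = sqint (fun w => f w * (w - w1)^-1) z0 S.
Proof.
move=> df h; pose D := S - cabs (w1 - z0).
have D0 : 0 < D by rewrite subr_gt0.
apply/eqP; rewrite -subr_eq0 -cabs_eq0; apply/eqP.
apply: (@le_eps0 _ _ 16); rewrite ?cabs_ge0// => eta eta0.
have bw1 : sqbox z0 S w1 by apply: sqbox_cabs; exact: ltW.
have cf1 := derivable_contC (df _ bw1).
have [d d0 dP] := (contCP f w1).1 cf1 _ eta0.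
(* Points of the small square are within 2 e of w1, hence within d of w1 and inside the large
   square. *)
pose e := Num.min (d / 3) (D / 3).
have e0 : 0 < e by rewrite lt_min !divr_gt0.
have ed : 3 * e <= d by rewrite -ler_pdivlMl// mulrC ge_min lexx.
have eD : 3 * e <= D by rewrite -ler_pdivlMl// mulrC ge_min lexx orbT.
have sub : sqbox w1 e `<=` sqbox z0 S.
  by apply: sub_sqbox; [rewrite /D in eD; lra|exact: ltW].
have := Re_le_cabs (w1 - z0); have := Im_le_cabs (w1 - z0).
rewrite !raddfB /= !ler_norml => /andP[? ?] /andP[? ?]; move: (eD); rewrite /D => eD'.
have g1 : complex.Re z0 - S <= complex.Re w1 - e by lra.
have g2 : complex.Re w1 + e <= complex.Re z0 + S by lra.
have g3 : complex.Im z0 - S <= complex.Im w1 - e by lra.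
have g4 : complex.Im w1 + e <= complex.Im z0 + S by lra.
have ce w : onsq w1 e w -> {for w, continuous f}.
  by case=> ow _; apply: derivable_contC; apply: df; exact: sub.
have w1e : cabs (w1 - w1) < e by rewrite subrr cabs0.
have ci := onsq_cont_inv w1e.
have cst1 w : onsq w1 e w -> {for w, continuous (cst (f w1) : C -> C)}.
  by move=> _; exact: cst_continuous.
have dfi w : sqbox z0 S w -> w != w1 -> derivable (fun w => f w * (w - w1)^-1) w 1.
  move=> bw ww1; apply: (@derivableM _ _ f (fun w => (w - w1)^-1)); first exact: df.
  exact: derivable_inv.
rewrite (sqint_deform e0 g1 g2 g3 g4 dfi).
have -> : csq * f w1 = sqint (fun w => f w1 * (w - w1)^-1) w1 e.
  by rewrite (sqintZ _ (ltW e0) ci) (sqint_inv _ e0) mulrC.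
rewrite -(sqintB (ltW e0) (onsq_contM cst1 ci) (onsq_contM ce ci)).
have -> : 16 * eta = 16 * (eta * e^-1) * e.
  by rewrite -!mulrA mulVf ?mulr1// gt_eqF.
apply: sqint_bound; first exact: ltW.
  move=> w ow; apply: continuousB; first exact: (onsq_contM cst1 ci).
  exact: (onsq_contM ce ci).
move=> w ow; rewrite -mulrBl cabsM ler_pM ?cabs_ge0//.
  rewrite cabsBC; apply: ltW; apply: dP.
  by case: ow => /sqbox_dist ow _; apply: (le_lt_trans ow); lra.
by have := onsq_inv w1e ow; rewrite subrr cabs0 subr0.
Qed.

(** In the difference of the two Cauchy formulas the kernel is (w - z0) / ((v - w) (v - z0)), and |v
    - w| >= S / 2, |v - z0| >= S on the contour. So 32 is 16 from [sqint_bound] times 2. *)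
Lemma cauchy_estimate (f : C -> C) z0 S M w :
  0 < S -> (forall w, sqbox z0 S w -> derivable f w 1) ->
  (forall w, onsq z0 S w -> cabs (f w) <= M) -> cabs (w - z0) <= S / 2 ->
  cabs (f w - f z0) <= 32 / cabs csq * M * cabs (w - z0) / S.
Proof.
move=> S0 df fM wS.
have wS1 : cabs (w - z0) < S by apply: (le_lt_trans wS); lra.
have zS : cabs (z0 - z0) < S by rewrite subrr cabs0.
have cf v : onsq z0 S v -> {for v, continuous f}.
  by case=> bv _; apply: derivable_contC; exact: df.
have c1 := onsq_contM cf (onsq_cont_inv wS1).
have c2 := onsq_contM cf (onsq_cont_inv zS).
have e : csq * (f w - f z0) = sqint (fun v => f v * (v - w)^-1 - f v * (v - z0)^-1) z0 S.
  by rewrite mulrBr (cauchy_formula df wS1) (cauchy_formula df zS) (sqintB (ltW S0) c1 c2).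
have q0 : 0 < cabs csq by rewrite cabs_gt0 csq_neq0.
have -> : 32 / cabs csq * M * cabs (w - z0) / S
   = (cabs csq)^-1 * (16 * (M * (cabs (w - z0) * (2 / S) * S^-1)) * S).
  by field; rewrite !gt_eqF.
rewrite -ler_pdivrMl ?invr_gt0// invrK -cabsM e.
apply: sqint_bound; first exact: ltW.
  by move=> v ov; apply: continuousB; [exact: c1|exact: c2].
move=> v ov; rewrite -mulrBr cabsM ler_pM ?cabs_ge0//; first exact: fM.
have vw : v - w != 0 by rewrite subr_eq0; exact: onsq_neq ov.
have vz : v - z0 != 0 by rewrite subr_eq0; exact: onsq_neq ov.
have -> : (v - w)^-1 - (v - z0)^-1 = (w - z0) * (v - w)^-1 * (v - z0)^-1.
  by field; rewrite vw vz.
rewrite !cabsM; apply: ler_pM; rewrite ?cabs_ge0 ?mulr_ge0 ?cabs_ge0//.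
  rewrite ler_wpM2l ?cabs_ge0//; apply: (le_trans (onsq_inv wS1 ov)).
  have -> : 2 / S = (S / 2)^-1 by rewrite invf_div.
  by rewrite lef_pV2 ?posrE; lra.
by apply: (le_trans (onsq_inv zS ov)); rewrite subrr cabs0 subr0.
Qed.

(** Cauchy's formula passes to the uniform limit P, with kernels bounded for each fixed w. A
    continuous bounded P that satisfies the formula is differentiable, since the kernel can be
    differentiated explicitly. *)
Lemma holomorphic_limit (P : C -> C) z0 S M : 0 < S ->
  (forall w, sqbox z0 S w -> {for w, continuous P}) ->
  (forall w, sqbox z0 S w -> cabs (P w) <= M) ->
  (forall e : R, 0 < e -> exists2 f : C -> C,
     (forall w, sqbox z0 S w -> derivable f w 1) &
     forall w, sqbox z0 S w -> cabs (f w - P w) <= e) ->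
  derivable P z0 1.
Proof.
move=> S0 cP PM app.
have q0 : 0 < cabs csq by rewrite cabs_gt0 csq_neq0.
have cP' w : onsq z0 S w -> {for w, continuous P} by case=> + _; exact: cP.
have F w : cabs (w - z0) < S -> csq * P w = sqint (fun v => P v * (v - w)^-1) z0 S.
  move=> wS; apply/eqP; rewrite -subr_eq0 -cabs_eq0; apply/eqP.
  have D0 : 0 < S - cabs (w - z0) by rewrite subr_gt0.
  apply: (@le_eps0 _ _ (cabs csq + 16 * (S - cabs (w - z0))^-1 * S)).
  - exact: cabs_ge0.
  - by rewrite addr_ge0 ?cabs_ge0// !mulr_ge0 ?invr_ge0// ltW.
  move=> e e0; have [f df fP] := app _ e0.
  have cf v : onsq z0 S v -> {for v, continuous f}.
    by case=> bv _; apply: derivable_contC; exact: df.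
  have c1 := onsq_contM cf (onsq_cont_inv wS).
  have c2 := onsq_contM cP' (onsq_cont_inv wS).
  have -> : csq * P w - sqint (fun v => P v * (v - w)^-1) z0 S =
      sqint (fun v => f v * (v - w)^-1 - P v * (v - w)^-1) z0 S - csq * (f w - P w).
    by rewrite (sqintB (ltW S0) c1 c2) -(cauchy_formula df wS); ring.
  apply: (le_trans (cabsB _ _)); rewrite mulrDl addrC lerD//.
    rewrite cabsM ler_wpM2l ?cabs_ge0//; apply: fP; apply: sqbox_cabs; exact: ltW.
  have -> : 16 * (S - cabs (w - z0))^-1 * S * e = 16 * (e * (S - cabs (w - z0))^-1) * S by ring.
  apply: sqint_bound; first exact: ltW.
    by move=> v ov; apply: continuousB; [exact: c1|exact: c2].
  move=> v ov; rewrite -mulrBl cabsM ler_pM ?cabs_ge0//.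
    by apply: fP; case: ov.
  exact: onsq_inv.
have zS : cabs (z0 - z0) < S by rewrite subrr cabs0.
have c0 := onsq_cont_inv zS.
have c3 := onsq_contM (onsq_contM cP' c0) c0.
(* The derivative of the kernel at w = z0; the remainder of the kernel is (w - z0)^2 / ((v - w) (v -
   z0)^2), quadratic in w - z0. *)
pose D := csq^-1 * sqint (fun v => P v * (v - z0)^-1 * (v - z0)^-1) z0 S.
apply/derivable_cder; exists D => e e0.
have M0 : 0 <= M by apply: (le_trans (cabs_ge0 (P z0))); apply: PM; apply: sqbox_center; exact: ltW.
pose K := 32 / cabs csq * M / S ^+ 2 + 1.
have K1 : 0 <= 32 / cabs csq * M / S ^+ 2.
  by rewrite !mulr_ge0 ?invr_ge0 ?exprn_ge0 ?cabs_ge0 ?(ltW S0).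
have K0 : 0 < K by rewrite /K; lra.
exists (Num.min (S / 2) (e / K)); first by rewrite lt_min !divr_gt0.
move=> w; rewrite lt_min => /andP[w1 w2].
have wS : cabs (w - z0) < S by apply: (lt_trans w1); lra.
have ciw := onsq_cont_inv wS.
have c4 := onsq_contM cP' ciw.
have c5 := onsq_contM cP' c0.
have cw : forall v, onsq z0 S v -> {for v, continuous (cst (w - z0) : C -> C)}.
  by move=> v _; exact: cst_continuous.
have c6 := onsq_contM cw c3.
have c45 v : onsq z0 S v -> {for v, continuous (fun v => P v * (v - w)^-1 - P v * (v - z0)^-1)}.
  by move=> ov; apply: continuousB; [exact: c4|exact: c5].
have E : P w - P z0 - D * (w - z0) = csq^-1 *
   sqint (fun v => (P v * (v - w)^-1 - P v * (v - z0)^-1) - (w - z0) * (P v * (v - z0)^-1 * (v - z0)^-1)) z0 S.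
  rewrite (sqintB (ltW S0) c45 c6) (sqintB (ltW S0) c4 c5) (sqintZ _ (ltW S0) c3) -(F _ wS) -(F _ zS) /D.
  by field; exact: csq_neq0.
have bd : cabs (P w - P z0 - D * (w - z0)) <= K * cabs (w - z0) * cabs (w - z0).
  rewrite E cabsM cabsV.
  apply: (@le_trans _ _ ((cabs csq)^-1 * (16 * (M * (cabs (w - z0) * cabs (w - z0) * (2 / S) * S^-1 * S^-1)) * S))).
    rewrite ler_wpM2l ?invr_ge0 ?cabs_ge0//.
    apply: sqint_bound; first exact: ltW.
      by move=> v ov; apply: continuousB; [exact: c45|exact: c6].
    move=> v ov.
    have vw : v - w != 0 by rewrite subr_eq0; exact: onsq_neq ov.
    have vz : v - z0 != 0 by rewrite subr_eq0; exact: onsq_neq ov.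
    have -> : P v * (v - w)^-1 - P v * (v - z0)^-1 - (w - z0) * (P v * (v - z0)^-1 * (v - z0)^-1)
      = P v * ((w - z0) * (w - z0) * (v - w)^-1 * (v - z0)^-1 * (v - z0)^-1).
      by field; rewrite vw vz.
    have iz : cabs (v - z0)^-1 <= S^-1.
      by apply: (le_trans (onsq_inv zS ov)); rewrite subrr cabs0 subr0.
    have iw : cabs (v - w)^-1 <= 2 / S.
      apply: (le_trans (onsq_inv wS ov)).
      have -> : 2 / S = (S / 2)^-1 by rewrite invf_div.
      by rewrite lef_pV2 ?posrE; lra.
    rewrite cabsM ler_pM ?cabs_ge0//; first by apply: PM; case: ov.
    by rewrite !cabsM !ler_pM ?mulr_ge0 ?cabs_ge0.
  have -> : K * cabs (w - z0) * cabs (w - z0) =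
     (cabs csq)^-1 * (16 * (M * (cabs (w - z0) * cabs (w - z0) * (2 / S) * S^-1 * S^-1)) * S)
     + cabs (w - z0) * cabs (w - z0).
    by rewrite /K; field; rewrite !gt_eqF.
  by rewrite lerDl mulr_ge0 ?cabs_ge0.
apply: (le_trans bd); rewrite ler_wpM2r ?cabs_ge0// mulrC -ler_pdivlMr//; exact: ltW.
Qed.

(** Cauchy's formula at the centre: a side has length at most 2 s and lies at distance at least s
    from z0. This gives 2, and [cint01_le_int] gives the other 2. *)
Lemma submean_line (f : C -> C) z0 s : 0 < s ->
  (forall w, sqbox z0 s w -> derivable f w 1) ->
  cabs csq * cabs (f z0) <= 4 * \sum_(j < 4)
    (\int[mu]_(t in `[0%R, 1%R]) cabs (f (seg (corner z0 s j) (corner z0 s j.+1) t)))%R.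
Proof.
move=> s0 df; have zS : cabs (z0 - z0) < s by rewrite subrr cabs0.
rewrite -cabsM (cauchy_formula df zS).
have cf v : onsq z0 s v -> {for v, continuous f}.
  by case=> bv _; apply: derivable_contC; exact: df.
have c1 := onsq_contM cf (onsq_cont_inv zS).
have E j : (j < 4)%N -> cabs (cint (fun w => f w * (w - z0)^-1) (corner z0 s j) (corner z0 s j.+1))
   <= 4 * (\int[mu]_(t in `[0%R, 1%R]) cabs (f (seg (corner z0 s j) (corner z0 s j.+1) t)))%R.
  move=> j4; rewrite cintE.
  have cc := edge_cont (ltW s0) j4 c1.
  have cF := cont01_seg (edge_cont (ltW s0) j4 cf).
  have cG := cont01M (cont01_seg cc) (cont01_cst (corner z0 s j.+1 - corner z0 s j)).
  apply: (le_trans (cint01_le_int cG)).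
  have -> : 4 = 2 * 2 :> R by ring.
  rewrite -mulrA ler_wpM2l// -RintegralZl//; last exact: (int01 (cont01_cabs cF)).
  apply: le_Rintegral => //; first exact: (int01 (cont01_cabs cG)).
    apply: int01 => t t01; apply: continuousM; first exact: cst_continuous.
    exact: (cont01_cabs cF).
  move=> t /=; rewrite in_itv/= => t01.
  rewrite !cabsM cabsV mulrC mulrCA -[leRHS]mulrC ler_wpM2l ?cabs_ge0//.
  have od := onsq_dist (edge_onsq z0 (ltW s0) j4 t01).
  rewrite ler_pdivrMr; last exact: lt_le_trans od.
  by apply: (le_trans (edge_len z0 (ltW s0) j4)); rewrite ler_wpM2l.
rewrite /sqint mulr_sumr; apply: (le_trans (cabs_sum _ _ _)).
by apply: ler_sum => j _; exact: E (ltn_ord j).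
Qed.

(** * Primitives on the half-plane and periodic functions *)

Definition halfplane (m : R) : set C := [set z | m <= complex.Im z].

Lemma halfplane_closed m : closed (halfplane m).
Proof.
apply: (@preimage_closed _ _ (fun z : C => complex.Im z) [set y | m <= y]).
  by move=> z _; exact: continuous_Im.
exact: closed_ge.
Qed.

Lemma halfplane_convex m : segconvex (halfplane m).
Proof.
move=> a b t; rewrite /halfplane /= => ha hb /andP[? ?]; rewrite seg_Im; nra.
Qed.

Lemma upper_i : upper ('i : C).
Proof. by rewrite /upper /= ltr01. Qed.

Lemma upper_seg a b (t : R) : upper (a : C) -> upper (b : C) -> 0 <= t <= 1 -> upper (seg a b t).
Proof. by rewrite /upper /= => ? ? /andP[? ?]; rewrite seg_Im; nra. Qed.

Lemma upper_cont (f : C -> C) : holomorphic f -> forall z, upper z -> {for z, continuous f}.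
Proof. by move=> hf z /hf; exact: derivable_contC. Qed.

(** Goursat's lemma for the triangle i, a, b, in the closed half-plane bounded by the height of its
    lowest vertex. *)
Lemma Lambda_diff (f : C -> C) a b : holomorphic f -> upper a -> upper b ->
  Lambda f b - Lambda f a = cint f a b.
Proof.
move=> hf ua ub; have ui := upper_i.
pose m := Num.min (complex.Im a) (Num.min (complex.Im b) 1).
have m0 : 0 < m by rewrite !lt_min ua ub ltr01.
have h := @goursat R (halfplane m) f 'i a b (@halfplane_closed m) (@halfplane_convex m).
have e1 : cint f b 'i = - cint f 'i b.
  by apply: cint_rev => t t01; apply: upper_cont => //; exact: upper_seg.
have h0 : cint f 'i a + cint f a b - cint f 'i b = 0.
  rewrite -e1; apply: h.
  - by move=> z hz; apply: hf; exact: lt_le_trans m0 hz.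
  - by rewrite /halfplane /= !ge_min /= lexx !orbT.
  - by rewrite /halfplane /= ge_min lexx.
  - by rewrite /halfplane /= !ge_min lexx orbT.
by rewrite /Lambda -[LHS]addr0 -h0; ring.
Qed.

Lemma Lambda_cder (f : C -> C) z : holomorphic f -> upper z -> cder (Lambda f) z (f z).
Proof.
move=> hf uz e e0; have e20 : 0 < e / 2 by rewrite divr_gt0.
have [d d0 dP] := (contCP f z).1 (upper_cont hf uz) _ e20.
exists (Num.min d (complex.Im z)); first by rewrite lt_min d0.
move=> w; rewrite lt_min => /andP[wd wI].
have uw : upper w.
  have := le_lt_trans (Im_le_cabs _) wI; rewrite raddfB /= ltr_norml => /andP[+ _].
  by rewrite /upper /=; lra.
have cf t : 0 <= t <= 1 -> {for seg z w t, continuous f}.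
  by move=> t01; apply: upper_cont => //; exact: upper_seg.
have cc t : 0 <= t <= 1 -> {for seg z w t, continuous (cst (f z) : C -> C)}.
  by move=> _; exact: cst_continuous.
have -> : Lambda f w - Lambda f z - f z * (w - z) = cint (fun v => f v - f z) z w.
  rewrite Lambda_diff// (cintB cf cc); congr (_ - _).
  by rewrite cintE cint01_cst.
have -> : e * cabs (w - z) = 2 * (e / 2) * cabs (w - z) by field.
apply: cint_bound.
  by move=> t t01; apply: continuousB; [exact: cf|exact: cc].
move=> t /andP[t0 t1]; apply: ltW; apply: dP; apply: le_lt_trans wd.
have -> : seg z w t - z = t%:C * (w - z) by rewrite /seg; ring.
by rewrite cabsM cabsr ger0_norm// ler_piMl// cabs_ge0.
Qed.

(** In the rectangle between the two heights over one period, the vertical sides cancel by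
    periodicity. *)
Lemma mean_const (h : C -> C) (m y y' : R) :
  (forall z, m <= complex.Im z -> derivable h z 1) ->
  (forall z, m <= complex.Im z -> h (z + 1) = h z) ->
  m <= y -> m <= y' ->
  cint01 (fun t => h (t +i* y)) = cint01 (fun t => h (t +i* y')).
Proof.
move=> dh ph my my'.
have E (v : R) : cint01 (fun t => h (t +i* v)) = cint h (0 +i* v) (1 +i* v).
  rewrite cintE; apply: eq_cint01 => t _.
  have -> : 1 +i* v - 0 +i* v = 1 :> C by apply/eqP; rewrite eq_complex /= subr0 subrr !eqxx.
  rewrite mulr1; congr h; rewrite /seg; apply/eqP; rewrite eq_complex /=.
  by apply/andP; split; apply/eqP; ring.
rewrite !E.
have := @trapezoid (halfplane m) h (0 +i* y) (1 +i* y) (0 +i* y') (1 +i* y')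
  (@halfplane_closed m) (@halfplane_convex m) dh my my my' my'.
move=> ->.
have -> : cint h (1 +i* y) (1 +i* y') = cint h (0 +i* y) (0 +i* y').
  rewrite !cintE; apply: eq_cint01 => t /andP[t0 t1].
  have -> : seg (1 +i* y) (1 +i* y') t = seg (0 +i* y) (0 +i* y') t + 1.
    by rewrite /seg; apply/eqP; rewrite eq_complex /=; apply/andP; split; apply/eqP; ring.
  rewrite ph; last by rewrite seg_Im /=; nra.
  by congr (_ * _); apply/eqP; rewrite eq_complex /=; apply/andP; split; apply/eqP; ring.
by ring.
Qed.

Lemma periodic_int (h : C -> C) (m : R) :
  (forall z, m <= complex.Im z -> h (z + 1) = h z) ->
  forall (n : int) z, m <= complex.Im z -> h (z + n%:~R) = h z.
Proof.
move=> ph.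
have P (n : nat) z : m <= complex.Im z -> h (z + n%:R) = h z.
  move=> hz; elim: n => [|n IH]; first by rewrite addr0.
  rewrite -addn1 natrD addrA ph// ImD.
  have -> : complex.Im (n%:R : C) = 0 by rewrite -(rmorph_nat (real_complex R)).
  by rewrite addr0.
case=> n z hz; first exact: P.
rewrite NegzE rmorphN /=.
have hz' : m <= complex.Im (z - n.+1%:R : C).
  rewrite ImD; have -> : complex.Im (- n.+1%:R : C) = 0.
    by rewrite -(rmorph_nat (real_complex R)) /= oppr0.
  by rewrite addr0.
by rewrite -(P n.+1 (z - n.+1%:R) hz') subrK.
Qed.

Lemma periodic_shift (h : C -> C) (m x y : R) :
  (forall z, m <= complex.Im z -> h (z + 1) = h z) -> m <= y ->
  exists2 x', 0 <= x' < 1 & h (x +i* y) = h (x' +i* y).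
Proof.
move=> ph my; exists (x - (Num.floor x)%:~R).
  have /andP[h1 h2] := floor_itv x.
  by apply/andP; split; move: h2; rewrite ?intrD; lra.
rewrite -[RHS](periodic_int ph (Num.floor x))//; congr h.
rewrite -[((Num.floor x)%:~R : C)](rmorph_int (real_complex R)).
by apply/eqP; rewrite eq_complex /= addr0 subrK !eqxx.
Qed.

(* By the mean zero condition h is a mean of differences, which the Cauchy estimate
   on a square of side 2S controls: going up by S halves the bound. *)
Lemma periodic_decay_step (h : C -> C) (Y S M : R) :
  32 / cabs csq <= S / 4 -> 2 <= S ->
  (forall z, Y <= complex.Im z -> derivable h z 1) ->
  (forall z, Y <= complex.Im z -> h (z + 1) = h z) ->
  (forall y, Y <= y -> cint01 (fun t => h (t +i* y)) = 0) ->
  (forall z, Y <= complex.Im z -> cabs (h z) <= M) ->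
  forall z, Y + S <= complex.Im z -> cabs (h z) <= M / 2.
Proof.
move=> KS S2 dh ph mh hM [x y] /= hy.
have S0 : 0 < S by lra.
have Yy : Y <= y by lra.
have [x' /andP[x0 x1] ->] := periodic_shift x ph Yy.
have sub w : sqbox (x' +i* y) S w -> Y <= complex.Im w.
  by case=> _ /=; move=> /andP[? _]; lra.
have ch : cont01 (fun t => h (t +i* y)).
  have -> : (fun t => h (t +i* y)) = (fun t => h (seg (0 +i* y) (1 +i* y) t)).
    apply/funext => t; congr h; apply/eqP; rewrite eq_complex seg_Re seg_Im /=.
    by apply/andP; split; apply/eqP; ring.
  apply: cont01_seg => t t01; apply: derivable_contC; apply: dh.
  by rewrite seg_Im /= subrr mulr0 addr0.
have -> : h (x' +i* y) = cint01 (fun t => h (x' +i* y) - h (t +i* y)).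
  by rewrite (cint01B (cont01_cst _) ch) cint01_cst mh// subr0.
have M0 : 0 <= M by apply: (le_trans (cabs_ge0 _)); apply: (hM (x' +i* y)).
(* The condition on S makes each difference at most M / 4, and [cint01_bound] costs a factor 2. *)
have -> : M / 2 = 2 * (M / 4) by field.
apply: cint01_bound; first exact: (cont01B (cont01_cst _) ch).
move=> t /andP[t0 t1]; rewrite cabsBC.
have d1 : cabs ((t +i* y : C) - (x' +i* y)) <= 1.
  apply: (le_trans (cabs_le_ReIm _)) => /=.
  by rewrite subrr normr0 addr0 ler_norml; apply/andP; split; lra.
apply: (le_trans (@cauchy_estimate h (x' +i* y) S M (t +i* y) S0 _ _ _)).
- by move=> w /sub; exact: dh.
- by move=> w [/sub + _]; exact: hM.
- by apply: (le_trans d1); lra.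
rewrite ler_pdivrMr//; apply: (@le_trans _ _ (S / 4 * M * 1)).
  rewrite ler_pM ?mulr_ge0 ?invr_ge0 ?cabs_ge0//.
  by rewrite ler_wpM2r.
by have -> : S / 4 * M * 1 = M / 4 * S by field.
Qed.

(** The bound halves each time the height grows by S, which is the rate ln 2 / S. The factor 2 in
    the constant pays for rounding (y - Y) / S down to an integer. *)
Lemma periodic_decay (h : C -> C) (Y M : R) :
  (forall z, Y <= complex.Im z -> derivable h z 1) ->
  (forall z, Y <= complex.Im z -> h (z + 1) = h z) ->
  (forall y, Y <= y -> cint01 (fun t => h (t +i* y)) = 0) ->
  (forall z, Y <= complex.Im z -> cabs (h z) <= M) ->
  exists c B : R, 0 < c /\ forall y, Y <= y -> forall x,
    cabs (h (x +i* y)) <= B * expR (- (c * y)).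
Proof.
move=> dh ph mh hM.
have K0 : 0 <= 32 / cabs csq by rewrite mulr_ge0 ?invr_ge0 ?cabs_ge0.
pose S := 4 * (32 / cabs csq) + 2.
have KS : 32 / cabs csq <= S / 4 by rewrite /S; lra.
have S2 : 2 <= S by rewrite /S; lra.
have S0 : 0 < S by lra.
have it (n : nat) z : Y + n%:R * S <= complex.Im z -> cabs (h z) <= M / 2 ^+ n.
  elim: n z => [z|n IH z]; first by rewrite mul0r addr0 expr0 divr1; exact: hM.
  have le1 w : Y + n%:R * S <= complex.Im w -> Y <= complex.Im w.
    by apply: le_trans; rewrite lerDl mulr_ge0// ltW.
  rewrite -natr1 mulrDl mul1r addrA => hz.
  have -> : M / 2 ^+ n.+1 = M / 2 ^+ n / 2 by rewrite exprSr invfM mulrA.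
  apply: (periodic_decay_step KS S2 (Y := Y + n%:R * S)) => //.
  - by move=> w /le1; exact: dh.
  - by move=> w /le1; exact: ph.
  - by move=> y hy; apply: mh; exact: (le1 (0 +i* y)).
have l2 : 0 < ln (2 : R) by rewrite ln_gt0// ltr1n.
have M0 : 0 <= M by apply: (le_trans (cabs_ge0 _)); apply: (hM (0 +i* Y)).
exists (ln 2 / S), (2 * M * expR (ln 2 / S * Y)); split; first by rewrite divr_gt0.
move=> y Yy x; pose n := Num.truncn ((y - Y) / S).
have q0 : 0 <= (y - Y) / S by rewrite divr_ge0 ?subr_ge0// ltW.
have /andP[n1 n2] := truncn_itv q0.
apply: (le_trans (it n (x +i* y) _)).
  by rewrite /= -lerBrDl -ler_pdivlMr.
have -> : 2 * M * expR (ln 2 / S * Y) * expR (- (ln 2 / S * y)) =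
    M * (2 * expR (ln 2 / S * Y - ln 2 / S * y)) by rewrite expRD; ring.
rewrite ler_wpM2l//.
have -> : (2 ^+ n)^-1 = expR (- (n%:R * ln 2)) :> R.
  by rewrite expRN expRM_natl lnK// posrE.
rewrite (_ : 2 * expR _ = expR (ln 2) * expR (ln 2 / S * Y - ln 2 / S * y)); last by rewrite lnK// posrE.
rewrite -expRD ler_expR.
have -> : ln 2 / S * Y - ln 2 / S * y = - (ln 2 * ((y - Y) / S)) by field; rewrite gt_eqF.
move: n2; rewrite -/n -natr1 => n2.
have := ler_wpM2l (ltW l2) (ltW n2); lra.
Qed.

End Cauchy.

(** * Invariance of the hyperbolic measure *)

Section Lebesgue.
Context {R : realType}.
Local Notation C := (Cplx R).
Local Notation mu := (@lebesgue_measure R).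
Local Notation T2 := (measurableTypeR R * measurableTypeR R)%type.

(** The image of Lebesgue measure under x |-> a x + b, multiplied by a, agrees with Lebesgue measure
    on half-open intervals, hence everywhere by uniqueness. *)
Lemma lint_affine (f : R -> \bar R) (a b : R) : 0 < a ->
  measurable_fun [set: measurableTypeR R] f -> (forall x, (0 <= f x)%E) ->
  (\int[mu]_x f (a * x + b)%R = (a^-1)%:E * \int[mu]_x f x)%E.
Proof.
move=> a0 mf f0; pose phi (x : measurableTypeR R) : measurableTypeR R := a * x + b.
have mphi : measurable_fun setT phi.
  apply: measurable_funD; last exact: measurable_cst.
  by apply: measurable_funM => //; exact: measurable_cst.
have ai0 : 0 <= a^-1 by rewrite invr_ge0 ltW.
have E (A : set (measurableTypeR R)) : measurable A ->
   pushforward mu phi A = mscale (NngNum ai0) mu A.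
  move=> mA; have a0' : 0 <= a by exact: ltW.
  have -> : pushforward mu phi A = (a^-1%:E * mscale (NngNum a0') (pushforward mu phi) A)%E.
    by rewrite /mscale /= muleA -EFinM mulVf ?mul1e// gt_eqF.
  rewrite /mscale /=; congr (_ * _)%E; apply/esym.
  apply: (@lebesgue_measure_unique R (mscale (NngNum a0') (pushforward mu phi))) => //.
  move=> _ [[u v]] _ <- /=; rewrite /mscale /= /pushforward.
  have -> : phi @^-1` `]u, v] = `]((u - b) / a), ((v - b) / a)]%classic.
    apply/seteqP; split=> x; rewrite /phi /= !in_itv /= => /andP[h1 h2]; apply/andP; split.
    - by rewrite ltr_pdivrMr// ltrBlDr mulrC.
    - by rewrite ler_pdivlMr// lerBrDr mulrC.
    - by move: h1; rewrite ltr_pdivrMr// ltrBlDr mulrC.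
    - by move: h2; rewrite ler_pdivlMr// lerBrDr mulrC.
  rewrite !lebesgue_measure_itv /= !lte_fin.
  have -> : ((u - b) / a < (v - b) / a) = (u < v).
    by rewrite ltr_pM2r ?invr_gt0// ltrD2r.
  case: ifP => _; last by rewrite mule0.
  by rewrite -EFinM; congr EFin; field; rewrite gt_eqF.
transitivity (\int[pushforward mu phi]_x f x)%E.
  by rewrite (ge0_integral_pushforward mphi).
rewrite (eq_measure_integral (mscale (NngNum ai0) mu)); last by move=> A mA _; exact: E.
by rewrite ge0_integral_mscale.
Qed.

Lemma lint_opp (f : R -> \bar R) :
  measurable_fun [set: measurableTypeR R] f -> (forall x, (0 <= f x)%E) ->
  (\int[mu]_x f (- x)%R = \int[mu]_x f x)%E.
Proof.
move=> mf f0; have mo : measurable_fun setT (-%R : measurableTypeR R -> measurableTypeR R).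
  exact: oppr_measurable.
transitivity (\int[pushforward mu (-%R : measurableTypeR R -> measurableTypeR R)]_x f x)%E.
  by rewrite (ge0_integral_pushforward mo).
by apply: eq_measure_integral => A mA _; exact: lebesgue_measureN.
Qed.

Lemma tonelli12 (f : T2 -> \bar R) : measurable_fun setT f -> (forall p, 0 <= f p)%E ->
  (\int[mu \x mu]_p f p = \int[mu]_x \int[mu]_y f (x, y))%E.
Proof. by move=> mf f0; exact: (fubini_tonelli1 f mf f0). Qed.

Lemma tonelli21 (f : T2 -> \bar R) : measurable_fun setT f -> (forall p, 0 <= f p)%E ->
  (\int[mu \x mu]_p f p = \int[mu]_y \int[mu]_x f (x, y))%E.
Proof. by move=> mf f0; rewrite tonelli12//; exact: (fubini_tonelli f mf f0). Qed.

(* Truncated at 0, so that integrals over the upper half-plane are integrals over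
   the whole plane. *)
Definition posinv (y : R) : R := if 0 < y then y^-1 else 0.

Lemma posinv_ge0 y : 0 <= posinv y.
Proof. by rewrite /posinv; case: ifP => // h; rewrite invr_ge0 ltW. Qed.

Lemma measurable_inv_R : measurable_fun [set: measurableTypeR R] (fun y : R => y^-1).
Proof.
have m0 : measurable [set (0 : R)] by exact: measurable_set1.
rewrite -(setvU [set (0 : R)]); apply/measurable_funU; [exact: measurableC|exact: m0|split].
  apply: open_continuous_measurable_fun.
    exact: (closed_openC (@accessible_closed_set1 R (@hausdorff_accessible _ (@norm_hausdorff _ _)) 0)).
  by move=> x; rewrite inE /= => /eqP x0; exact: inv_continuous.
exact: measurable_fun_set1.
Qed.

Lemma measurable_posinv : measurable_fun [set: measurableTypeR R] posinv.
Proof.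
apply: measurable_fun_ifT; last exact: measurable_cst.
  by apply: measurable_fun_ltr; [exact: measurable_cst|exact: measurable_id].
exact: measurable_inv_R.
Qed.

End Lebesgue.

Ltac measurable_arith := repeat first
  [ exact: measurable_cst | exact: measurable_id | exact: measurable_fst | exact: measurable_snd
  | apply: measurable_funD | apply: measurable_funB | apply: measurable_funM
  | apply: measurable_funN | apply: measurable_funX
  | apply: (measurableT_comp measurable_posinv) | apply: (measurableT_comp measurable_inv_R) ].

Section Invariance.
Context {R : realType}.
Local Notation C := (Cplx R).
Local Notation mu := (@lebesgue_measure R).
Local Notation T2 := (measurableTypeR R * measurableTypeR R)%type.

(** Integration against dy / y, the Haar measure of the multiplicative group of positive reals. *)
Definition haar_int (g : measurableTypeR R -> \bar R) : \bar R :=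
  (\int[mu]_y (g y * (posinv y)%:E))%E.

Lemma mul_posinv_ge0 (g : measurableTypeR R -> \bar R) y :
  (forall x, 0 <= g x)%E -> (0 <= g y * (posinv y)%:E)%E.
Proof. by move=> g0; rewrite mule_ge0// lee_fin posinv_ge0. Qed.

Lemma measurable_mul_posinv (g : measurableTypeR R -> \bar R) :
  measurable_fun setT g -> measurable_fun setT (fun y => g y * (posinv y)%:E)%E.
Proof.
move=> mg; apply: emeasurable_funM => //.
by apply/measurable_EFinP; exact: measurable_posinv.
Qed.

Lemma eq_haar_int (g h : measurableTypeR R -> \bar R) :
  (forall y, 0 < y -> g y = h y) -> haar_int g = haar_int h.
Proof.
move=> gh; apply: eq_integral => y _; rewrite /posinv.
by case: ifPn => [/gh ->//|_]; rewrite !mule0.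
Qed.

Lemma posinvM (c y : R) : 0 < c -> posinv (c * y) = c^-1 * posinv y.
Proof.
move=> c0; rewrite /posinv pmulr_rgt0//; case: ifP => _; last by rewrite mulr0.
by rewrite invfM.
Qed.

Lemma haar_int_scale (g : measurableTypeR R -> \bar R) (c : R) : 0 < c ->
  measurable_fun setT g -> (forall x, 0 <= g x)%E ->
  haar_int (fun y => g (c * y)%R) = haar_int g.
Proof.
move=> c0 mg g0; pose F (y : measurableTypeR R) := (g y * (posinv y)%:E)%E.
have mF : measurable_fun setT F by exact: measurable_mul_posinv.
have F0 y : (0 <= F y)%E by exact: mul_posinv_ge0.
transitivity (\int[mu]_y (c%:E * F (c * y + 0)%R))%E.
  apply: eq_integral => y _; rewrite /F addr0 posinvM// muleCA.
  by rewrite -EFinM mulrA divff ?mul1r// gt_eqF.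
rewrite ge0_integralZl_EFin//; last 2 first.
- by apply: (measurableT_comp mF); measurable_arith.
- exact: ltW.
by rewrite lint_affine// muleA -EFinM divff ?mul1e// gt_eqF.
Qed.

Definition bump12 (y : measurableTypeR R) : \bar R := (\1_(`[1, 2]%classic : set R) y)%:E.

Lemma bump12_ge0 y : (0 <= bump12 y)%E.
Proof. by rewrite /bump12 lee_fin indicE. Qed.

Lemma measurable_bump12 : measurable_fun setT bump12.
Proof. by apply/measurable_EFinP; exact: measurable_indic. Qed.

Lemma haar_int_bump12 : (0 < haar_int bump12 < +oo)%E.
Proof.
have m12 : measurable (`[1, 2]%classic : set R) by [].
have e : mu (`[1, 2]%classic : set R) = 1%E.
  by rewrite lebesgue_measure_itv /= lte_fin ltr1n -EFinB; congr EFin; ring.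
have i1 (k : R) : 0 <= k -> (\int[mu]_y (k%:E * bump12 y) = k%:E)%E.
  move=> k0; rewrite /bump12 ge0_integralZl_EFin// ?integral_indic// ?setIT; last by apply/measurable_EFinP; exact: measurable_indic.
  by rewrite [X in (_ * X)%E]e mule1.
have mJ := measurable_mul_posinv measurable_bump12.
have J0 y := mul_posinv_ge0 y bump12_ge0.
apply/andP; split.
  apply: (@lt_le_trans _ _ (2^-1%:E)); first by rewrite lte_fin invr_gt0.
  rewrite -i1 ?invr_ge0//; apply: ge0_le_integral => //.
  - by move=> y _; rewrite mule_ge0 ?bump12_ge0 ?lee_fin ?invr_ge0.
  - by apply: emeasurable_funM; [exact: measurable_cst|exact: measurable_bump12].
  - move=> y _; rewrite /bump12 indicE; case: (boolP (y \in _)); rewrite ?mule0 ?mul0e//.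
    rewrite inE /= in_itv /= => /andP[y1 y2]; rewrite mule1 mul1e lee_fin /posinv.
    by rewrite (lt_le_trans ltr01 y1) lef_pV2 ?posrE// (lt_le_trans ltr01).
apply: (@le_lt_trans _ _ 1%E); last exact: ltry.
rewrite -i1//; apply: ge0_le_integral => //.
- by apply: emeasurable_funM; [exact: measurable_cst|exact: measurable_bump12].
- move=> y _; rewrite /bump12 indicE; case: (boolP (y \in _)); rewrite ?mule0 ?mul0e//.
  rewrite inE /= in_itv /= => /andP[y1 y2]; rewrite mule1 mul1e lee_fin /posinv.
  by rewrite (lt_le_trans ltr01 y1) invf_le1// (lt_le_trans ltr01 y1).
Qed.

(* Uniqueness of the Haar measure dy/y: integrate g(1/u) bump12(u y) (du/u) (dy/y) in
   both orders, with a bump of positive finite mass. *)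
Lemma haar_int_inv (g : measurableTypeR R -> \bar R) :
  measurable_fun setT g -> (forall x, 0 <= g x)%E ->
  haar_int (fun y => g (posinv y)) = haar_int g.
Proof.
move=> mg g0.
have mgi : measurable_fun setT (fun y : measurableTypeR R => g (posinv y)).
  by apply: (measurableT_comp mg); measurable_arith.
pose F1 (p : T2) : \bar R := ((g (posinv p.1) * (posinv p.1)%:E) * (bump12 (p.1 * p.2)%R * (posinv p.2)%:E))%E.
pose F2 (p : T2) : \bar R := ((g (p.2 * posinv p.1)%R * (posinv p.2)%:E) * (bump12 p.1 * (posinv p.1)%:E))%E.
have mEp1 : measurable_fun setT (fun p : T2 => (posinv p.1)%:E) by apply/measurable_EFinP; measurable_arith.
have mEp2 : measurable_fun setT (fun p : T2 => (posinv p.2)%:E) by apply/measurable_EFinP; measurable_arith.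
have mF1 : measurable_fun setT F1.
  do 2 (apply: emeasurable_funM); try exact: mEp1.
  - by apply: (measurableT_comp mg); measurable_arith.
  - by apply: (measurableT_comp measurable_bump12); measurable_arith.
  - exact: mEp2.
have mF2 : measurable_fun setT F2.
  do 2 (apply: emeasurable_funM); try exact: mEp2.
  - by apply: (measurableT_comp mg); measurable_arith.
  - by apply: (measurableT_comp measurable_bump12); measurable_arith.
  - exact: mEp1.
have F10 p : (0 <= F1 p)%E by rewrite !mule_ge0 ?bump12_ge0 ?lee_fin ?posinv_ge0.
have F20 p : (0 <= F2 p)%E by rewrite !mule_ge0 ?bump12_ge0 ?lee_fin ?posinv_ge0.
have /andP[h0 hy] := haar_int_bump12.
have mJg := measurable_mul_posinv mg; have mJgi := measurable_mul_posinv mgi.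
have mJh := measurable_mul_posinv measurable_bump12.
have E1 : (haar_int (fun y => g (posinv y)) * haar_int bump12 = \int[mu \x mu]_p F1 p)%E.
  rewrite (tonelli12 mF1 F10) /haar_int -ge0_integralZr//; last 2 first.
  - by move=> y _; rewrite mule_ge0 ?bump12_ge0 ?lee_fin ?posinv_ge0.
  - exact: ltW.
  apply: eq_integral => u _; rewrite /F1 /=.
  have [u0|u0] := ltP 0 u; last first.
    rewrite /posinv ltNge u0 /= mule0 mul0e.
    by under eq_integral do rewrite mul0e; rewrite integral0.
  rewrite ge0_integralZl//; last 3 first.
  - by apply: measurable_mul_posinv; apply: (measurableT_comp measurable_bump12); measurable_arith.
  - by move=> y _; rewrite mule_ge0 ?bump12_ge0 ?lee_fin ?posinv_ge0.
  - by rewrite mule_ge0 ?bump12_ge0 ?lee_fin ?posinv_ge0.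
  by congr (_ * _)%E; rewrite -/(haar_int bump12) -(haar_int_scale u0 measurable_bump12 bump12_ge0).
(* For fixed y, replacing u by u / y turns g(1/u) bump12(u y) into g(y/u) bump12(u). Scaling y by u
   for fixed u then separates the two integrals. *)
have E2 : (\int[mu \x mu]_p F1 p = \int[mu]_y \int[mu]_u F2 (u, y))%E.
  rewrite (tonelli21 mF1 F10); apply: eq_integral => y _; rewrite /F1 /F2 /=.
  have [y0|y0] := ltP 0 y; last first.
    have -> : posinv y = 0 by rewrite /posinv ltNge y0.
    by apply: eq_integral => u _; rewrite !mule0 mul0e.
  have iy0 : 0 < y^-1 by rewrite invr_gt0.
  transitivity ((posinv y)%:E * haar_int (fun u => g (posinv u) * bump12 (u * y)%R))%E.
    rewrite /haar_int -ge0_integralZl_EFin//.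
    - by apply: eq_integral => u _; rewrite muleACA muleA muleC.
    - by move=> u _; rewrite !mule_ge0 ?bump12_ge0 ?lee_fin ?posinv_ge0.
    - apply: measurable_mul_posinv; apply: emeasurable_funM; try exact: mgi; try exact: measurable_bump12.
      by apply: (measurableT_comp measurable_bump12); measurable_arith.
    - exact: posinv_ge0.
  rewrite -(haar_int_scale iy0); last 2 first.
  - apply: emeasurable_funM; try exact: mgi; try exact: measurable_bump12.
    by apply: (measurableT_comp measurable_bump12); measurable_arith.
  - by move=> u; rewrite mule_ge0 ?bump12_ge0.
  rewrite /haar_int -ge0_integralZl_EFin//; last 3 first.
  - by move=> u _; rewrite !mule_ge0 ?bump12_ge0 ?lee_fin ?posinv_ge0.
  - apply: measurable_mul_posinv; apply: emeasurable_funM; try exact: mgi; try exact: measurable_bump12.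
      by apply: (measurableT_comp mg); measurable_arith.
    by apply: (measurableT_comp measurable_bump12); measurable_arith.
  - exact: posinv_ge0.
  apply: eq_integral => u _; rewrite posinvM// invrK mulrAC mulVf ?gt_eqF// mul1r.
  by rewrite !muleA; congr (_ * _ * _)%E; rewrite muleC.
have E3 : (\int[mu]_y \int[mu]_u F2 (u, y) = haar_int bump12 * haar_int g)%E.
  have Jg0 : (0 <= haar_int g)%E.
    by apply: integral_ge0 => y _; rewrite mule_ge0 ?lee_fin ?posinv_ge0.
  rewrite -(tonelli21 mF2 F20) (tonelli12 mF2 F20).
  rewrite -(ge0_integralZr mu measurableT mJh (fun y _ => mul_posinv_ge0 y bump12_ge0) Jg0).
  apply: eq_integral => u _; rewrite /F2 /=.
  have [u0|u0] := ltP 0 u; last first.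
    have -> : posinv u = 0 by rewrite /posinv ltNge u0.
    by rewrite !mule0 mul0e integral0_eq// => y _; rewrite !mule0.
  rewrite ge0_integralZr//; last 3 first.
  - by apply: measurable_mul_posinv; apply: (measurableT_comp mg); measurable_arith.
  - by move=> y _; rewrite mule_ge0 ?bump12_ge0 ?lee_fin ?posinv_ge0.
  - by rewrite mule_ge0 ?bump12_ge0 ?lee_fin ?posinv_ge0.
  rewrite muleC; congr (_ * _)%E.
  have pu0 : 0 < posinv u by rewrite /posinv u0 invr_gt0.
  rewrite -(haar_int_scale pu0)//; apply: eq_integral => y _; by rewrite (mulrC y).
have : (haar_int (fun y => g (posinv y)) * haar_int bump12 = haar_int g * haar_int bump12)%E.
  by rewrite E1 E2 E3 muleC.
have hfin : haar_int bump12 \is a fin_num by rewrite ge0_fin_numE ?(ltW h0).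
move/(congr1 (fun x => x * ((fine (haar_int bump12))^-1)%:E)%E).
rewrite -!muleA; have -> : (haar_int bump12 * (fine (haar_int bump12))^-1%:E = 1)%E.
  rewrite -{1}(fineK hfin) -EFinM divff// gt_eqF// fine_gt0// h0 hy//.
by rewrite !mule1.
Qed.

Definition hyp_int (g : T2 -> \bar R) : \bar R :=
  (\int[mu \x mu]_p (g p * (posinv p.2 ^+ 2)%:E))%E.

Lemma measurable_hyp_int (g : T2 -> \bar R) : measurable_fun setT g ->
  measurable_fun setT (fun p : T2 => g p * (posinv p.2 ^+ 2)%:E)%E.
Proof.
by move=> mg; apply: emeasurable_funM => //; apply/measurable_EFinP; measurable_arith.
Qed.

Lemma hyp_int_ge0_fun (g : T2 -> \bar R) p : (forall p, 0 <= g p)%E ->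
  (0 <= g p * (posinv p.2 ^+ 2)%:E)%E.
Proof. by move=> g0; rewrite mule_ge0// lee_fin exprn_ge0// posinv_ge0. Qed.

Lemma eq_hyp_int (g h : T2 -> \bar R) :
  (forall p, 0 < p.2 -> g p = h p) -> hyp_int g = hyp_int h.
Proof.
move=> gh; apply: eq_integral => p _; rewrite /posinv.
by case: ifPn => [/gh ->//|_]; rewrite expr0n /= !mule0.
Qed.

Lemma hyp_int_le (g h : T2 -> \bar R) : measurable_fun setT g -> measurable_fun setT h ->
  (forall p, 0 <= g p)%E -> (forall p, (0 < p.2)%R -> g p <= h p)%E -> (hyp_int g <= hyp_int h)%E.
Proof.
move=> mg mh g0 gh; apply: ge0_le_integral => //.
- by move=> p _; exact: hyp_int_ge0_fun.
- exact: measurable_hyp_int.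
- exact: measurable_hyp_int.
move=> p _; rewrite /posinv; case: ifPn => [p0|_]; last by rewrite expr0n /= !mule0.
by rewrite lee_wpmul2r ?gh// lee_fin exprn_ge0// invr_ge0 ltW.
Qed.

(* The coordinates x = t y, in which the inversion becomes y |-> 1 / ((t^2 + 1) y). *)
Lemma hyp_int_polar (g : T2 -> \bar R) : measurable_fun setT g -> (forall p, 0 <= g p)%E ->
  hyp_int g = (\int[mu]_t haar_int (fun y => g ((t * y)%R, y)))%E.
Proof.
move=> mg g0; rewrite /hyp_int tonelli21; [|exact: measurable_hyp_int|by move=> p; exact: hyp_int_ge0_fun].
pose F (p : T2) : \bar R := (g ((p.1 * p.2)%R, p.2) * (posinv p.2)%:E)%E.
have mF : measurable_fun setT F.
  apply: emeasurable_funM; last by apply/measurable_EFinP; measurable_arith.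
  by apply: (measurableT_comp mg); apply: measurable_fun_pair; measurable_arith.
have F0 p : (0 <= F p)%E by rewrite mule_ge0// lee_fin posinv_ge0.
transitivity (\int[mu]_y \int[mu]_t F (t, y))%E; last first.
  by rewrite -tonelli21// tonelli12.
apply: eq_integral => y _; rewrite /F /=.
have [y0|y0] := ltP 0 y; last first.
  rewrite /posinv ltNge y0 /= expr0n /=.
  by apply: eq_integral => t _; rewrite !mule0.
pose G (x : measurableTypeR R) := (g (x, y) * (posinv y ^+ 2)%:E)%E.
have mG : measurable_fun setT G.
  apply: emeasurable_funM; last exact: measurable_cst.
  by apply: (measurableT_comp mg); apply: measurable_fun_pair; measurable_arith.
have G0 x : (0 <= G x)%E by rewrite mule_ge0// lee_fin exprn_ge0// posinv_ge0.
have -> : (\int[mu]_x (g (x, y) * (posinv y ^+ 2)%:E) = y%:E * \int[mu]_x G (y * x + 0)%R)%E.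
  by rewrite lint_affine// muleA -EFinM divff ?mul1e// gt_eqF.
rewrite -ge0_integralZl_EFin//; last 2 first.
- by apply: (measurableT_comp mG); measurable_arith.
- exact: ltW.
apply: eq_integral => t _; rewrite /G addr0 (mulrC y t) muleCA; congr (_ * _)%E.
by rewrite /posinv y0 -EFinM; congr EFin; field; rewrite gt_eqF.
Qed.

Lemma hyp_int_affine (g : T2 -> \bar R) (a b : R) : 0 < a ->
  measurable_fun setT g -> (forall p, 0 <= g p)%E ->
  hyp_int (fun p => g ((a * p.1 + b)%R, (a * p.2)%R)) = hyp_int g.
Proof.
move=> a0 mg g0.
have mga : measurable_fun setT (fun p : T2 => g ((a * p.1 + b)%R, (a * p.2)%R)).
  by apply: (measurableT_comp mg); apply: measurable_fun_pair; measurable_arith.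
have mh := measurable_hyp_int mg.
rewrite /hyp_int (tonelli21 (measurable_hyp_int mga) (fun p => hyp_int_ge0_fun p (fun p => g0 _))).
rewrite (tonelli21 mh (fun p => hyp_int_ge0_fun p g0)).
pose K (y : measurableTypeR R) : \bar R := (\int[mu]_x (g (x, y) * (posinv y ^+ 2)%:E))%E.
have mK : measurable_fun setT K.
  by apply: (@measurable_fun_fubini_tonelli_G _ _ _ _ _ mu _ mh) => p; exact: hyp_int_ge0_fun.
have K0 y : (0 <= K y)%E.
  by apply: integral_ge0 => x _; rewrite mule_ge0// lee_fin exprn_ge0// posinv_ge0.
transitivity (\int[mu]_y (a%:E * K (a * y + 0)%R))%E; last first.
  rewrite ge0_integralZl_EFin//; last 2 first.
  - by apply: (measurableT_comp mK); measurable_arith.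
  - exact: ltW.
  by rewrite lint_affine// muleA -EFinM divff ?mul1e// gt_eqF.
apply: eq_integral => y _; rewrite /K addr0.
pose G (x : measurableTypeR R) := (g (x, (a * y)%R) * (posinv (a * y) ^+ 2)%:E)%E.
have mG : measurable_fun setT G.
  apply: emeasurable_funM; last exact: measurable_cst.
  by apply: (measurableT_comp mg); apply: measurable_fun_pair; measurable_arith.
have G0 x : (0 <= G x)%E by rewrite mule_ge0// lee_fin exprn_ge0// posinv_ge0.
transitivity ((a ^+ 2)%:E * \int[mu]_x G (a * x + b)%R)%E.
  rewrite -ge0_integralZl_EFin//; last 2 first.
  - by apply: (measurableT_comp mG); measurable_arith.
  - by rewrite exprn_ge0// ltW.
  apply: eq_integral => x _; rewrite /G /= muleCA; congr (_ * _)%E.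
  rewrite posinvM// exprMn -EFinM; congr EFin; rewrite exprVn mulrA divff ?mul1r//.
  by rewrite expf_neq0// gt_eqF.
rewrite lint_affine// muleA -EFinM; congr (_%:E * _)%E.
by field; rewrite gt_eqF.
Qed.

(** The map z |-> -1/z in the coordinates x, y. *)
Definition inversion (p : T2) : T2 :=
  (- p.1 * (p.1 ^+ 2 + p.2 ^+ 2)^-1, p.2 * (p.1 ^+ 2 + p.2 ^+ 2)^-1).

Lemma measurable_inversion : measurable_fun setT inversion.
Proof.
apply: measurable_fun_pair.
  apply: measurable_funM; last by measurable_arith.
  by apply: (measurableT_comp (@oppr_measurable R setT)); measurable_arith.
by measurable_arith.
Qed.

(** The inversion also sends t to - t. For fixed t the change of y is undone by [haar_int_scale] and
    [haar_int_inv], and the sign of t by [lint_opp]. *)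
Lemma hyp_int_inv (g : T2 -> \bar R) :
  measurable_fun setT g -> (forall p, 0 <= g p)%E ->
  hyp_int (fun p => g (inversion p)) = hyp_int g.
Proof.
move=> mg g0.
have mgW : measurable_fun setT (fun p : T2 => g (inversion p)).
  by apply: (measurableT_comp mg); exact: measurable_inversion.
rewrite (hyp_int_polar mgW (fun p => g0 _)) (hyp_int_polar mg g0).
have mgt (t : R) : measurable_fun setT (fun y : measurableTypeR R => g ((t * y)%R, y)).
  by apply: (measurableT_comp mg); apply: measurable_fun_pair; measurable_arith.
transitivity (\int[mu]_t haar_int (fun v => g ((- t * v)%R, v)))%E.
  apply: eq_integral => t _.
  have t1 : 0 < 1 + t ^+ 2 by rewrite ltr_pwDl// sqr_ge0.
  rewrite -[RHS]haar_int_inv//.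
  rewrite -[RHS](haar_int_scale t1)//; last first.
    by apply: (measurableT_comp (mgt (- t))); measurable_arith.
  apply: eq_haar_int => y y0; rewrite /inversion /=; congr g.
  rewrite posinvM// /posinv y0; congr (_, _).
    by field; rewrite !gt_eqF// ltr_wpDl ?sqr_ge0// exprn_gt0.
  by field; rewrite !gt_eqF// ltr_wpDl ?sqr_ge0// exprn_gt0.
pose F (p : T2) : \bar R := (g ((p.1 * p.2)%R, p.2) * (posinv p.2)%:E)%E.
have mF : measurable_fun setT F.
  apply: emeasurable_funM; last by apply/measurable_EFinP; measurable_arith.
  by apply: (measurableT_comp mg); apply: measurable_fun_pair; measurable_arith.
have F0 p : (0 <= F p)%E by rewrite mule_ge0// lee_fin posinv_ge0.
apply: (@lint_opp R (fun t => haar_int (fun v => g ((t * v)%R, v)))).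
  exact: (@measurable_fun_fubini_tonelli_F _ _ _ _ _ mu _ mF F0).
by move=> t; apply: integral_ge0 => y _; exact: (F0 (t, y)).
Qed.

(** * Moebius transformations in real coordinates *)

Definition toC (p : T2) : C := p.1 +i* p.2.

Definition mob (g : 'M[R]_2) (p : T2) : T2 :=
  (complex.Re (moebius g (toC p)), complex.Im (moebius g (toC p))).

Lemma toC_mob g p : toC (mob g p) = moebius g (toC p).
Proof. by rewrite /mob /toC; case: (moebius g _). Qed.

Lemma det2 (g : 'M[R]_2) : \det g = g 0 0 * g 1 1 - g 0 1 * g 1 0.
Proof.
rewrite (expand_det_row g ord0) !big_ord_recl big_ord0 addr0.
rewrite /cofactor !det_mx11 !mxE /= addn0 addn1 expr0 expr1 mul1r mulN1r mulrN.
have -> : lift ord0 ord0 = 1 :> 'I_2 by apply/val_inj.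
have -> : lift 1 0 = 0 :> 'I_2 by apply/val_inj.
by [].
Qed.

(** This is |c z + d|^2. *)
Definition autj_norm2 (g : 'M[R]_2) (p : T2) : R :=
  (g 1 0 * p.1 + g 1 1) ^+ 2 + (g 1 0 * p.2) ^+ 2.

Lemma mobE g p : mob g p =
  (((g 0 0 * p.1 + g 0 1) * (g 1 0 * p.1 + g 1 1) + g 0 0 * p.2 * (g 1 0 * p.2)) * (autj_norm2 g p)^-1,
   (g 0 0 * p.2 * (g 1 0 * p.1 + g 1 1) - (g 0 0 * p.1 + g 0 1) * (g 1 0 * p.2)) * (autj_norm2 g p)^-1).
Proof.
case: p => x y; rewrite /mob /moebius /autj /toC /autj_norm2 /=.
by congr (_, _); rewrite !mul0r !subr0 !addr0; ring.
Qed.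

Lemma measurable_mob g : measurable_fun setT (mob g).
Proof.
have -> : mob g = (fun p => (((g 0 0 * p.1 + g 0 1) * (g 1 0 * p.1 + g 1 1) + g 0 0 * p.2 * (g 1 0 * p.2)) * (autj_norm2 g p)^-1,
   (g 0 0 * p.2 * (g 1 0 * p.1 + g 1 1) - (g 0 0 * p.1 + g 0 1) * (g 1 0 * p.2)) * (autj_norm2 g p)^-1)).
  by apply/funext => p; exact: mobE.
by apply: measurable_fun_pair; rewrite /autj_norm2; measurable_arith.
Qed.

Lemma autj_norm2_gt0 g p : \det g = 1 -> 0 < p.2 -> 0 < autj_norm2 g p.
Proof.
rewrite det2 => d y0; rewrite /autj_norm2.
have [c0|c0] := eqVneq (g 1 0) 0.
  rewrite c0 !mul0r expr0n addr0 add0r exprn_even_gt0//=.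
  by apply: contra_eq_neq d => ->; rewrite c0 !mulr0 subr0 eq_sym oner_eq0.
by rewrite ltr_wpDl ?sqr_ge0// exprn_even_gt0//= mulf_neq0// gt_eqF.
Qed.

(** Bruhat decomposition: for c = 0 the map is z |-> a^2 z + a b, and otherwise g z = a / c - 1 /
    (c^2 z + c d), an affine map followed by the inversion and a translation. *)
Lemma hyp_int_mob (g : 'M[R]_2) (f : T2 -> \bar R) : \det g = 1 ->
  measurable_fun setT f -> (forall p, 0 <= f p)%E ->
  hyp_int (fun p => f (mob g p)) = hyp_int f.
Proof.
move=> dg mf f0; have dg' := dg; rewrite det2 in dg'.
set a := g 0 0 in dg'; set b := g 0 1 in dg'; set c := g 1 0 in dg'; set d := g 1 1 in dg'.
have [c0|c0] := eqVneq c 0.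
  have ad : a * d = 1 by rewrite c0 mulr0 subr0 in dg'.
  have a0 : a != 0 by apply: contra_eq_neq ad => ->; rewrite mul0r eq_sym oner_eq0.
  have a2 : 0 < a ^+ 2 by rewrite exprn_even_gt0.
  rewrite -(hyp_int_affine (a * b) a2 mf f0); apply: eq_hyp_int => -[x y] /= y0; congr f.
  have dE : d = a^-1 by apply: (mulfI a0); rewrite ad divff.
  rewrite mobE /autj_norm2 -/a -/b -/c -/d c0 dE /=.
  by congr (_, _); field; rewrite a0.
have c2 : 0 < c ^+ 2 by rewrite exprn_even_gt0.
pose A (p : T2) : T2 := (1 * p.1 + a / c, 1 * p.2).
have mA : measurable_fun setT A by apply: measurable_fun_pair; measurable_arith.
have mfA : measurable_fun setT (fun p => f (A p)) by apply: (measurableT_comp mf).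
have mfAW : measurable_fun setT (fun p => f (A (inversion p))).
  by apply: (measurableT_comp mfA); exact: measurable_inversion.
rewrite -(hyp_int_affine (a / c) ltr01 mf f0) -/A.
rewrite -[RHS](hyp_int_inv mfA (fun p => f0 _)).
rewrite -[RHS](hyp_int_affine (c * d) c2 mfAW (fun p => f0 _)).
apply: eq_hyp_int => -[x y] /= y0; congr f.
have D0 := autj_norm2_gt0 (p := (x, y)) dg y0.
rewrite mobE /A /inversion /=; rewrite /autj_norm2 -/a -/b -/c -/d /= in D0 *.
have E : (c ^+ 2 * x + c * d) ^+ 2 + (c ^+ 2 * y) ^+ 2 = c ^+ 2 * ((c * x + d) ^+ 2 + (c * y) ^+ 2) by ring.
rewrite E invfM; have D1 := gt_eqF D0.
have bE : b = (a * d - 1) / c by apply: (mulIf c0); rewrite divfK//; lra.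
rewrite bE !mul1r; have D2 := negbT D1.
by congr (_, _); field; rewrite c0 D2.
Qed.

End Invariance.

(** * The area mean value inequality and discrete groups *)

Section Discrete.
Context {R : realType}.
Local Notation C := (Cplx R).
Local Notation mu := (@lebesgue_measure R).
Local Notation T2 := (measurableTypeR R * measurableTypeR R)%type.
Local Notation M2 := 'M[R]_2.

(** Such a set is the union of the squares with rational centre and radius that it contains, a
    countable union of measurable rectangles. *)
Lemma measurable_open_rect (U : set T2) :
  (forall p, U p -> exists2 d : R, 0 < d &
     forall q, `|q.1 - p.1| < d -> `|q.2 - p.2| < d -> U q) -> measurable U.
Proof.
move=> HU.
pose rect (a b r : rat) : set T2 :=
  [set q | `|q.1 - ratr a| < ratr r /\ `|q.2 - ratr b| < ratr r].
have mrect a b r : measurable (rect a b r).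
  have -> : rect a b r = (`](ratr a - ratr r), (ratr a + ratr r)[%classic : set (measurableTypeR R))
     `*` (`](ratr b - ratr r), (ratr b + ratr r)[%classic : set (measurableTypeR R)).
    apply/seteqP; split=> -[x y]; rewrite /rect /= !in_itv /= !ltr_norml.
      by move=> [/andP[? ?] /andP[? ?]]; split; apply/andP; split; lra.
    by move=> [/andP[? ?] /andP[? ?]]; split; apply/andP; split; lra.
  exact: measurableX.
pose V a b r : set T2 := if pselect (rect a b r `<=` U) then rect a b r else set0.
have mV a b r : measurable (V a b r).
  rewrite /V; case: (pselect (rect a b r `<=` U)) => ?; [exact: mrect|exact: measurable0].
suff -> : U = \bigcup_a \bigcup_b \bigcup_r V a b r.
  apply: bigcupT_measurable_rat => a; apply: bigcupT_measurable_rat => b.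
  by apply: bigcupT_measurable_rat => r; exact: mV.
apply/seteqP; split=> [p /HU[d d0 dP]|p [a _ [b _ [r _]]]]; last first.
  by rewrite /V; case: (pselect (rect a b r `<=` U)) => // h; exact: h.
have h1 : 0 < d / 2 by rewrite divr_gt0.
have [r] := rat_in_itvoo h1; rewrite in_itv /= => /andP[r0 rd].
have h2 : p.1 - ratr r < p.1 + ratr r by lra.
have h3 : p.2 - ratr r < p.2 + ratr r by lra.
have [a] := rat_in_itvoo h2; rewrite in_itv /= => /andP[a0 a1].
have [b] := rat_in_itvoo h3; rewrite in_itv /= => /andP[b0 b1].
exists a => //; exists b => //; exists r => //; rewrite /V; case: (pselect (rect a b r `<=` U)) => [?|[]].
  by split; rewrite ltr_norml; apply/andP; split; lra.
move=> q [q1 q2]; apply: dP; move: q1 q2; rewrite !ltr_norml => /andP[? ?] /andP[? ?];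
  apply/andP; split; lra.
Qed.

(** The values of f outside the half-plane are arbitrary and need not be measurable; they are
    replaced by 0. *)
Definition upext (f : C -> R) (p : T2) : R := if 0 < p.2 then f (toC p) else 0.

Lemma toC_dist (p q : T2) : cabs (toC q - toC p) <= `|q.1 - p.1| + `|q.2 - p.2|.
Proof. exact: cabs_le_ReIm. Qed.

Lemma measurable_upext (f : C -> R) :
  (forall z, upper z -> {for z, continuous f}) -> measurable_fun setT (upext f).
Proof.
move=> cf; have mup : measurable [set p : T2 | 0 < p.2].
  apply: measurable_open_rect => p /= p0; exists p.2 => // q _.
  by rewrite ltr_norml => /andP[h _]; lra.
apply: measurable_fun_if => //.
- by apply: measurable_fun_ltr; measurable_arith.
- rewrite setTI; have -> : ((fun p : T2 => 0 < p.2) @^-1` [set true]) = [set p : T2 | 0 < p.2].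
    by [].
  apply: (measurability _ (RGenOInfty.measurableE R)) => _ [_ [a ->]] <-.
  apply: measurable_open_rect => p [/= p0]; rewrite in_itv /= andbT => fa.
  have e0 : 0 < f (toC p) - a by rewrite subr_gt0.
  have [d d0 dP] := (contCRP f (toC p)).1 (cf (toC p) p0) _ e0.
  exists (Num.min (d / 2) p.2); first by rewrite lt_min divr_gt0.
  move=> q; rewrite !lt_min => /andP[q1 _] /andP[q2 q3]; split=> /=.
    by move: q3; rewrite ltr_norml => /andP[h _]; lra.
  rewrite in_itv /= andbT.
  have : cabs (toC q - toC p) < d by apply: (le_lt_trans (toC_dist _ _)); lra.
  by move/dP; rewrite ltr_norml => /andP[h _]; lra.
Qed.

Definition sqbox_points (z0 : C) (r : R) : set T2 := [set p | sqbox z0 r (toC p)].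

Lemma measurable_sqbox_points z0 r : measurable (sqbox_points z0 r).
Proof.
have -> : sqbox_points z0 r = (`[complex.Re z0 - r, complex.Re z0 + r]%classic : set (measurableTypeR R))
   `*` (`[complex.Im z0 - r, complex.Im z0 + r]%classic : set (measurableTypeR R)).
  by apply/seteqP; split=> -[x y]; rewrite /sqbox_points /sqbox /boxC /= !in_itv.
exact: measurableX.
Qed.

Definition boxfun (f : C -> C) z0 r (p : T2) : \bar R :=
  (\1_(sqbox_points z0 r) p * upext (fun z => cabs (f z)) p)%:E.

Lemma boxfun_ge0 f z0 r p : (0 <= boxfun f z0 r p)%E.
Proof.
rewrite lee_fin mulr_ge0 ?indicE//.
by rewrite /upext; case: ifP => // _; exact: cabs_ge0.
Qed.

Lemma measurable_boxfun (f : C -> C) z0 r : holomorphic f ->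
  measurable_fun setT (boxfun f z0 r).
Proof.
move=> hf; apply/measurable_EFinP; apply: measurable_funM.
  by apply: measurable_indic; exact: measurable_sqbox_points.
apply: measurable_upext => z uz.
by apply: (@continuous_comp _ _ _ f cabs); [exact: upper_cont|exact: continuous_cabs].
Qed.

Lemma lint_affineN (f : measurableTypeR R -> \bar R) (a b : R) : 0 < a ->
  measurable_fun setT f -> (forall x, (0 <= f x)%E) ->
  (\int[mu]_x f (b - a * x)%R = (a^-1)%:E * \int[mu]_x f x)%E.
Proof.
move=> a0 mf f0.
have mfo : measurable_fun setT (fun x : measurableTypeR R => f (- x)%R).
  by apply: (measurableT_comp mf); exact: oppr_measurable.
rewrite -(lint_opp mf f0) -(@lint_affine _ (fun x => f (- x)%R) a (- b) a0 mfo (fun x => f0 _)).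
by apply: eq_integral => x _; rewrite opprD opprK addrC.
Qed.

Lemma Rint_le_integral (h : R -> R) (g : measurableTypeR R -> \bar R) :
  (forall t : R, 0 <= t <= 1 -> {for t, continuous h}) ->
  (forall t : R, 0 <= t <= 1 -> 0 <= h t) ->
  measurable_fun setT g -> (forall t, (0 <= g t)%E) ->
  (forall t : R, (0 <= t <= 1)%R -> (h t)%:E <= g t)%E ->
  ((\int[mu]_(t in `[0%R, 1%R]) h t)%R%:E <= \int[mu]_t g t)%E.
Proof.
move=> ch h0 mg g0 hg; have ih := int01 ch.
have -> : (\int[mu]_(t in `[0%R, 1%R]) h t)%R%:E = (\int[mu]_(t in `[0%R, 1%R]) (h t)%:E)%E.
  rewrite /Rintegral fineK//; exact: integrable_fin_num.
have m01 : measurable (`[0%R, 1%R]%classic : set (measurableTypeR R)) by [].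
apply: (@le_trans _ _ (\int[mu]_(t in `[0%R, 1%R]) g t)%E).
  apply: ge0_le_integral => //.
  - exact: (measurable_int mu ih).
  - exact: measurable_funTS.
apply: ge0_subset_integral => //.
Qed.

(** [submean_line] for the half-side s, multiplied by s, is integrated over s in [r / 2, r]. On the
    left this gives at least |csq| |f(z0)| (r / 2)^2, on the right at most 8 times the area
    integral, whence 32 = 8 * 4. *)
Lemma submean_area (f : C -> C) z0 r : holomorphic f -> 0 < r -> r < complex.Im z0 ->
  ((cabs (f z0))%:E <= (32 / (cabs csq * r ^+ 2))%:E *
    \int[mu \x mu]_p boxfun f z0 r p)%E.
Proof.
move=> hf r0 rz.
have q0 : 0 < cabs (csq : C) by rewrite cabs_gt0 csq_neq0.
have bup w : sqbox z0 r w -> upper w.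
  by move=> [_ /andP[h _]]; rewrite /upper /=; lra.
pose F := boxfun f z0 r.
have mF : measurable_fun setT F by exact: measurable_boxfun.
have F0 p : (0 <= F p)%E by exact: boxfun_ge0.
have FE p : sqbox z0 r (toC p) -> F p = (cabs (f (toC p)))%:E.
  move=> h; rewrite /F /boxfun indicE mem_set ?mul1r// /upext.
  by have := bup _ h; rewrite /upper /= => ->.
(* The integral of F along the whole line through side j of the square of half-side s. As s runs
   over the reals these lines sweep the plane once, so each j contributes the full area integral. *)
pose L (j : nat) (s : R) : \bar R := match j with
  | 0%N => \int[mu]_x F (x, complex.Im z0 - s)%R
  | 1%N => \int[mu]_y F (complex.Re z0 + s, y)%R
  | 2%N => \int[mu]_x F (x, complex.Im z0 + s)%R
  | _ => \int[mu]_y F (complex.Re z0 - s, y)%R end%E.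
have mG := @measurable_fun_fubini_tonelli_G _ _ _ _ _ mu _ mF F0.
have mFF := @measurable_fun_fubini_tonelli_F _ _ _ _ _ mu _ mF F0.
have G0 y : (0 <= \int[mu]_x F (x, y))%E by apply: integral_ge0 => x _; exact: F0.
have FF0 x : (0 <= \int[mu]_y F (x, y))%E by apply: integral_ge0 => y _; exact: F0.
have mL j : (j < 4)%N -> measurable_fun [set: measurableTypeR R] (L j).
  case: j => [|[|[|[|//]]]] _.
  - by apply: (measurableT_comp mG); measurable_arith.
  - by apply: (measurableT_comp mFF); measurable_arith.
  - by apply: (measurableT_comp mG); measurable_arith.
  - by apply: (measurableT_comp mFF); measurable_arith.
have L0 j s : (j < 4)%N -> (0 <= L j s)%E.
  by case: j => [|[|[|[|//]]]] _; rewrite /L.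
have iL j : (j < 4)%N -> (\int[mu]_s L j s = \int[mu \x mu]_p F p)%E.
  case: j => [|[|[|[|//]]]] _.
  - transitivity (\int[mu]_s fubini_G mu F (complex.Im z0 - 1 * s)%R)%E.
      by apply: eq_integral => s _; rewrite mul1r.
    by rewrite (lint_affineN _ ltr01 mG G0) invr1 mul1e (tonelli21 mF F0).
  - transitivity (\int[mu]_s fubini_F mu F (1 * s + complex.Re z0)%R)%E.
      by apply: eq_integral => s _; rewrite mul1r addrC.
    by rewrite (lint_affine _ ltr01 mFF FF0) invr1 mul1e (tonelli12 mF F0).
  - transitivity (\int[mu]_s fubini_G mu F (1 * s + complex.Im z0)%R)%E.
      by apply: eq_integral => s _; rewrite mul1r addrC.
    by rewrite (lint_affine _ ltr01 mG G0) invr1 mul1e (tonelli21 mF F0).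
  - transitivity (\int[mu]_s fubini_F mu F (complex.Re z0 - 1 * s)%R)%E.
      by apply: eq_integral => s _; rewrite mul1r.
    by rewrite (lint_affineN _ ltr01 mFF FF0) invr1 mul1e (tonelli12 mF F0).
have E (s : R) (j : nat) : 0 < s -> s <= r -> (j < 4)%N ->
   ((\int[mu]_(t in `[0%R, 1%R]) cabs (f (seg (corner z0 s j) (corner z0 s j.+1) t)))%R%:E
     <= ((2 * s)^-1)%:E * L j s)%E.
  move=> s0 sr j4.
  have s20 : 0 < 2 * s by rewrite mulr_gt0.
  have bs t : 0 <= t <= 1 -> sqbox z0 r (seg (corner z0 s j) (corner z0 s j.+1) t).
    move=> t01; have [[/andP[a1 a2] /andP[a3 a4]] _] := edge_onsq z0 (ltW s0) j4 t01.
    by split; apply/andP; split; lra.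
  have cf : cont01 (fun t => f (seg (corner z0 s j) (corner z0 s j.+1) t)).
    by apply: cont01_seg => t t01; apply: (upper_cont hf); apply: bup; exact: bs.
  pose P (t : R) : T2 := match j with
   | 0%N => (2 * s * t + (complex.Re z0 - s), complex.Im z0 - s)
   | 1%N => (complex.Re z0 + s, 2 * s * t + (complex.Im z0 - s))
   | 2%N => (complex.Re z0 + s - 2 * s * t, complex.Im z0 + s)
   | _ => (complex.Re z0 - s, complex.Im z0 + s - 2 * s * t) end.
  have PE t : toC (P t) = seg (corner z0 s j) (corner z0 s j.+1) t.
    by apply/eqP; rewrite eq_complex seg_Re seg_Im /P /corner; case: j {bs cf P} j4 => [|[|[|[|//]]]] _;
      case: (z0) => x y /=; apply/andP; split; apply/eqP; ring.
  have mP : measurable_fun setT (P : measurableTypeR R -> T2).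
    rewrite /P; case: j {bs cf P PE} j4 => [|[|[|[|//]]]] _;
      apply: measurable_fun_pair; measurable_arith.
  have -> : (((2 * s)^-1)%:E * L j s = \int[mu]_t F (P t))%E.
    rewrite /P /L; case: j {bs cf P PE mP} j4 => [|[|[|[|//]]]] _.
    - have m1 : measurable_fun [set: measurableTypeR R] (fun x => F (x, complex.Im z0 - s)).
        by apply: (measurableT_comp mF); apply: measurable_fun_pair; measurable_arith.
      by rewrite (@lint_affine _ (fun x => F (x, complex.Im z0 - s)) _ _ s20 m1 (fun x => F0 _)).
    - have m1 : measurable_fun [set: measurableTypeR R] (fun y => F (complex.Re z0 + s, y)).
        by apply: (measurableT_comp mF); apply: measurable_fun_pair; measurable_arith.
      by rewrite (@lint_affine _ (fun y => F (complex.Re z0 + s, y)) _ _ s20 m1 (fun x => F0 _)).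
    - have m1 : measurable_fun [set: measurableTypeR R] (fun x => F (x, complex.Im z0 + s)).
        by apply: (measurableT_comp mF); apply: measurable_fun_pair; measurable_arith.
      by rewrite (@lint_affineN (fun x => F (x, complex.Im z0 + s)) _ _ s20 m1 (fun x => F0 _)).
    - have m1 : measurable_fun [set: measurableTypeR R] (fun y => F (complex.Re z0 - s, y)).
        by apply: (measurableT_comp mF); apply: measurable_fun_pair; measurable_arith.
      by rewrite (@lint_affineN (fun y => F (complex.Re z0 - s, y)) _ _ s20 m1 (fun x => F0 _)).
  apply: Rint_le_integral.
  - exact: (cont01_cabs cf).
  - by move=> t _; exact: cabs_ge0.
  - exact: (measurableT_comp mF mP).
  - by move=> t; exact: F0.
  - by move=> t t01; rewrite FE PE ?lexx//; exact: bs.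
have LE (s : R) : 0 < s -> s <= r ->
   ((cabs (csq : C) * cabs (f z0) * s)%:E <= 2%:E * \sum_(j < 4) L j s)%E.
  move=> s0 sr.
  have dfs w : sqbox z0 s w -> derivable f w 1.
    by move=> [/andP[a1 a2] /andP[a3 a4]]; apply: hf; rewrite /upper /=; lra.
  have h1 := submean_line s0 dfs.
  have -> : (2%:E * \sum_(j < 4) L j s = (4 * s)%:E * \sum_(j < 4) ((2 * s)^-1)%:E * L j s)%E.
    rewrite -ge0_sume_distrr; last by move=> j _; exact: L0.
    by rewrite muleA -EFinM; congr (_%:E * _)%E; field; rewrite gt_eqF.
  apply: (@le_trans _ _ ((4 * s)%:E * (\sum_(j < 4)
    (\int[mu]_(t in `[0%R, 1%R]) cabs (f (seg (corner z0 s j) (corner z0 s j.+1) t)))%R)%:E)%E).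
    by rewrite -EFinM lee_fin [leRHS]mulrAC ler_wpM2r// ltW.
  rewrite lee_wpmul2l ?lee_fin ?mulr_ge0 ?(ltW s0)//.
  by rewrite -sumEFin; apply: lee_sum => j _; exact: E.
have mS : measurable_fun [set: measurableTypeR R] (fun s => 2%:E * \sum_(j < 4) L j s)%E.
  apply: emeasurable_funM; first exact: measurable_cst.
  by apply: emeasurable_sum => j; exact: mL.
have S0 s : (0 <= 2%:E * \sum_(j < 4) L j s)%E.
  by rewrite mule_ge0// sume_ge0// => j _; exact: L0.
have tot : (\int[mu]_s (2%:E * \sum_(j < 4) L j s) = 8%:E * \int[mu \x mu]_p F p)%E.
  rewrite ge0_integralZl_EFin//; last 2 first.
  - by move=> s _; rewrite sume_ge0// => j _; exact: L0.
  - by apply: emeasurable_sum => j; exact: mL.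
  rewrite ge0_integral_sum//; last 2 first.
  - by move=> j; exact: mL.
  - by move=> j s _; exact: L0.
  rewrite (eq_bigr (fun=> \int[mu \x mu]_p F p)%E); last by move=> j _; exact: iL.
  rewrite !big_ord_recl big_ord0 adde0.
  have IF0 : (0 <= \int[mu \x mu]_p F p)%E by apply: integral_ge0 => p _; exact: F0.
  case: (\int[mu \x mu]_p F p)%E IF0 => [x| |//] _.
    by rewrite -?EFinD -!EFinM -?EFinD; congr EFin; ring.
  by rewrite !gt0_muley ?lte_fin// !gt0_muley ?lte_fin.
pose D : set (measurableTypeR R) := `[r / 2, r]%classic.
have mD : measurable D by exact: measurable_itv.
have muD : mu D = (r / 2)%:E.
  rewrite lebesgue_measure_itv /= lte_fin.
  have -> : r / 2 < r by lra.
  by rewrite -EFinB; congr EFin; field.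
pose A := cabs (csq : C) * cabs (f z0) * (r / 2).
have A0 : 0 <= A by rewrite /A; apply: mulr_ge0; [apply: mulr_ge0; exact: cabs_ge0|lra].
have fin : ((A * (r / 2))%:E <= 8%:E * \int[mu \x mu]_p F p)%E.
  rewrite -tot; apply: (@le_trans _ _ (\int[mu]_(s in D) (2%:E * \sum_(j < 4) L j s))%E); last first.
    by apply: ge0_subset_integral.
  have -> : ((A * (r / 2))%:E = \int[mu]_(s in D) A%:E)%E by rewrite integral_cst// EFinM -muD.
  apply: ge0_le_integral => //.
  - exact: measurable_funTS.
  - move=> s; rewrite /D /= in_itv /= => /andP[s1 s2].
    apply: (le_trans _ (LE s _ s2)); last by lra.
    by rewrite lee_fin /A ler_wpM2l// mulr_ge0 ?cabs_ge0.
have -> : (32 / (cabs csq * r ^+ 2))%:E = ((4 / (cabs csq * r ^+ 2))%:E * 8%:E)%E.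
  by rewrite -EFinM; congr EFin; field; rewrite !gt_eqF.
rewrite -muleA.
have -> : (cabs (f z0))%:E = ((4 / (cabs csq * r ^+ 2))%:E * (A * (r / 2))%:E)%E.
  by rewrite -EFinM /A; congr EFin; field; rewrite !gt_eqF.
rewrite lee_wpmul2l// lee_fin divr_ge0// mulr_ge0 ?cabs_ge0 ?sqr_ge0//.
Qed.

(** * Discrete groups of matrices *)

Definition mxbound (g : 'M[R]_2) (B : R) := forall i j, `|g i j| <= B.

Lemma mul2E (g h : 'M[R]_2) i j : (g *m h) i j = g i 0 * h 0 j + g i 1 * h 1 j.
Proof.
rewrite mxE !big_ord_recl big_ord0 addr0.
by have -> : lift ord0 ord0 = 1 :> 'I_2 by apply/val_inj.
Qed.

Lemma ord2P (i : 'I_2) : i = 0 \/ i = 1.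
Proof. by case: i => [[|[|//]] h]; [left|right]; apply/val_inj. Qed.

Lemma mx2P (g h : 'M[R]_2) : g 0 0 = h 0 0 -> g 0 1 = h 0 1 -> g 1 0 = h 1 0 ->
  g 1 1 = h 1 1 -> g = h.
Proof.
by move=> *; apply/matrixP => i j; case: (ord2P i) (ord2P j) => -> [] ->.
Qed.

Lemma det_neq0_unit (g : 'M[R]_2) : \det g = 1 -> g \in unitmx.
Proof. by move=> d; rewrite unitmxE d unitr1. Qed.

Lemma inv2E (g : 'M[R]_2) : \det g = 1 ->
  [/\ invmx g 0 0 = g 1 1, invmx g 0 1 = - g 0 1, invmx g 1 0 = - g 1 0
    & invmx g 1 1 = g 0 0].
Proof.
move=> d; have := d; rewrite det2 => d'.
pose h : 'M[R]_2 := \matrix_(i, j) (if i == 0 then (if j == 0 then g 1 1 else - g 0 1)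
   else (if j == 0 then - g 1 0 else g 0 0)).
have gh : g *m h = 1%:M.
  by apply: mx2P; rewrite mul2E !mxE /=; lra.
have -> : invmx g = h.
  by rewrite -[h]mul1mx -(mulVmx (det_neq0_unit d)) -mulmxA gh mulmx1.
by rewrite !mxE.
Qed.

Lemma det_inv (g : 'M[R]_2) : \det g = 1 -> \det (invmx g) = 1.
Proof. by move=> d; rewrite det_inv d invr1. Qed.

Lemma isolated_id (G : set 'M[R]_2) : fuchsian_first_kind G ->
  exists2 d : R, 0 < d & forall g, G g -> mxbound (g - 1%:M) d -> g = 1%:M.
Proof.
move=> [sG dG _]; have [_ [V V1 VG]] := dG _ (psl2_1 sG).
have /nbhs_ballP[e /= e0 eV] := V1.
exists (e / 2); first by rewrite divr_gt0.
move=> g Gg gb; have : [set 1%:M] g; last by [].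
rewrite -VG; split=> //; apply: eV.
split=> // i j; rewrite -ball_normE /ball_ /= distrC.
have := gb i j; rewrite !mxE => h; apply: (le_lt_trans h); lra.
Qed.

Lemma mul2_bound (g h : 'M[R]_2) (A B : R) :
  mxbound g A -> mxbound h B -> mxbound (g *m h) (2 * A * B).
Proof.
move=> gA hB i j; rewrite mul2E; apply: (le_trans (ler_normD _ _)).
have A0 : 0 <= A by exact: le_trans (gA 0 0).
rewrite !normrM.
have h1 := ler_pM (normr_ge0 _) (normr_ge0 _) (gA i 0) (hB 0 j).
have h2 := ler_pM (normr_ge0 _) (normr_ge0 _) (gA i 1) (hB 1 j).
lra.
Qed.

Lemma inv2_bound (g : 'M[R]_2) (A : R) : \det g = 1 -> mxbound g A -> mxbound (invmx g) A.
Proof.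
move=> /inv2E[e1 e2 e3 e4] gA i j.
by case: (ord2P i) (ord2P j) => -> [] ->; rewrite ?e1 ?e2 ?e3 ?e4 ?normrN.
Qed.

(** Pigeonhole: the entries are sorted into a grid of mesh d / (2 B), where d is the isolation
    radius of the identity. If g and h share a cell, then g^-1 h is within d of the identity, so g =
    h. *)
Lemma discrete_finite (G : set 'M[R]_2) B : fuchsian_first_kind G ->
  finite_set [set g | G g /\ mxbound g B].
Proof.
move=> fG; have sG := fuchsian_subgroup fG; have [d d0 dP] := isolated_id fG.
have [B0|B0] := leP B 0.
  apply: (@sub_finite_set _ _ set0) => // g [Gg gB].
  have g0 i j : g i j = 0.
    by apply/eqP; rewrite -normr_le0; exact: le_trans (gB i j) B0.
  have := psl2_det sG Gg; rewrite det2 !g0 !mul0r subr0 => /eqP.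
  by rewrite eq_sym oner_eq0.
pose e := d / (2 * B).
have e0 : 0 < e by rewrite divr_gt0// mulr_gt0.
have eB : 2 * B * e = d by rewrite /e; field; rewrite gt_eqF.
pose q (x : R) := Num.truncn ((x + B) / e).
pose f (g : 'M[R]_2) := ((q (g 0 0), q (g 0 1)), (q (g 1 0), q (g 1 1))).
pose N := (Num.truncn ((B + B) / e)).+1.
have qlt x : `|x| <= B -> (q x < N)%N.
  rewrite ler_norml => /andP[x1 x2].
  by rewrite /q /N ltnS; apply: le_truncn; rewrite ler_pM2r ?invr_gt0// lerD2r.
have qeq x y : `|x| <= B -> `|y| <= B -> q x = q y -> `|y - x| <= e.
  rewrite !ler_norml => /andP[x1 x2] /andP[y1 y2] qxy.
  have hx : 0 <= (x + B) / e by rewrite divr_ge0 ?(ltW e0)//; lra.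
  have hy : 0 <= (y + B) / e by rewrite divr_ge0 ?(ltW e0)//; lra.
  have /andP[a1 a2] := truncn_itv hx; have /andP[b1 b2] := truncn_itv hy.
  move: b1 b2; rewrite -/(q y) -qxy -/(q x) in a1 a2 * => b1 b2.
  rewrite -natr1 in a2 b2.
  have : (y - x) / e = (y + B) / e - (x + B) / e by field; rewrite gt_eqF.
  move=> E; have : -1 <= (y - x) / e <= 1 by apply/andP; split; lra.
  by rewrite ler_pdivlMr// ler_pdivrMr// mulN1r mul1r.
have finj : {in [set g | G g /\ mxbound g B] &, injective f}.
  move=> g h; rewrite !inE => -[Gg gB] [Gh hB] [f1 f2 f3 f4].
  have dg := psl2_det sG Gg.
  have b1 : mxbound (h - g) e.
    move=> i j; rewrite !mxE; apply: qeq => //.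
    by case: (ord2P i) (ord2P j) => -> [] ->.
  have e1 : invmx g *m h = 1%:M.
    apply: dP; first by apply: psl2_mul => //; exact: psl2_inv.
    have -> : invmx g *m h - 1%:M = invmx g *m (h - g).
      by rewrite mulmxBr mulVmx// det_neq0_unit.
    by rewrite -eB; apply: mul2_bound => //; exact: inv2_bound.
  by rewrite -[h]mul1mx -(mulmxV (det_neq0_unit dg)) -mulmxA e1 mulmx1.
have fin : finite_set (f @` [set g | G g /\ mxbound g B]).
  apply: (@sub_finite_set _ _ ((`I_N `*` `I_N) `*` (`I_N `*` `I_N))).
    by move=> _ [g [_ gB] <-]; split; split; apply: qlt.
  by apply: finite_setX; apply: finite_setX; exact: finite_II.
by rewrite -(eq_finite_set (inj_card_eq finj)).
Qed.

Lemma discrete_countable (G : set 'M[R]_2) : fuchsian_first_kind G -> countable G.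
Proof.
move=> fG.
have -> : G = \bigcup_(n in [set: nat]) [set g | G g /\ mxbound g n%:R].
  apply/seteqP; split=> [g Gg|g [n _ []//]].
  pose s := `|g 0 0| + `|g 0 1| + `|g 1 0| + `|g 1 1|.
  exists (Num.truncn s).+1 => //; split=> // i j.
  apply: (le_trans _ (ltW (truncnS_gt s))).
  have := normr_ge0 (g 0 0); have := normr_ge0 (g 0 1); have := normr_ge0 (g 1 0); have := normr_ge0 (g 1 1).
  by rewrite /s; case: (ord2P i) (ord2P j) => -> [] ->; lra.
apply: bigcup_countable => // n _; apply: finite_set_countable; exact: discrete_finite.
Qed.

(** * The action on the half-plane and the slash operator *)

Lemma autj_neq0 (g : 'M[R]_2) z : \det g = 1 -> upper z -> autj g z != 0.
Proof.
move=> dg; case: z => x y; rewrite /upper /= => y0.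
have D0 := autj_norm2_gt0 (p := (x, y)) dg y0.
rewrite -cabs_eq0 -sqrf_eq0 sqr_cabs /autj /=.
have -> : (g 1 0 * x - 0 * y + g 1 1) ^+ 2 + (g 1 0 * y + 0 * x + 0) ^+ 2 = autj_norm2 g (x, y).
  by rewrite /autj_norm2 /=; ring.
by rewrite gt_eqF.
Qed.

Lemma sqr_cabs_autj (g : 'M[R]_2) (x y : R) : cabs (autj g (x +i* y)) ^+ 2 = autj_norm2 g (x, y).
Proof. by rewrite sqr_cabs /autj /autj_norm2 /=; ring. Qed.

Lemma moebius_Im (g : 'M[R]_2) z : \det g = 1 -> upper z ->
  complex.Im (moebius g z) = complex.Im z / cabs (autj g z) ^+ 2.
Proof.
move=> dg; case: z => x y _.
have -> : moebius g (x +i* y) = toC (mob g (x, y)) by rewrite toC_mob.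
rewrite sqr_cabs_autj mobE [complex.Im _]/= [complex.Im _ in RHS]/=.
by rewrite det2 in dg; congr (_ / _); rewrite -[RHS]mulr1 -[X in _ = _ * X]dg; ring.
Qed.

Lemma moebius_upper (g : 'M[R]_2) z : \det g = 1 -> upper z -> upper (moebius g z).
Proof.
move=> dg uz; rewrite /upper /= moebius_Im// divr_gt0// exprn_gt0// cabs_gt0.
exact: autj_neq0.
Qed.

Lemma autjM (g h : 'M[R]_2) z : \det h = 1 -> upper z ->
  autj (g *m h) z = autj g (moebius h z) * autj h z.
Proof.
move=> dh uz; have := autj_neq0 dh uz; rewrite /moebius /autj !mul2E => n0.
by rewrite !rmorphD !rmorphM; field.
Qed.

Lemma moebiusM (g h : 'M[R]_2) z : \det g = 1 -> \det h = 1 -> upper z ->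
  moebius (g *m h) z = moebius g (moebius h z).
Proof.
move=> dg dh uz; have n1 := autj_neq0 dh uz.
have n2 := autj_neq0 dg (moebius_upper dh uz).
have e := autjM g dh uz.
rewrite {1}/moebius e [RHS]/moebius.
apply: (mulIf (mulf_neq0 n2 n1)); rewrite divfK ?mulf_neq0// mulrA divfK//.
rewrite !mul2E !rmorphD !rmorphM [moebius h z]/moebius /autj.
by move: n1; rewrite /autj => n1; field.
Qed.

Lemma moebius1 z : moebius (1%:M : 'M[R]_2) z = z.
Proof. by rewrite /moebius /autj !mxE /= mul0r mul1r addr0 add0r divr1. Qed.

Lemma moebiusVK (g : 'M[R]_2) z : \det g = 1 -> upper z ->
  moebius (invmx g) (moebius g z) = z.
Proof.
by move=> dg uz; rewrite -moebiusM ?det_inv// mulVmx ?det_neq0_unit// moebius1.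
Qed.

Lemma moebiusKV (g : 'M[R]_2) z : \det g = 1 -> upper z ->
  moebius g (moebius (invmx g) z) = z.
Proof.
by move=> dg uz; rewrite -moebiusM ?det_inv// mulmxV ?det_neq0_unit// moebius1.
Qed.

Lemma slashM k (f : C -> C) (g h : 'M[R]_2) z : \det g = 1 -> \det h = 1 -> upper z ->
  slash k f (g *m h) z = slash k (slash k f g) h z.
Proof.
move=> dg dh uz; rewrite /slash moebiusM// autjM// exprMn invfM.
by rewrite mulrA.
Qed.

Lemma cabs_slash k (f : C -> C) (g : 'M[R]_2) z : ~~ odd k -> \det g = 1 -> upper z ->
  cabs (slash k f g z) * complex.Im z ^+ k./2 =
  cabs (f (moebius g z)) * complex.Im (moebius g z) ^+ k./2.
Proof.
move=> ek dg uz; rewrite /slash cabsM cabsV cabsX moebius_Im// expr_div_n -exprM.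
by rewrite mul2n even_halfK// -mulrA (mulrC (_^-1)).
Qed.

Lemma derivable_pow (f : C -> C) (z : C) n : derivable f z 1 ->
  derivable (fun z => f z ^+ n) z 1.
Proof.
move=> df; elim: n => [|n IH]; first by under eq_fun do rewrite expr0; exact: derivable_cst.
have -> : (fun z => f z ^+ n.+1) = (fun z => f z * f z ^+ n).
  by apply/funext => w; rewrite exprS.
exact: (@derivableM _ _ f (fun z => f z ^+ n) z 1 df IH).
Qed.

Lemma holomorphic_slash k (f : C -> C) (g : 'M[R]_2) : \det g = 1 ->
  holomorphic f -> holomorphic (slash k f g).
Proof.
move=> dg hf z uz.
have n0 := autj_neq0 dg uz.
have lin (a b : C) : derivable (fun z : C => a * z + b) z 1.
  apply: (@derivableD _ _ _ (fun z : C => a * z) (cst b)); last exact: derivable_cst.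
  by apply: (@derivableM _ _ (cst a : C -> C) id); [exact: derivable_cst|exact: derivable_id].
have da : derivable (autj g) z 1 by exact: lin.
have dm : derivable (moebius g) z 1.
  apply: (@derivableM _ _ (fun z : C => (g 0 0)%:C * z + (g 0 1)%:C) (fun z => (autj g z)^-1)); first exact: lin.
  exact: derivableV.
apply: (@derivableM _ _ (f \o moebius g) (fun z => (autj g z ^+ k)^-1)).
  apply/derivable1_diffP; apply: (@differentiable_comp _ _ _ _ (moebius g) f z);
    apply/derivable1_diffP; first exact: dm.
  by apply: hf; exact: moebius_upper.
apply: derivableV; first by rewrite expf_neq0.
exact: derivable_pow.
Qed.

Lemma moebius_cder (g : 'M[R]_2) z : \det g = 1 -> upper z ->
  cder (moebius g) z (autj g z ^- 2).
Proof.
move=> dg uz; have n0 := autj_neq0 dg uz.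
pose N (z : C) := (g 0 0)%:C * z + (g 0 1)%:C.
have lin (a b : C) : is_derive (z : C) (1 : C) (fun z : C => a * z + b) a.
  apply: cder_is_derive => e e0; exists 1 => // w _.
  have -> : a * w + b - (a * z + b) - a * (w - z) = 0 by ring.
  by rewrite cabs0 mulr_ge0 ?cabs_ge0// ltW.
have dN := lin (g 0 0)%:C (g 0 1)%:C; have dA := lin (g 1 0)%:C (g 1 1)%:C.
have [dA1 dA2] := dA; have [dN1 dN2] := dN.
have da : derivable (autj g) z 1 := dA1.
have dV := derivableV n0 da.
suff D : is_derive (z : C) (1 : C) (moebius g) (autj g z ^- 2) by exact: (is_derive_cder D).
apply: DeriveDef.
  exact: (@derivableM _ _ N (fun z => (autj g z)^-1) _ _ dN1 dV).
have -> : moebius g = N * (fun z => (autj g z)^-1) by [].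
rewrite (deriveM dN1 dV) (deriveV n0 da) dA2 dN2 /N [_ *: _]/GRing.scale /=.
have dg' : (g 0 0)%:C * (g 1 1)%:C - (g 0 1)%:C * (g 1 0)%:C = 1 :> C.
  by rewrite -!rmorphM -rmorphB -det2 dg.
rewrite /autj in n0 *.
transitivity (((g 0 0)%:C * (g 1 1)%:C - (g 0 1)%:C * (g 1 0)%:C) / ((g 1 0)%:C * z + (g 1 1)%:C) ^+ 2 : C).
  have sc (u v : C) : u *: v = u * v by [].
  by rewrite !sc; field.
by rewrite dg' mul1r.
Qed.

(** Comparing the heights of z and g z bounds c z + d, then a z + b = (g z) (c z + d) is bounded.
    Since Im z >= m, the imaginary parts bound a and c, and the real parts then bound b and d. *)
Lemma box_return_bound (g : 'M[R]_2) (X m M : R) z : 0 < m -> \det g = 1 ->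
  boxC (- X) X m M z -> boxC (- X) X m M (moebius g z) ->
  mxbound g ((X + M + 1) * (M / m + 1) * (1 + X / m) + (X + M + 1) * (M / m + 1) / m).
Proof.
move=> m0 dg [x1 /andP[y1 y2]] [u1 /andP[v1 v2]].
have uz : upper z by exact: lt_le_trans y1.
have n0 := autj_neq0 dg uz.
have Y0 : 0 < complex.Im z by [].
have X0 : 0 <= X by move: x1 => /andP[? ?]; lra.
have M0 : 0 < M by lra.
pose Q := M / m + 1.
have Mm0 : 0 < M / m by rewrite divr_gt0.
have Q1 : 1 <= Q by rewrite /Q; lra.
have jQ : cabs (autj g z) <= Q.
  have c0 : 0 < cabs (autj g z) by rewrite cabs_gt0.
  have := moebius_Im dg uz => E.
  have : cabs (autj g z) ^+ 2 <= M / m.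
    rewrite ler_pdivlMr//; apply: (le_trans _ y2).
    by rewrite -[leRHS](divfK (_ : cabs (autj g z) ^+ 2 != 0)) ?expf_neq0 ?gt_eqF// -E mulrC ler_wpM2r// sqr_ge0.
  by rewrite /Q; nra.
have a1 : cabs (moebius g z) <= X + M.
  apply: (le_trans (cabs_le_ReIm _)); rewrite lerD// ?ler_norml//.
  by apply/andP; split; lra.
pose w : C := (g 0 0)%:C * z + (g 0 1)%:C.
have wE : w = moebius g z * autj g z by rewrite /moebius divfK.
have wb : cabs w <= (X + M) * Q.
  by rewrite wE cabsM; apply: ler_pM => //; exact: cabs_ge0.
have key (a b K : R) : cabs (a%:C * z + b%:C : C) <= K -> `|a| <= K / m /\ `|b| <= K * (1 + X / m).
  move=> h; have K0 : 0 <= K by exact: le_trans (cabs_ge0 _) h.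
  have ha : `|a| * complex.Im z <= K.
    apply: (le_trans _ h); apply: (le_trans _ (Im_le_cabs _)).
    by case: (z) Y0 => x y /= Y0; rewrite mul0r !addr0 normrM (gtr0_norm Y0).
  have ha' : `|a| <= K / m.
    by rewrite ler_pdivlMr//; apply: (le_trans _ ha); rewrite ler_wpM2l.
  split=> //.
  have : `|a * complex.Re z + b| <= K.
    apply: (le_trans _ h); apply: (le_trans _ (Re_le_cabs _)).
    by case: (z) => x y /=; rewrite mul0r subr0.
  have xb : `|complex.Re z| <= X by rewrite ler_norml.
  have hx : `|a * complex.Re z| <= K / m * X by rewrite normrM; apply: ler_pM.
  move=> h2; have := ler_normB (a * complex.Re z + b) (a * complex.Re z).
  have -> : a * complex.Re z + b - a * complex.Re z = b by ring.
  have -> : K * (1 + X / m) = K + K / m * X by field; rewrite gt_eqF.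
  lra.
have [h1 h2] := key _ _ _ wb; have [h3 h4] := key _ _ _ jQ.
have K1 : (X + M) * Q <= (X + M + 1) * Q by nra.
have K2 : Q <= (X + M + 1) * Q by nra.
have im0 : 0 < m^-1 by rewrite invr_gt0.
have f1 : 0 <= 1 + X / m by rewrite addr_ge0// mulr_ge0// ltW.
have t1 : 0 <= (X + M + 1) * Q * (1 + X / m) by rewrite !mulr_ge0//; lra.
have t2 : 0 <= (X + M + 1) * Q / m by rewrite !mulr_ge0//; lra.
have g1 : (X + M) * Q / m <= (X + M + 1) * Q / m by rewrite ler_wpM2r// ltW.
have g2 : Q / m <= (X + M + 1) * Q / m by rewrite ler_wpM2r// ltW.
have g3 : (X + M) * Q * (1 + X / m) <= (X + M + 1) * Q * (1 + X / m) by rewrite ler_wpM2r.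
have g4 : Q * (1 + X / m) <= (X + M + 1) * Q * (1 + X / m) by rewrite ler_wpM2r.
rewrite -/Q => i j; case: (ord2P i) (ord2P j) => -> [] ->; lra.
Qed.

End Discrete.

(** * Unfolding and unordered sums *)

Section Sums.
Context {R : realType}.
Local Notation C := (Cplx R).
Local Notation mu := (@lebesgue_measure R).
Local Notation T2 := (measurableTypeR R * measurableTypeR R)%type.
Local Notation M2 := 'M[R]_2.

(** * Integrals summed over a group or over its cosets *)

Lemma esum_subset (I : choiceType) (A B : set I) (a : I -> \bar R) :
  A `<=` B -> (\esum_(i in A) a i <= \esum_(i in B) a i)%E.
Proof.
move=> AB; apply: ge_ereal_sup => _ [X [fX XA] <-]; apply: esum_ge; exists X => //.
by split=> // x /XA /AB.
Qed.

Lemma esum_ge1 (I : choiceType) (A : set I) (a : I -> \bar R) i :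
  A i -> (a i <= \esum_(j in A) a j)%E.
Proof.
move=> Ai; apply: esum_ge; exists [set i]; first by split=> // j ->.
by rewrite fsbig_set1.
Qed.

(** An injection of the countable [A] into the integers makes the family a sequence, extended by 0
    off the image, so that integral and sum can be exchanged. At each point one suitable index
    already dominates h. *)
Lemma hyp_int_le_esum (A : set M2) (h : T2 -> \bar R) (a : M2 -> T2 -> \bar R) :
  countable A -> measurable_fun setT h -> (forall p, 0 <= h p)%E ->
  (forall i, measurable_fun setT (a i)) -> (forall i p, 0 <= a i p)%E ->
  (forall p, (0 < p.2)%R -> exists2 i, A i & (h p <= a i p)%E) ->
  (hyp_int h <= \esum_(i in A) hyp_int (a i))%E.
Proof.
move=> cA mh h0 ma a0 ha.
have /pcard_injP[f finj] := cA.
pose b n : T2 -> \bar R := if pselect (exists2 i, A i & f i = n) is left H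
  then a (projT1 (cid2 H)) else cst 0%E.
have bE i : A i -> b (f i) = a i.
  move=> Ai; rewrite /b; case: pselect => [H|[]]; last by exists i.
  by case: (cid2 H) => j Aj fj /=; congr a; apply: finj; rewrite ?inE.
have bN n : ~ (f @` A) n -> b n = cst 0%E.
  by move=> nA; rewrite /b; case: pselect => // -[i Ai fi]; exfalso; apply: nA; exists i.
have mb n : measurable_fun setT (b n).
  by rewrite /b; case: pselect => [H|nH]; [exact: ma|exact: measurable_cst].
have b0 n p : (0 <= b n p)%E.
  by rewrite /b; case: pselect => [H|nH]; [exact: a0|].
have mser : measurable_fun setT (fun p => \sum_(0 <= n <oo) b n p)%E.
  by apply: (@ge0_emeasurable_sum _ _ _ _ b xpredT) => [n p _ _|n _]; [exact: b0|exact: mb].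
have ser0 p : (0 <= \sum_(0 <= n <oo) b n p)%E by apply: nneseries_ge0 => n _ _; exact: b0.
apply: (@le_trans _ _ (hyp_int (fun p => \sum_(0 <= n <oo) b n p)%E)).
  apply: (hyp_int_le mh mser h0) => p p0; have [i Ai hi] := ha p p0.
  apply: (le_trans hi); rewrite -(bE _ Ai) nneseries_esumT; last by move=> n; exact: b0.
  exact: (@esum_ge1 _ setT (fun n => b n p)).
have -> : hyp_int (fun p => \sum_(0 <= n <oo) b n p)%E = (\sum_(0 <= n <oo) hyp_int (b n))%E.
  rewrite /hyp_int -integral_nneseries//.
  - apply: eq_integral => p _.
    have w0 : 0 <= posinv p.2 ^+ 2 by rewrite exprn_ge0// posinv_ge0.
    rewrite muleC -nneseriesZl; last by move=> n _; exact: b0.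
    by apply: eq_eseriesr => n _; rewrite muleC.
  - by move=> n; exact: measurable_hyp_int.
  - by move=> n p _; apply: hyp_int_ge0_fun; exact: b0.
rewrite nneseries_esumT; last first.
  by move=> n; apply: integral_ge0 => p _; apply: hyp_int_ge0_fun; exact: b0.
have finj' : set_inj A f by move=> i j Ai Aj; apply: finj.
have -> : (\esum_(i in A) hyp_int (a i) = \esum_(n in f @` A) hyp_int (b n))%E.
  by rewrite (esum_image A f (fun n => hyp_int (b n)) finj'); apply: eq_esum => i Ai; rewrite bE.
rewrite [leRHS]esum_mkcond; apply: le_esum => n _.
case: ifPn => // nA; rewrite bN; last by move=> hn; move: nA; rewrite mem_set.
by rewrite /hyp_int integral0_eq// => p _; rewrite mul0e.
Qed.

Lemma mob_pos (g : M2) (p : T2) : \det g = 1 -> 0 < p.2 -> 0 < (mob g p).2.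
Proof. by move=> dg p0; exact: (@moebius_upper R g (toC p) dg p0). Qed.

Lemma toC_inj : injective (toC : T2 -> C).
Proof. by move=> [x y] [u v] [-> ->]. Qed.

Lemma mobM (g h : M2) (p : T2) : \det g = 1 -> \det h = 1 -> 0 < p.2 ->
  mob (g *m h) p = mob g (mob h p).
Proof. by move=> dg dh p0; apply: toC_inj; rewrite !toC_mob moebiusM. Qed.

Lemma mobVK (g : M2) (p : T2) : \det g = 1 -> 0 < p.2 -> mob (invmx g) (mob g p) = p.
Proof. by move=> dg p0; apply: toC_inj; rewrite !toC_mob moebiusVK. Qed.

Lemma mobKV (g : M2) (p : T2) : \det g = 1 -> 0 < p.2 -> mob g (mob (invmx g) p) = p.
Proof. by move=> dg p0; apply: toC_inj; rewrite !toC_mob moebiusKV. Qed.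

Definition returns (G : set M2) (D : set T2) : set M2 :=
  [set g | G g /\ exists2 p, D p & D (mob g p)].

(* The translates of D overlap with bounded multiplicity: if q lies in g D and in
   g1 D, then g1^-1 g is a return. *)
Lemma multiplicity_bound (G : set M2) (D : set T2) (q : T2) (X : {fset M2}) :
  psl2_subgroup G -> (forall p, D p -> 0 < p.2) -> finite_set (returns G D) -> 0 < q.2 ->
  (forall g, g \in X -> G g) ->
  (\sum_(g <- X) (\1_D (mob (invmx g) q))%:E <= (#|` fset_set (returns G D)|)%:R%:E :> \bar R)%E.
Proof.
move=> sG Dpos fE q0 XG.
have [[g1 g1X Dg1]|none] := pselect (exists2 g1, g1 \in X & D (mob (invmx g1) q)); last first.
  rewrite big_seq big1 ?lee_fin ?ler0n// => g gX; rewrite indicE memNset//.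
  by move=> h; apply: none; exists g.
pose b g : bool := `[< D (mob (invmx g) q) >].
pose X' := [seq g <- (X : seq M2) | b g].
have sumE : (\sum_(g <- X) (\1_D (mob (invmx g) q))%:E = (size X')%:R%:E :> \bar R)%E.
  rewrite sumEFin; congr EFin.
  rewrite size_filter -sum1_count natr_sum [RHS]big_mkcond; apply: eq_bigr => g _.
  by rewrite indicE /b; case: (asboolP (D (mob (invmx g) q))) => h; [rewrite mem_set|rewrite memNset].
rewrite sumE lee_fin ler_nat.
have dX g : g \in X -> \det g = 1 by move=> /XG; exact: (psl2_det sG).
have -> : size X' = size [seq invmx g1 *m g | g <- X'] by rewrite size_map.
rewrite cardfE cardE -[leqRHS](size_map val).
apply: uniq_leq_size.
  rewrite map_inj_in_uniq; first by apply: filter_uniq; exact: fset_uniq.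
  move=> g h _ _ /(congr1 (mulmx g1)).
  by rewrite !mulmxA mulmxV ?mul1mx//; apply: det_neq0_unit; rewrite dX// oner_neq0.
move=> x /mapP[g]; rewrite mem_filter => /andP[/asboolP Dg gX] -> {x}.
have rg : returns G D (invmx g1 *m g).
  split; first by apply: (psl2_mul sG); [apply: (psl2_inv sG); exact: XG|exact: XG].
  exists (mob (invmx g) q) => //.
  have di h : h \in X -> \det (invmx h) = 1 by move=> hX; rewrite det_inv ?dX ?invr1.
  by rewrite mobM ?di ?dX// ?mobKV ?dX//; apply: mob_pos; rewrite ?di.
have mg : (invmx g1 *m g) \in fset_set (returns G D) by rewrite in_fset_set// mem_set.
by apply/mapP; exists (FSetSub mg) => //; rewrite mem_enum.
Qed.

Lemma hyp_int_sum (X : seq M2) (a : M2 -> T2 -> \bar R) :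
  (forall i, measurable_fun setT (a i)) -> (forall i p, 0 <= a i p)%E ->
  (\sum_(i <- X) hyp_int (a i) = hyp_int (fun p => \sum_(i <- X) a i p))%E.
Proof.
move=> ma a0; rewrite /hyp_int -ge0_integral_sum//.
- apply: eq_integral => p _; rewrite ge0_sume_distrl// => i _; exact: a0.
- by move=> i; exact: measurable_hyp_int.
- by move=> i p _; exact: hyp_int_ge0_fun.
Qed.

Lemma hyp_int_scale (c : R) (f : T2 -> \bar R) : 0 <= c ->
  measurable_fun setT f -> (forall p, 0 <= f p)%E ->
  hyp_int (fun p => c%:E * f p)%E = (c%:E * hyp_int f)%E.
Proof.
move=> c0 mf f0; rewrite /hyp_int -ge0_integralZl//; last 2 first.
- exact: measurable_hyp_int.
- by move=> p _; exact: hyp_int_ge0_fun.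
by apply: eq_integral => p _; rewrite muleA.
Qed.

Lemma measurable_indicE (D : set T2) : measurable D ->
  measurable_fun setT (fun p : T2 => (\1_D p : R)%:E).
Proof. by move=> mD; apply/measurable_EFinP; exact: measurable_indic. Qed.

Lemma indic_mule_ge0 (D : set T2) (x : \bar R) p : (0 <= x)%E -> (0 <= (\1_D p : R)%:E * x)%E.
Proof. by move=> x0; rewrite mule_ge0// lee_fin indicE ler0n. Qed.

(** After the substitution q = g p the sum becomes the integral of [Phi] against the number of
    translates of [D] that contain q, which [multiplicity_bound] controls. *)
Lemma unfold_group (G : set M2) (D : set T2) (Phi : T2 -> \bar R) :
  psl2_subgroup G -> measurable D -> (forall p, D p -> 0 < p.2) ->
  finite_set (returns G D) -> measurable_fun setT Phi -> (forall p, 0 <= Phi p)%E ->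
  (\esum_(g in G) hyp_int (fun p => (\1_D p)%:E * Phi (mob g p)) <=
   (#|` fset_set (returns G D)|)%:R%:E * hyp_int Phi)%E.
Proof.
move=> sG mD Dpos fE mP P0; apply: ge_ereal_sup => _ [X [fX XG] <-].
pose f g (q : T2) : \bar R := ((\1_D (mob (invmx g) q))%:E * Phi q)%E.
have mf g : measurable_fun setT (f g).
  apply: emeasurable_funM => //.
  exact: (measurableT_comp (measurable_indicE mD) (@measurable_mob R _)).
have f0 g p : (0 <= f g p)%E by exact: indic_mule_ge0.
rewrite fsbig_finite//=.
have -> : (\sum_(g <- fset_set X) hyp_int (fun p => (\1_D p)%:E * Phi (mob g p)) =
   \sum_(g <- fset_set X) hyp_int (f g))%E.
  rewrite big_seq [RHS]big_seq; apply: eq_bigr => g; rewrite in_fset_set// inE => /XG Gg.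
  have dg := psl2_det sG Gg.
  rewrite -(hyp_int_mob dg (mf g) (f0 g)); apply: eq_hyp_int => p p0.
  by rewrite /f mobVK.
rewrite hyp_int_sum//; rewrite -hyp_int_scale//; apply: hyp_int_le.
- by apply: emeasurable_sum.
- by apply: emeasurable_funM => //; exact: measurable_cst.
- by move=> p; apply: sume_ge0.
- move=> p p0; rewrite /f -ge0_sume_distrl; last by move=> g _; rewrite lee_fin indicE ler0n.
  apply: lee_pmul => //.
    by apply: sume_ge0 => g _; rewrite lee_fin indicE ler0n.
  by apply: multiplicity_bound => // g; rewrite in_fset_set// inE => /XG.
Qed.

(** The element d may vary with the point, so [h t] is bounded by the sum over all d in [G0].
    Products d t with t in [T] are pairwise distinct, so the double sum is part of a sum over
    [G]. *)
Lemma unfold_cosets (G G0 T : set M2) (D : set T2) (Phi : T2 -> \bar R)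
    (h : M2 -> T2 -> \bar R) :
  psl2_subgroup G -> countable G -> psl2_subgroup G0 -> G0 `<=` G ->
  coset_transversal G0 G T ->
  measurable D -> (forall p, D p -> 0 < p.2) ->
  finite_set (returns G D) -> measurable_fun setT Phi -> (forall p, 0 <= Phi p)%E ->
  (forall t, measurable_fun setT (h t)) -> (forall t p, 0 <= h t p)%E ->
  (forall t p, ~ D p -> h t p = 0%E) ->
  (forall t p, T t -> D p -> exists2 d, G0 d & (h t p <= Phi (mob (d *m t) p))%E) ->
  (\esum_(t in T) hyp_int (h t) <= (#|` fset_set (returns G D)|)%:R%:E * hyp_int Phi)%E.
Proof.
move=> sG cG sG0 G0G tT mD Dpos fE mP P0 mh h0 hD hP.
pose a (g : M2) p : \bar R := ((\1_D p)%:E * Phi (mob g p))%E.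
have ma g : measurable_fun setT (a g).
  by apply: emeasurable_funM; [exact: measurable_indicE|exact: (measurableT_comp mP (@measurable_mob R _))].
have a0 g p : (0 <= a g p)%E by exact: indic_mule_ge0.
have cG0 : countable G0 by apply: sub_countable cG; exact: subset_card_le.
have HI0 g : (0 <= hyp_int (a g))%E by apply: integral_ge0 => p _; exact: hyp_int_ge0_fun.
apply: (le_trans _ (unfold_group sG mD Dpos fE mP P0)).
apply: (@le_trans _ _ (\esum_(t in T) \esum_(d in G0) hyp_int (a (d *m t)))%E).
  apply: le_esum => t Tt; apply: (@hyp_int_le_esum _ _ (fun d => a (d *m t))) => // p p0.
  have [Dp|Dp] := pselect (D p).
    have [d d0 le] := hP t p Tt Dp; exists d => //.
    by rewrite /a indicE mem_set// mul1e.
  by exists 1%:M; [exact: psl2_1|rewrite hD].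
rewrite esum_esum//.
pose e (x : M2 * M2) : M2 := x.2 *m x.1.
have ei : set_inj (T `*`` fun=> G0) e.
  move=> [t d] [t' d'] /set_mem[/= Tt G0d] /set_mem[/= Tt' G0d'] /= E.
  have Gt : G (e (t, d)).
    by apply: (psl2_mul sG); [apply: G0G|apply: (Defs.transversal_sub tT)].
  have [t0 [_ U]] := Defs.transversal_repr tT Gt.
  have E1 : t0 = t by apply: U; split=> //; exists d.
  have E2 : t0 = t' by apply: U; split=> //; exists d'.
  subst t t'; congr pair; move: E; rewrite /e /= => /(congr1 (mulmx ^~ (invmx t0))).
  rewrite -!mulmxA mulmxV ?mulmx1//; apply: det_neq0_unit.
  exact: (psl2_det sG (Defs.transversal_sub tT Tt)).
have -> : (\esum_(k in T `*`` (fun=> G0)) hyp_int (a (k.2 *m k.1)) =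
  \esum_(g in e @` (T `*`` fun=> G0)) hyp_int (a g))%E.
  by rewrite (esum_image _ e (fun g => hyp_int (a g)) ei).
apply: esum_subset => _ [[t d] [/= Tt G0d] <-].
by apply: (psl2_mul sG); [exact: G0G|exact: (Defs.transversal_sub tT Tt)].
Qed.

Lemma ReB (z w : C) : complex.Re (z - w) = complex.Re z - complex.Re w.
Proof. by case: z w => ? ? []. Qed.

Lemma ImB (z w : C) : complex.Im (z - w) = complex.Im z - complex.Im w.
Proof. by case: z w => ? ? []. Qed.

(** * Unordered complex sums *)

Section UnorderedSums.

Variable I : choiceType.

Implicit Types (T : set I) (v w : I -> C) (A : {fset I}).

(** The finite sets live in [I] rather than in the subtype of [T], so that unions, and images under
    a change of transversal, stay in one type. *)
Definition hassum T v (s : C) := forall e : R, 0 < e ->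
  exists2 A0 : {fset I}, [set` A0] `<=` T &
    forall A, [set` A] `<=` T -> (A0 `<=` A)%fset -> cabs (\sum_(i <- A) v i - s) <= e.

Lemma fsub_setU A1 A2 T : [set` A1] `<=` T -> [set` A2] `<=` T ->
  [set` (A1 `|` A2)%fset] `<=` T.
Proof. by move=> h1 h2 i /=; rewrite inE => /orP[/h1|/h2]. Qed.

Lemma hassum_unique T v s s' : hassum T v s -> hassum T v s' -> s = s'.
Proof.
move=> h h'; suff : cabs (s - s') = 0 by move/eqP; rewrite cabs_eq0 subr_eq0 => /eqP.
apply: (@le_eps0 _ _ 2); rewrite ?cabs_ge0// => e e0.
have [A1 s1 H1] := h e e0; have [A2 s2 H2] := h' e e0.
have sU := fsub_setU s1 s2.
have := H1 _ sU (fsubsetUl _ _); have := H2 _ sU (fsubsetUr _ _).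
move: (\sum_(i <- _) v i) => x h2 h1.
have -> : s - s' = (x - s') - (x - s) by ring.
by apply: (le_trans (cabsB _ _)); lra.
Qed.

Lemma hassum_linear T v w s s' (c : C) : hassum T v s -> hassum T w s' ->
  hassum T (fun i => v i - c * w i) (s - c * s').
Proof.
move=> h h' e e0; have c0 := cabs_ge0 c.
have e1 : 0 < e / 2 by rewrite divr_gt0.
have e2 : 0 < e / 2 / (cabs c + 1) by rewrite !divr_gt0//; lra.
have [A1 s1 H1] := h _ e1; have [A2 s2 H2] := h' _ e2.
exists (A1 `|` A2)%fset; first exact: fsub_setU.
move=> A sA; rewrite fsubUset => /andP[i1 i2].
have := H1 _ sA i1; have := H2 _ sA i2.
rewrite sumrB -mulr_sumr.
move: (\sum_(i <- _) v i) (\sum_(i <- _) w i) => x y hy hx.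
have -> : x - c * y - (s - c * s') = (x - s) - c * (y - s') by ring.
apply: (le_trans (cabsB _ _)); rewrite cabsM.
have : cabs c * cabs (y - s') <= (cabs c + 1) * (e / 2 / (cabs c + 1)).
  by apply: ler_pM; rewrite ?cabs_ge0//; lra.
have -> : (cabs c + 1) * (e / 2 / (cabs c + 1)) = e / 2 by field; lra.
lra.
Qed.

Lemma hassumZ T v s (c : C) : hassum T v s -> hassum T (fun i => c * v i) (c * s).
Proof.
move=> h e e0; have c0 := cabs_ge0 c.
have e2 : 0 < e / (cabs c + 1) by rewrite divr_gt0//; lra.
have [A1 s1 H1] := h _ e2; exists A1 => // A sA i1; have := H1 _ sA i1.
rewrite -mulr_sumr -mulrBr cabsM => hx.
have : cabs c * cabs (\sum_(i <- A) v i - s) <= (cabs c + 1) * (e / (cabs c + 1)).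
  by apply: ler_pM; rewrite ?cabs_ge0//; lra.
have -> // : (cabs c + 1) * (e / (cabs c + 1)) = e by field; lra.
Qed.

Lemma eq_hassum T v w s : (forall i, T i -> v i = w i) -> hassum T v s -> hassum T w s.
Proof.
move=> E h e e0; have [A1 s1 H1] := h _ e0; exists A1 => // A sA i1.
suff <- : \sum_(i <- A) v i = \sum_(i <- A) w i by exact: H1.
by rewrite big_seq [RHS]big_seq; apply: eq_bigr => i iA; apply: E; exact: sA.
Qed.

Lemma hassum_reindex T T' (b b' : I -> I) v s :
  (forall i, T i -> T' (b i) /\ b' (b i) = i) ->
  (forall i, T' i -> T (b' i) /\ b (b' i) = i) ->
  hassum T' v s -> hassum T (fun i => v (b i)) s.
Proof.
move=> hb hb' h e e0; have [A1 s1 H1] := h _ e0.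
exists [fset b' i | i in A1]%fset.
  by move=> i /= /imfsetP[j /= /s1 Tj ->]; case: (hb' j Tj).
move=> A sA i1.
have -> : \sum_(i <- A) v (b i) = \sum_(j <- [fset b i | i in A]%fset) v j.
  rewrite big_imfset//= => i j iA jA E.
  by rewrite -(hb i (sA _ iA)).2 -(hb j (sA _ jA)).2 E.
apply: H1.
  by move=> i /= /imfsetP[j /= /sA Tj ->]; case: (hb j Tj).
apply/fsubsetP => j jA; apply/imfsetP; exists (b' j).
  by apply: (fsubsetP i1); apply/imfsetP; exists j.
by rewrite (hb' j (s1 _ jA)).2.
Qed.

Lemma esum_fsetE (A : {fset I}) (a : I -> R) : (forall i, 0 <= a i) ->
  (\sum_(i \in [set` A]) (a i)%:E = (\sum_(i <- A) a i)%:E)%E.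
Proof. by move=> a0; rewrite fsbig_finite// set_fsetK sumEFin. Qed.

Lemma sum_fsetU_disj (V : nmodType) (f : I -> V) A1 A2 : [disjoint A1 & A2]%fset ->
  \sum_(i <- (A1 `|` A2)%fset) f i = \sum_(i <- A1) f i + \sum_(i <- A2) f i.
Proof.
move=> d; rewrite -big_cat; apply: perm_big; apply: uniq_perm; first exact: fset_uniq.
  rewrite cat_uniq !fset_uniq /= andbT; apply/hasPn => i i2.
  by apply/negP => i1; have := fdisjointP d i i1; rewrite i2.
by move=> i; rewrite mem_cat inE.
Qed.

(** A finite set whose sum comes within e of the supremum leaves at most e to any finite set
    disjoint from it. *)
Lemma esum_tail T (a : I -> R) (e : R) : (forall i, 0 <= a i) ->
  (\esum_(i in T) (a i)%:E < +oo)%E -> 0 < e ->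
  exists2 A0 : {fset I}, [set` A0] `<=` T &
    forall A, [set` A] `<=` T -> [disjoint A & A0]%fset -> \sum_(i <- A) a i <= e.
Proof.
move=> a0 fin e0.
have S0 : (0 <= \esum_(i in T) (a i)%:E)%E by apply: esum_ge0 => i _; rewrite lee_fin.
have Sf : \esum_(i in T) (a i)%:E \is a fin_num by rewrite ge0_fin_numE.
have [_ [X [fX XT] <-] hX] := ub_ereal_sup_adherent e0 Sf.
exists (fset_set X); first by rewrite fset_setK.
move=> A AT dA.
have sAX : [set` (A `|` fset_set X)%fset] `<=` T by apply: fsub_setU; rewrite ?fset_setK.
have : ((\sum_(i <- (A `|` fset_set X)%fset) a i)%:E <= \esum_(i in T) (a i)%:E)%E.
  by apply: esum_ge; exists [set` (A `|` fset_set X)%fset]; rewrite ?esum_fsetE.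
have EX : (\sum_(i \in X) (a i)%:E = (\sum_(i <- fset_set X) a i)%:E)%E.
  by rewrite fsbig_finite// sumEFin.
rewrite EX in hX; rewrite sum_fsetU_disj//.
move: hX; rewrite -[ereal_sup _]/(\esum_(i in T) (a i)%:E)%E -(fineK Sf).
rewrite -EFinB lte_fin lee_fin; lra.
Qed.

Lemma sum_near T v (a : I -> R) (e : R) A0 A : (forall i, T i -> cabs (v i) <= a i) ->
  (forall A, [set` A] `<=` T -> [disjoint A & A0]%fset -> \sum_(i <- A) a i <= e) ->
  [set` A] `<=` T -> (A0 `<=` A)%fset ->
  cabs (\sum_(i <- A) v i - \sum_(i <- A0) v i) <= e.
Proof.
move=> va H sA iA.
have sD : [set` (A `\` A0)%fset] `<=` T by move=> i /=; rewrite inE => /andP[_ /sA].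
have dD : [disjoint (A `\` A0)%fset & A0]%fset by apply/fdisjointP => i; rewrite inE => /andP[].
have AE : A = ((A `\` A0) `|` A0)%fset.
  apply/fsetP => i; rewrite !inE; have [i0|] := boolP (i \in A0); last by rewrite orbF.
  by rewrite orbT; exact: (fsubsetP iA).
rewrite {1}AE sum_fsetU_disj// addrK; apply: (le_trans (cabs_sum _ _ _)).
apply: (le_trans _ (H _ sD dD)); rewrite big_seq [leRHS]big_seq; apply: ler_sum => i iD.
by apply: va; exact: sD.
Qed.

(** Choose [F n] with tail at most 1 / 2^n. These sets need not be nested: consecutive partial sums
    are compared through the union of [F n] and [F n.+1], and [geo_cauchy_lim] gives the two
    coordinates of the sum. *)
Lemma hassum_exists T v (a : I -> R) : (forall i, 0 <= a i) ->
  (forall i, T i -> cabs (v i) <= a i) ->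
  (\esum_(i in T) (a i)%:E < +oo)%E -> exists s, hassum T v s.
Proof.
move=> a0 va fin.
have p20 n : 0 < 1 / 2 ^+ n :> R by rewrite divr_gt0// exprn_gt0.
have /choice[F FP] n : exists A0 : {fset I}, [set` A0] `<=` T /\
    forall A, [set` A] `<=` T -> [disjoint A & A0]%fset -> \sum_(i <- A) a i <= 1 / 2 ^+ n.
  by have [A0 h1 h2] := esum_tail a0 fin (p20 n); exists A0.
pose u n := \sum_(i <- F n) v i.
have near n A : [set` A] `<=` T -> (F n `<=` A)%fset -> cabs (\sum_(i <- A) v i - u n) <= 1 / 2 ^+ n.
  by move=> sA iA; apply: (sum_near va (FP n).2).
have uS n : cabs (u n.+1 - u n) <= 2 / 2 ^+ n.
  have sU := fsub_setU (FP n).1 (FP n.+1).1.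
  have := near _ _ sU (fsubsetUl _ _); have := near _ _ sU (fsubsetUr _ _).
  move: (\sum_(i <- _) v i) => x h1 h2.
  have -> : u n.+1 - u n = (x - u n) - (x - u n.+1) by ring.
  apply: (le_trans (cabsB _ _)).
  have : 1 / 2 ^+ n.+1 <= 1 / 2 ^+ n :> R.
    by rewrite !div1r lef_pV2 ?posrE ?exprn_gt0// ler_eXn2l// ltr1n.
  by move: (2 ^+ n.+1) h1 h2 => y h1 h2 h3; lra.
have [l1 L1] : exists l, forall n, `|complex.Re (u n) - l| <= 2 * 2 / 2 ^+ n.
  by apply: geo_cauchy_lim => n; rewrite -ReB; exact: le_trans (Re_le_cabs _) (uS n).
have [l2 L2] : exists l, forall n, `|complex.Im (u n) - l| <= 2 * 2 / 2 ^+ n.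
  by apply: geo_cauchy_lim => n; rewrite -ImB; exact: le_trans (Im_le_cabs _) (uS n).
exists (l1 +i* l2) => e e0; have [n ne] := @pow2_arch R 9 e e0.
exists (F n); first exact: (FP n).1.
move=> A sA iA.
have := near _ _ sA iA; move: (\sum_(i <- A) v i) => x h1.
have -> : x - (l1 +i* l2) = (x - u n) + (u n - (l1 +i* l2)) by ring.
apply: (le_trans (cabsD _ _)).
have := cabs_le_ReIm (u n - (l1 +i* l2)).
rewrite ReB ImB /=; have := L1 n; have := L2 n.
by lra.
Qed.

Definition unif_on (K : set C) T (u : I -> C -> C) (P : C -> C) := forall e : R, 0 < e ->
  exists2 A0 : {fset I}, [set` A0] `<=` T &
    forall A, [set` A] `<=` T -> (A0 `<=` A)%fset ->
      forall z, K z -> cabs (\sum_(i <- A) u i z - P z) <= e.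

(** [A0] comes from the majorant alone and is uniform in z. The set [A1] that depends on z only
    serves to compare with [P z], through the union of [A] and [A1]. *)
Lemma weierstrass_test (K : set C) T (u : I -> C -> C) (P : C -> C) (a : I -> R) :
  (forall i, 0 <= a i) -> (forall i z, T i -> K z -> cabs (u i z) <= a i) ->
  (\esum_(i in T) (a i)%:E < +oo)%E ->
  (forall z, K z -> hassum T (u^~ z) (P z)) -> unif_on K T u P.
Proof.
move=> a0 ua fin hP e e0; have e1 : 0 < e / 4 by rewrite divr_gt0.
have [A0 s0 H0] := esum_tail a0 fin e1; exists A0 => // A sA iA z Kz.
have [A1 s1 H1] := hP z Kz _ e1.
have uz i : T i -> cabs (u i z) <= a i by move=> Ti; exact: ua.
have sU := fsub_setU sA s1.
have := H1 _ sU (fsubsetUr _ _).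
have := sum_near uz H0 sU (fsubset_trans iA (fsubsetUl _ _)).
have := sum_near uz H0 sA iA.
move: (\sum_(i <- A) _) (\sum_(i <- A0) _) (\sum_(i <- (A `|` A1)%fset) _) => x y w h1 h2 h3.
have -> : x - P z = (x - y) - (w - y) + (w - P z) by ring.
apply: (le_trans (cabsD _ _)); have := cabsB (x - y) (w - y).
by move: e0; lra.
Qed.

End UnorderedSums.

Lemma cont_cabs_comp (f : C -> C) z : {for z, continuous f} ->
  {for z, continuous (fun z => cabs (f z))}.
Proof. by move=> cf; apply: continuous_comp; [exact: cf|exact: continuous_cabs]. Qed.

Lemma compact_cont_bounded (K : set C) (g : C -> R) : compact K ->
  (forall z, K z -> {for z, continuous g}) -> exists B, forall z, K z -> `|g z| <= B.
Proof.
move=> cK cg.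
have wg : {within K, continuous g}.
  by apply: continuous_in_subspaceT => z /set_mem Kz; exact: cg.
have cim : compact (g @` K : set R^o) by exact: continuous_compact.
have [B _ hB] := pinfty_ex_gt0 (compact_bounded cim).
by exists B => z Kz; apply: hB; exists z.
Qed.

Lemma boxC_compact (a b c d : R) : compact (boxC a b c d).
Proof.
have -> : boxC a b c d = (fun p : R * R => (p.1 +i* p.2 : C)) @` (`[a, b] `*` `[c, d]).
  apply/seteqP; split=> [[x y] [/= h1 h2]|_ [[x y] [/= h1 h2] <-]].
    by exists (x, y) => //; rewrite /= !in_itv.
  by move: h1 h2; rewrite !in_itv.
apply: continuous_compact; last by apply: compact_setX; exact: segment_compact.
apply: continuous_in_subspaceT => p _ /= Q /nbhsCP[e e0 eQ].
have e2 : 0 < e / 2 by rewrite divr_gt0.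
exists ([set x | `|x - p.1| < e / 2], [set y | `|y - p.2| < e / 2]).
  by split; apply/nbhsRP; exists (e / 2).
move=> q [/= h1 h2]; apply: eQ; apply: (le_lt_trans (cabs_le_ReIm _)).
by rewrite ReB ImB /=; lra.
Qed.

(** * Uniform limits of holomorphic partial sums *)

Section HolomorphicSums.

Variable I : choiceType.

Implicit Types (T : set I) (u : I -> C -> C) (P : C -> C) (A : {fset I}).

Lemma sqbox_upper (z : C) (S : R) (w : C) : S < complex.Im z -> sqbox z S w -> upper w.
Proof. by move=> Sz [_ /andP[h _]]; rewrite /upper /=; lra. Qed.

Lemma holomorphic_fsum T u A : (forall i, T i -> holomorphic (u i)) -> [set` A] `<=` T ->
  holomorphic (fun z => \sum_(i <- A) u i z).
Proof.
move=> hu sA z uz.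
have : forall r : seq I, {subset r <= A} -> derivable (fun z : C => \sum_(i <- r) u i z : C) z 1.
  elim=> [|i r IH] hr.
    have -> : (fun z : C => \sum_(i <- [::]) u i z : C) = cst 0.
      by apply/funext => w; rewrite big_nil.
    exact: derivable_cst.
  have -> : (fun z : C => \sum_(j <- i :: r) u j z : C) = (u i : C -> C) \+ (fun z => \sum_(j <- r) u j z).
    by apply/funext => w; rewrite big_cons.
  apply: derivableD; first by apply: hu => //; apply: sA; apply: hr; exact: mem_head.
  by apply: IH => j jr; apply: hr; rewrite in_cons jr orbT.
by apply.
Qed.

Lemma unif_on_cont T u P : (forall i, T i -> holomorphic (u i)) ->
  (forall (z : C) (S : R), 0 < S -> S < complex.Im z -> unif_on (sqbox z S) T u P) ->
  forall z, upper z -> {for z, continuous P}.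
Proof.
move=> hu H z uz; apply/contCP => e e0.
have S0 : 0 < complex.Im z / 2 by rewrite divr_gt0.
have Sz : complex.Im z / 2 < complex.Im z by rewrite ltr_pdivrMr// ltr_pMr// ltr1n.
have e4 : 0 < e / 4 by rewrite divr_gt0.
have [A sA HA] := H z _ S0 Sz _ e4.
have cA : {for z, continuous (fun z => \sum_(i <- A) u i z)}.
  by apply: upper_cont => //; exact: holomorphic_fsum sA.
have [d d0 dP] := (contCP _ _).1 cA _ e4.
exists (Num.min d (complex.Im z / 2)); first by rewrite lt_min d0.
move=> w; rewrite lt_min => /andP[wd wS].
have bw : sqbox z (complex.Im z / 2) w.
  have := le_lt_trans (Re_le_cabs _) wS; have := le_lt_trans (Im_le_cabs _) wS.
  rewrite ReB ImB !ltr_norml => /andP[? ?] /andP[? ?].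
  by split; apply/andP; split; lra.
have bz : sqbox z (complex.Im z / 2) z by split; apply/andP; split; lra.
have h1 := HA A sA (fsubset_refl _) w bw; have h2 := HA A sA (fsubset_refl _) z bz.
have h3 := dP w wd; move: h1 h2 h3 => /=.
move: (\sum_(i <- A) _) (\sum_(i <- A) _) => x y h1 h2 h3.
have -> : P w - P z = (y - x) - (y - P w) + (x - P z) by ring.
apply: (le_lt_trans (cabsD _ _)); have := cabsB (y - x) (y - P w).
by move: e0 h1 h2 h3; clear; lra.
Qed.

Lemma unif_on_holomorphic T u P : (forall i, T i -> holomorphic (u i)) ->
  (forall (z : C) (S : R), 0 < S -> S < complex.Im z -> unif_on (sqbox z S) T u P) ->
  holomorphic P.
Proof.
move=> hu H z uz.
have cP := unif_on_cont hu H.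
have S0 : 0 < complex.Im z / 2 by rewrite divr_gt0.
have Sz : complex.Im z / 2 < complex.Im z by rewrite ltr_pdivrMr// ltr_pMr// ltr1n.
have cPb w : sqbox z (complex.Im z / 2) w -> {for w, continuous P}.
  by move=> bw; apply: cP; exact: sqbox_upper bw.
have [M PM] : exists M, forall w, sqbox z (complex.Im z / 2) w -> cabs (P w) <= M.
  have [B hB] : exists B, forall w, sqbox z (complex.Im z / 2) w -> `|cabs (P w)| <= B.
    apply: compact_cont_bounded; first exact: boxC_compact.
    by move=> w bw; apply: cont_cabs_comp; exact: cPb.
  by exists B => w bw; apply: (le_trans (ler_norm _)); exact: hB.
apply: (holomorphic_limit S0 cPb PM) => e e0.
have [A sA HA] := H z _ S0 Sz _ e0.
exists (fun z => \sum_(i <- A) u i z).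
  move=> w bw; apply: (holomorphic_fsum hu sA); exact: sqbox_upper bw.
by move=> w bw; apply: HA.
Qed.

(** Finite sets of the subtype of [T] are carried to finite subsets of [T] by [val]. Radii of balls
    are elements of R[i], hence the passage to the real part of e. *)
Lemma unif_on_cvg (K : set C) T u P : unif_on K T u P ->
  {uniform K, (fun (A : {fset T}) (z : C) =>
                    partial_sum (fun g : T => u (val g) z) A) @ totally
                 --> P}.
Proof.
move=> H Q /uniform_nbhs[E [entE EQ]].
move: entE; rewrite -entourage_from_ballE => -[e /= e0 eE].
have [ie re] : complex.Im e = 0 /\ 0 < complex.Re e.
  by move: e0; rewrite ltcE /= => /andP[/eqP].
have e2 : 0 < complex.Re e / 2 by rewrite divr_gt0.
have [A0 sA0 HA0] := H _ e2.
pose A0' : {fset T} := [fset x | x in pmap insub (A0 : seq I)]%fset.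
exists A0' => // A /= iA; apply: EQ => z Kz; apply: eE => /=.
rewrite -ball_normE /ball_ /= cabs_norm ltcE /= ie eqxx /= cabsBC.
suff : cabs (partial_sum (fun g : T => u (val g) z) A - P z) <= complex.Re e / 2 by lra.
pose A1 := [fset val x | x in A]%fset.
have -> : partial_sum (fun g : T => u (val g) z) A = \sum_(i <- A1) u i z.
  rewrite /A1 big_imfset/=; last by move=> x y _ _; exact: val_inj.
  by rewrite /partial_sum big_seq_fsetE.
apply: HA0 => //.
  by move=> i /= /imfsetP[x _ ->]; exact: (set_mem (valP x)).
apply/fsubsetP => i i0; have Ti := mem_set (sA0 _ i0).
apply/imfsetP; exists (Sub i Ti) => //=; apply: (fsubsetP iA).
rewrite !inE mem_pmap; apply/mapP; exists i => //.
by rewrite insubT.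
Qed.

End HolomorphicSums.

End Sums.

(** * Cusps *)

Section Cusps.
Context {R : realType}.
Local Notation C := (Cplx R).
Local Notation mu := (@lebesgue_measure R).
Local Notation T2 := (measurableTypeR R * measurableTypeR R)%type.
Local Notation M2 := 'M[R]_2.

(** * The group in the coordinate of a scaling matrix *)

Lemma translationE (m : int) : [/\ @translation R m 0 0 = 1, @translation R m 0 1 = m%:~R,
  @translation R m 1 0 = 0 & @translation R m 1 1 = 1].
Proof. by rewrite /translation !mxE /= !mulr0 !mulr1 !addr0 add0r. Qed.

Definition conj_mx (s g : M2) : M2 := invmx s *m g *m s.

Lemma det_conj s g : \det s = 1 -> \det g = 1 -> \det (conj_mx s g) = 1.
Proof. by move=> ds dg; rewrite !det_mulmx det_inv// dg ds !mulr1. Qed.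

Lemma conj_mxM s g h : \det s = 1 -> conj_mx s (g *m h) = conj_mx s g *m conj_mx s h.
Proof.
move=> ds; rewrite /conj_mx !mulmxA -[in RHS](mulmxA _ s) mulmxV ?mulmx1//.
exact: det_neq0_unit.
Qed.

Lemma conj_mxV s g : \det s = 1 -> \det g = 1 -> conj_mx s (invmx g) = invmx (conj_mx s g).
Proof.
move=> ds dg; have u : conj_mx s g \in unitmx by apply: det_neq0_unit; exact: det_conj.
apply: (can_inj (mulmxK u)); rewrite mulVmx// -conj_mxM// mulVmx ?det_neq0_unit//.
by rewrite /conj_mx mulmx1 mulVmx// det_neq0_unit.
Qed.

Lemma conj_mxK s g : \det s = 1 -> s *m conj_mx s g *m invmx s = g.
Proof.
move=> ds; have us := det_neq0_unit ds.
by rewrite /conj_mx !mulmxA mulmxV// mul1mx -mulmxA mulmxV// mulmx1.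
Qed.

Lemma bdry_actM (g s : M2) : \det s = 1 -> bdry_act (g *m s) None = bdry_act g (bdry_act s None).
Proof.
move=> ds; rewrite /bdry_act !mul2E.
have [s0|s0] := eqVneq (s 1 0) 0.
  have a0 : s 0 0 != 0.
    by apply/eqP => a0; move: ds; rewrite det2 s0 a0 mul0r mulr0 subr0 => /eqP; rewrite eq_sym oner_eq0.
  rewrite s0 !mulr0 !addr0 mulf_eq0 (negbTE a0) orbF; case: ifP => // c0.
  by congr Some; field; rewrite a0 c0.
have E : g 1 0 * (s 0 0 / s 1 0) + g 1 1 = (g 1 0 * s 0 0 + g 1 1 * s 1 0) / s 1 0 by field.
rewrite E mulf_eq0 invr_eq0 (negbTE s0) orbF; case: ifP => // c0.
by congr Some; field; rewrite s0 c0.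
Qed.

Lemma mob_Im (g : M2) (p : T2) : \det g = 1 -> 0 < p.2 -> (mob g p).2 = p.2 / autj_norm2 g p.
Proof.
case: p => x y dg y0; rewrite -sqr_cabs_autj.
exact: (@moebius_Im R g (toC (x, y)) dg y0).
Qed.

Section Scaling.

Variables (G : set M2) (a : option R) (s : M2).

Hypotheses (fG : fuchsian_first_kind G) (hs : scaling_matrix G a s).

Let sG := fuchsian_subgroup fG.

Let ds : \det s = 1 := scaling_det hs.

(** Conjugating back by s enlarges bounds on the entries by a fixed factor, so [discrete_finite]
    applies. *)
Lemma conj_finite (B : R) : finite_set [set h | exists2 g, G g & h = conj_mx s g /\ mxbound h B].
Proof.
pose S := \big[Num.max/0]_(i < 2) \big[Num.max/0]_(j < 2) `|s i j|.
have sS : mxbound s S.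
  move=> i j; apply: (le_trans (le_bigmax _ (fun j => `|s i j|) j)).
  exact: (le_bigmax _ (fun i => \big[Num.max/0]_(j < 2) `|s i j|) i).
apply: (sub_finite_set _ (finite_image (conj_mx s) (discrete_finite (2 * (2 * S * B) * S) fG))).
move=> h [g Gg [hE hB]]; exists g; last by [].
split => //; rewrite -(conj_mxK g ds) -hE.
by apply: mul2_bound; [exact: mul2_bound|exact: inv2_bound].
Qed.

Lemma conj_translation : exists2 g, G g & conj_mx s g = @translation R 1.
Proof.
have : [set h | exists m : int, h = @translation R m \/ h = - @translation R m] (@translation R 1).
  by exists 1; left.
by rewrite -(scaling_stab hs) => -[g [Gg _] gE]; exists g.
Qed.

(** A zero lower left entry means that s^-1 g s fixes oo, so g fixes the cusp and belongs to the
    stabilizer that the scaling matrix describes. *)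
Lemma conj_upper_triangular g : G g -> conj_mx s g 1 0 = 0 ->
  exists m : int, conj_mx s g = @translation R m \/ conj_mx s g = - @translation R m.
Proof.
move=> Gg c0.
suff : [set h | exists m : int, h = @translation R m \/ h = - @translation R m] (conj_mx s g) by [].
rewrite -(scaling_stab hs); exists g => //; split => //.
rewrite -(scaling_infty hs) -bdry_actM//.
have dc : \det (conj_mx s g) = 1 by apply: det_conj => //; exact: (psl2_det sG Gg).
have -> : g *m s = s *m conj_mx s g.
  by rewrite /conj_mx !mulmxA mulmxV ?mul1mx// det_neq0_unit.
by rewrite bdry_actM// {2}/bdry_act c0 eqxx.
Qed.

Lemma mul_translation_conj (B : M2) : \det B = 1 ->
  let B' := B *m @translation R 1 *m invmx B in
  [/\ B' 0 0 = 1 - B 0 0 * B 1 0, B' 0 1 = B 0 0 ^+ 2,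
      B' 1 0 = - B 1 0 ^+ 2 & B' 1 1 = 1 + B 0 0 * B 1 0].
Proof.
move=> dB B'; rewrite /B' !mul2E.
have [-> -> -> ->] := inv2E dB; have [-> -> -> ->] := translationE 1.
move: dB; rewrite det2; move: (B 0 0) (B 0 1) (B 1 0) (B 1 1) => p q u v d.
by split; [rewrite -[X in _ = X - _]d| | |rewrite -[X in _ = X + _]d]; ring.
Qed.

(* Shimizu's lemma: if 0 < |c| < 1, the matrices A_0 = A, A_(n+1) = A_n T A_n^-1,
   where T is the translation by 1, are bounded, and pairwise distinct since
   c_(n+1) = - c_n^2. *)

Lemma shimizu g : G g -> conj_mx s g 1 0 != 0 -> 1 <= `|conj_mx s g 1 0|.
Proof.
move=> Gg c0; rewrite leNgt; apply/negP => c1.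
have [t Gt tE] := conj_translation.
pose f (x : M2) := x *m t *m invmx x.
pose x n := iter n f g.
have Gx n : G (x n).
  elim: n => //= n IH; apply: (psl2_mul sG); last exact: (psl2_inv sG).
  exact: (psl2_mul sG).
have dx n : \det (x n) = 1 := psl2_det sG (Gx n).
pose A n := conj_mx s (x n).
have dA n : \det (A n) = 1 by exact: det_conj.
have AS n : [/\ A n.+1 0 0 = 1 - A n 0 0 * A n 1 0, A n.+1 0 1 = A n 0 0 ^+ 2,
   A n.+1 1 0 = - A n 1 0 ^+ 2 & A n.+1 1 1 = 1 + A n 0 0 * A n 1 0].
  have -> : A n.+1 = A n *m @translation R 1 *m invmx (A n).
    by rewrite -tE /A -conj_mxV// -!conj_mxM.
  exact: mul_translation_conj.
pose q := `|A 0%N 1 0|.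
have q0 : 0 < q by rewrite normr_gt0.
have q1 : q < 1 by exact: c1.
have cn n : 0 < `|A n.+1 1 0| < `|A n 1 0| /\ `|A n 1 0| <= q.
  elim: n => [|n [/andP[h1 h2] h3]].
    split=> //; have [_ _ -> _] := AS 0%N; rewrite normrN normrX -/q; apply/andP; split; nra.
  split; last by exact: le_trans (ltW h2) h3.
  have [_ _ -> _] := AS n.+1; rewrite normrN normrX.
  have : `|A n.+1 1 0| < 1 by lra.
  by move: h1; move: `|_| => w *; apply/andP; split; nra.
(* Chosen so that 1 + K q <= K: the recursion a_(n+1) = 1 - a_n c_n with |c_n| <= q then preserves
   |a_n| <= K. *)
pose K := Num.max `|A 0%N 0 0| (1 - q)^-1.
have K0 : 0 <= K by rewrite le_max normr_ge0.
have KK : 1 + K * q <= K.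
  have : (1 - q)^-1 <= K by rewrite le_max lexx orbT.
  have q1' : 0 < 1 - q by lra.
  rewrite -div1r ler_pdivrMr//; lra.
have an n : `|A n 0 0| <= K.
  elim: n => [|n IH]; first by rewrite le_max lexx.
  have [-> _ _ _] := AS n; apply: (le_trans (ler_normB _ _)); rewrite normr1 normrM.
  have [_ h] := cn n; have := ler_pM (normr_ge0 _) (normr_ge0 _) IH h; lra.
pose B := K ^+ 2 + K + 1.
have xB n : mxbound (A n.+1) B.
  have [e1 e2 e3 e4] := AS n; have ha := an n.
  have ha' := an n.+1; have [_ hc] := cn n; have [_ hc'] := cn n.+1.
  have K20 : 0 <= K ^+ 2 by exact: sqr_ge0.
  have hd : `|A n.+1 1 1| <= 1 + K.
    rewrite e4; apply: (le_trans (ler_normD _ _)); rewrite normr1 normrM.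
    have := ler_pM (normr_ge0 _) (normr_ge0 _) ha hc; lra.
  have hb : `|A n.+1 0 1| <= K ^+ 2.
    by rewrite e2 normrX; apply: lerXn2r => //; rewrite nnegrE.
  by move=> i j; case: (ord2P i) (ord2P j) => -> [] ->; rewrite /B; lra.
have fin := conj_finite B.
pose y n := A n.+1.
have mono n m : (n < m)%N -> `|A m 1 0| < `|A n 1 0|.
  elim: m => // m IH; rewrite ltnS leq_eqVlt => /orP[/eqP->|/IH h].
    by have [/andP[]] := cn m.
  by apply: (lt_trans _ h); have [/andP[]] := cn m.
have yinj : injective y.
  move=> n m E; case: (ltngtP n m) => // h.
    by have := mono n.+1 m.+1 h; rewrite -/(y n) -/(y m) E ltxx.
  by have := mono m.+1 n.+1 h; rewrite -/(y n) -/(y m) E ltxx.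
have := @finite_preimage _ _ _ y (in2W yinj) fin.
have -> : y @^-1` [set h | exists2 g, G g & h = conj_mx s g /\ mxbound h B] = setT.
  apply/seteqP; split=> // n _; exists (x n.+1) => //; split=> //; exact: xB.
exact: infinite_nat.
Qed.

(** One period 0 <= x <= 1 with a unit margin on each side, room for the squares of the mean value
    inequality. *)
Definition strip (Y : R) : set T2 := [set p | -1 <= p.1 <= 2 /\ Y <= p.2].

Lemma measurable_strip Y : measurable (strip Y).
Proof.
have -> : strip Y = (`[-1, 2]%classic : set (measurableTypeR R)) `*`
   (`[Y, +oo[%classic : set (measurableTypeR R)).
  by apply/seteqP; split=> -[u v]; rewrite /strip /= !in_itv /= ?andbT.
by apply: measurableX; exact: measurable_itv.
Qed.

(** If c is not 0 for s^-1 g s, then |c| >= 1 and a point of height y >= 2 is sent to height at most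
    1 / (c^2 y) < 2. So a return is a translation up to sign, by at most 3, the width of the
    strip. *)
Lemma strip_returns : finite_set (returns G [set q | 0 < q.2 /\ strip 2 (mob (invmx s) q)]).
Proof.
have inj : set_inj setT (conj_mx s).
  by move=> g h _ _ E; rewrite -(conj_mxK g ds) E conj_mxK.
have -> : returns G [set q | 0 < q.2 /\ strip 2 (mob (invmx s) q)] =
  (conj_mx s) @^-1` ((conj_mx s) @` returns G [set q | 0 < q.2 /\ strip 2 (mob (invmx s) q)]).
  apply/seteqP; split=> [g h|g [h hh E]]; first by exists g.
  by rewrite -(inj h g)// in_setT.
apply: finite_preimage; first by move=> g h _ _; apply: inj; rewrite in_setT.
apply: (sub_finite_set _ (conj_finite 3)) => _ [g [Gg [p [p0 Dp] [gp0 Dgp]]] <-].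
exists g => //; split => //.
have dg := psl2_det sG Gg.
have di : \det (invmx s) = 1 by exact: det_inv.
pose w := mob (invmx s) p.
have w0 : 0 < w.2 by exact: mob_pos.
have E : mob (invmx s) (mob g p) = mob (conj_mx s g) w.
  rewrite /conj_mx mobM ?det_mulmx ?di ?dg ?mulr1//.
  by rewrite mobKV// mobM.
move: Dgp Dp; rewrite E -/w => -[/andP[u1 u2] v2] [/andP[x1 x2] y2].
have dc := det_conj ds dg.
have c0 : conj_mx s g 1 0 = 0.
  apply/eqP; apply/negPn/negP => c0; have := shimizu Gg c0.
  move: v2; rewrite mob_Im//.
  have A0 : 0 < autj_norm2 (conj_mx s g) w by exact: autj_norm2_gt0.
  rewrite ler_pdivlMr// /autj_norm2 -[X in _ + X]real_normK ?num_real// normrM (gtr0_norm w0).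
  move: (_ 1 0 * _ + _) => u; move: `|_| y2; move: w.2; clear => y c y2 h c1.
  have := sqr_ge0 u; have : y <= c * y by nra.
  move: (c * y) h => w h h1 h2; nra.
have [m mE] := conj_upper_triangular Gg c0.
have [t1 t2 t3 t4] := translationE m.
have tN i j : (- @translation R m) i j = - @translation R m i j by rewrite mxE.
clearbody w.
have m3 : `|m%:~R| <= 3 :> R.
  have : (mob (conj_mx s g) w).1 = w.1 + m%:~R.
    case: mE => ->; rewrite mobE /autj_norm2 /= ?tN ?t1 ?t2 ?t3 ?t4; field; rewrite ?oner_eq0 //.
  by move=> h; rewrite h in u1 u2; rewrite ler_norml; apply/andP; split; lra.
by move=> i j; case: mE => ->; case: (ord2P i) (ord2P j) => -> [] ->;
  rewrite ?tN ?t1 ?t2 ?t3 ?t4 ?normrN ?normr1 ?normr0//; lra.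
Qed.

End Scaling.

(** Along a vertical line the derivative is i d, whose real part is - Im d. *)
Lemma cder_vertical (f : C -> C) (x t : R) (d : C) : cder f (x +i* t) d ->
  is_derive t 1 (fun t : R => complex.Re (f (x +i* t))) (- complex.Im d).
Proof.
move=> H.
suff cv : (fun h : R => h^-1 *: (complex.Re (f (x +i* (h *: 1 + t))) - complex.Re (f (x +i* t)))) @ (0 : R)^' --> - complex.Im d.
  apply: DeriveDef.
    by apply/cvg_ex; exists (- complex.Im d); exact: cv.
  by apply: cvg_lim; [exact: norm_hausdorff|exact: cv].
move=> P /nbhsRP[e e0 eP].
have e20 : 0 < e / 2 by rewrite divr_gt0.
have [r r0 rP] := H _ e20.
apply/nbhsRP; exists r => // h hr hN0; apply: eP.
have E : (x +i* (h + t) : C) - (x +i* t) = 0 +i* h.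
  by apply/eqP; rewrite eq_complex /= subrr addrK !eqxx.
have ch : cabs (0 +i* h : C) = `|h|.
  by rewrite -[LHS]ger0_norm ?cabs_ge0// -sqrtr_sqr sqr_cabs /= expr0n add0r sqrtr_sqr.
have hz : cabs ((x +i* (h + t) : C) - (x +i* t)) < r by rewrite E ch; move: hr; rewrite subr0.
have := rP _ hz; rewrite E ch => le1.
have h0 : 0 < `|h| by rewrite normr_gt0.
have -> : h^-1 *: (complex.Re (f (x +i* (h *: 1 + t))) - complex.Re (f (x +i* t))) - - complex.Im d
   = h^-1 * complex.Re (f (x +i* (h + t)) - f (x +i* t) - d * (0 +i* h)).
  rewrite !ReB [h *: 1]mulr1 [h^-1 *: _]/GRing.scale /=.
  have hh : h != 0 by [].
  by case: d {H rP le1} => u v /=; field.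
rewrite normrM normfV mulrC ltr_pdivrMr//.
apply: (le_lt_trans (Re_le_cabs _)); apply: le_lt_trans le1 _.
by rewrite ltr_pM2r// ltr_pdivrMr// mulr2n mulrDr mulr1 ltrDl.
Qed.

Lemma cderZ (a : C) (f : C -> C) z d : cder f z d -> cder (fun z => a * f z) z (a * d).
Proof.
move=> H e e0; have a0 := cabs_ge0 a.
have e1 : 0 < e / (cabs a + 1) by rewrite divr_gt0//; lra.
have [r r0 rP] := H _ e1; exists r => // w /rP h.
rewrite -mulrBr -mulrA -mulrBr cabsM.
apply: (le_trans (ler_wpM2l a0 h)); rewrite mulrA; apply: ler_wpM2r; first exact: cabs_ge0.
rewrite mulrA ler_pdivrMr; last lra.
by rewrite mulrC; apply: ler_wpM2l; [exact: ltW|lra].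
Qed.

(** A rotation a with a w = |w| makes the increment w real and positive, which brings in the real
    mean value theorem: Re(a F) + (B / c) exp(- c t) has derivative at most 0, so its increment is
    at most 0. *)
Lemma exp_decay_vertical (F phi : C -> C) (x y y' c B : R) : 0 < c -> y <= y' ->
  (forall t, y <= t <= y' -> cder F (x +i* t) (phi (x +i* t))) ->
  (forall t, y <= t <= y' -> cabs (phi (x +i* t)) <= B * expR (- (c * t))) ->
  cabs (F (x +i* y') - F (x +i* y)) <= B / c * expR (- (c * y)).
Proof.
move=> c0 yy dF hphi.
have B0 : 0 <= B.
  have := le_trans (cabs_ge0 _) (hphi y _); rewrite lexx yy => /(_ isT).
  by rewrite pmulr_lge0// expR_gt0.
set w := F (x +i* y') - F (x +i* y).
have [->|w0] := eqVneq w 0.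
  by rewrite cabs0 mulr_ge0 ?divr_ge0 ?expR_ge0// ltW.
pose a : C := (cabs w)%:C / w.
have aw : a * w = (cabs w)%:C by rewrite /a mulfVK.
have a1 : cabs a = 1.
  by rewrite /a cabsM cabsV cabsr ger0_norm ?cabs_ge0// divff// cabs_eq0.
pose v (t : R) : R := complex.Re (a * F (x +i* t)) + B / c * expR (- c * t).
pose dv (t : R) : R := - complex.Im (a * phi (x +i* t)) + B / c * (expR (- c * t) * - c).
have dvP t : y <= t <= y' -> is_derive t 1 v (dv t).
  move=> tI; have D1 := cder_vertical (cderZ a (dF t tI)).
  have D2 : is_derive t 1 (fun t : R => expR (- c * t)) (expR (- c * t) * - c).
    have D3 : is_derive t 1 (fun t : R => - c * t) (- c).
      by apply: is_derive_eq; rewrite /GRing.scale /= mulr1.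
    exact: (@is_derive1_comp _ expR (fun t => - c * t) t _ _ (is_derive_expR _) D3).
  have D4 := is_deriveZ (B / c) D2.
  exact: is_deriveD D1 D4.
have cv : {within `[y, y'], continuous v}.
  by apply: derivable_within_continuous => t; rewrite in_itv /= => tI; have [] := dvP t tI.
have dvoo t : t \in `]y, y'[ -> is_derive t 1 v (dv t).
  by rewrite in_itv /= => /andP[h1 h2]; apply: dvP; rewrite !ltW.
have [xi] := MVT_segment yy dvoo cv.
rewrite in_itv /= => xiI vE.
have dv0 : dv xi <= 0.
  have h := hphi xi xiI; have := Im_le_cabs (a * phi (x +i* xi)).
  rewrite cabsM a1 mul1r => h2; have := le_trans h2 h; rewrite ler_norml => /andP[h3 _].
  have -> : dv xi = - complex.Im (a * phi (x +i* xi)) - B * expR (- (c * xi)).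
    by rewrite /dv mulNr; field; rewrite gt_eqF.
  by move: h3; clear; lra.
have : v y' - v y <= 0 by rewrite vE mulr_le0_ge0// subr_ge0.
have -> : v y' - v y = complex.Re (a * w) + B / c * (expR (- (c * y')) - expR (- (c * y))).
  by rewrite /v /w mulrBr ReB !mulNr; ring.
rewrite aw /= => h.
have Bc : 0 <= B / c by rewrite divr_ge0// ltW.
have := mulr_ge0 Bc (expR_ge0 (- (c * y'))).
move: h; rewrite mulrBr; lra.
Qed.

Lemma cder_comp (f g : C -> C) z df dg : cder g z dg -> cder f (g z) df ->
  cder (fun z => f (g z)) z (df * dg).
Proof.
move=> hg hf e e0; have a0 := cabs_ge0 df; have b0 := cabs_ge0 dg.
have df1 : 0 < cabs df + 1 by rewrite ltr_wpDl.
have dg1 : 0 < cabs dg + 1 by rewrite ltr_wpDl.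
have e1 : 0 < Num.min 1 (e / 2 / (cabs df + 1)) by rewrite lt_min ltr01 !divr_gt0.
have e2 : 0 < e / 2 / (cabs dg + 1) by rewrite !divr_gt0.
have [r1 r10 h1] := hg _ e1; have [r2 r20 h2] := hf _ e2.
exists (Num.min r1 (r2 / (cabs dg + 1))); first by rewrite lt_min r10 divr_gt0.
move=> w; rewrite lt_min => /andP[w1 w2]; have n0 := cabs_ge0 (w - z).
have := h1 w w1; set p := g w - g z - dg * (w - z) => hp.
have p1 : cabs p <= cabs (w - z).
  by apply: (le_trans hp); rewrite -[leRHS]mul1r; apply: ler_wpM2r => //; rewrite ge_min lexx.
have p2 : cabs p <= e / 2 / (cabs df + 1) * cabs (w - z).
  by apply: (le_trans hp); apply: ler_wpM2r => //; rewrite ge_min lexx orbT.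
have gE : g w - g z = p + dg * (w - z) by rewrite /p subrK.
have hgb : cabs (g w - g z) <= (cabs dg + 1) * cabs (w - z).
  rewrite gE; apply: (le_trans (cabsD _ _)); rewrite cabsM mulrDl mul1r; lra.
have gr : cabs (g w - g z) < r2.
  by apply: (le_lt_trans hgb); move: w2; rewrite ltr_pdivlMr// mulrC.
have := h2 _ gr; set q := f (g w) - _ - _ => hq.
have -> : f (g w) - f (g z) - df * dg * (w - z) = q + df * p by rewrite /q /p; ring.
apply: (le_trans (cabsD _ _)); rewrite cabsM.
have hq' : cabs q <= e / 2 * cabs (w - z).
  apply: (le_trans hq); have := ler_wpM2l (ltW e2) hgb.
  by rewrite [leRHS]mulrA divfK// gt_eqF.
have hp' : cabs df * cabs p <= e / 2 * cabs (w - z).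
  have h3 : cabs df * cabs p <= (cabs df + 1) * cabs p.
    by apply: ler_wpM2r; [exact: cabs_ge0|rewrite lerDl].
  apply: (le_trans h3); have := ler_wpM2l (ltW df1) p2.
  by rewrite [leRHS]mulrA [_ * (_ / _)]mulrC divfK// gt_eqF.
have -> : e * cabs (w - z) = e / 2 * cabs (w - z) + e / 2 * cabs (w - z) by field.
exact: lerD.
Qed.

(** As the derivative of s is (c z + d)^-2, the composite Lambda o s is a primitive of f|_2 s. This
    decays exponentially above some height Y, so the values above Y stay close to those at Y; below
    Y the strip is compact. *)
Lemma Lambda_cusp_bounded (G : set M2) (f : C -> C) (a : option R) s :
  cusp_form 1 2 G f -> cusp G a -> scaling_matrix G a s ->
  exists B, forall p, strip 2 p -> cabs (Lambda f (moebius s (toC p))) <= B.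
Proof.
move=> [hf _ _ rd] ca hs; have ds := scaling_det hs.
have [c [B [c0 [Y0 [_ hY]]]]] := rd a ca s hs.
pose Y := Num.max 2 (Y0 + 1).
pose F z := Lambda f (moebius s z).
have dF z : upper z -> cder F z (slash 2 f s z).
  move=> uz; exact: (cder_comp (moebius_cder ds uz) (Lambda_cder hf (moebius_upper ds uz))).
have cF z : upper z -> {for z, continuous F}.
  by move=> uz; apply: derivable_contC; apply/derivable_cder; exists (slash 2 f s z); exact: dF.
have [M hM] : exists M, forall z, boxC (-1) 2 2 Y z -> `|cabs (F z)| <= M.
  apply: compact_cont_bounded; first exact: boxC_compact.
  move=> z [_ /andP[h _]]; apply: cont_cabs_comp; apply: cF.
  by rewrite /upper /=; lra.
have Y2 : 2 <= Y by rewrite le_max lexx.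
have YY0 : Y0 < Y by rewrite lt_max ltrDl ltr01 orbT.
exists (M + `|B / c * expR (- (c * Y))|) => -[x y] [/= xI y2].
have Mb t : 2 <= t <= Y -> cabs (F (x +i* t)) <= M.
  by move=> tI; apply: (le_trans (ler_norm _)); apply: hM.
have [yY|Yy] := leP y Y.
  have := Mb y; rewrite y2 yY => /(_ isT) h.
  by rewrite -[leLHS]addr0; apply: lerD.
have h1 := Mb Y; rewrite Y2 lexx in h1; have := h1 isT => {}h1.
have := @exp_decay_vertical F (slash 2 f s) x Y y c B c0 (ltW Yy).
have Yt t : Y <= t <= y -> 0 < t by case/andP => h _; lra.
move=> /(_ (fun t tI => dF (x +i* t) (Yt t tI))).
move=> /(_ (fun t tI => hY t (lt_le_trans YY0 (andP tI).1) x)) h2.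
have -> : Lambda f (moebius s (toC (x, y))) = (F (x +i* y) - F (x +i* Y)) + F (x +i* Y) by rewrite subrK.
apply: (le_trans (cabsD _ _)); rewrite addrC; apply: lerD => //.
exact: (le_trans h2 (ler_norm _)).
Qed.

End Cusps.

(** * The Poincare series *)

Section Main.
Context {R : realType}.
Local Notation C := (Cplx R).
Local Notation mu := (@lebesgue_measure R).
Local Notation T2 := (measurableTypeR R * measurableTypeR R)%type.
Local Notation M2 := 'M[R]_2.

(** Used with l = |L(t)|, with a and b the moduli of Lambda^+ and Lambda^- at the point moved into
    the fundamental set, and with c and d those at the original point. *)
Lemma one_plus_L_bound (l a b c d B : R) : 0 <= a -> 0 <= b -> l <= a + b + (c + d) -> c <= B -> d <= B -> 0 <= B ->
  1 + l <= (1 + 2 * B) * (1 + a + b).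
Proof. by move=> *; nra. Qed.

(** * Unfolding the integral hypothesis *)

Section Setting.

Variables (G G0 : set M2) (k : nat) (phi : C -> C) (L : M2 -> C) (fp fm : C -> C).

Hypothesis fG : fuchsian_first_kind G.

Hypothesis ek : ~~ odd k.

Hypothesis sG0 : psl2_subgroup G0.

Hypothesis G0G : G0 `<=` G.

Hypothesis hphi : holomorphic phi.

Hypothesis phi_inv : forall g z, G0 g -> upper z -> slash k phi g z = phi z.

Hypothesis hL : hom0 G L.

Hypothesis L0 : forall g, G0 g -> L g = 0.

Hypothesis es : eichler_shimura G L fp fm.

Let W z := (1 + cabs (Lambda fp z) + cabs (Lambda fm z)) * cabs (phi z) *
              complex.Im z ^+ k./2.

Hypothesis Wint : quotient_integral_finite G0 W.

Let sG := fuchsian_subgroup fG.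

Definition weighted_phi z := cabs (phi z) * complex.Im z ^+ k./2.

Lemma cabs_Lambda_bound g z : G g -> upper z ->
  cabs (L g) <= cabs (Lambda fp (moebius g z)) + cabs (Lambda fm (moebius g z)) +
                (cabs (Lambda fp z) + cabs (Lambda fm z)).
Proof.
move=> Gg uz; have ugz := moebius_upper (psl2_det sG Gg) uz.
have [hfp _ _ _] := es_plus es; have [hfm _ _ _] := es_minus es.
rewrite (es_period es Gg uz) -!Lambda_diff//.
apply: (le_trans (cabsD _ _)); rewrite cabsC.
have := cabsB (Lambda fp (moebius g z)) (Lambda fp z).
have := cabsB (Lambda fm (moebius g z)) (Lambda fm z).
lra.
Qed.

Lemma cont_Lambda f (z : C) : holomorphic f -> upper z -> {for z, continuous (Lambda f)}.
Proof.
move=> hf uz; apply: derivable_contC; by apply/derivable_cder; exists (f z); exact: Lambda_cder.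
Qed.

Lemma cont_Imk (z : C) : {for z, continuous (fun z : C => complex.Im z ^+ k./2)}.
Proof.
apply: (@continuous_comp _ _ _ (fun z : C => complex.Im z) (fun y : R => y ^+ k./2) z).
  exact: continuous_Im.
exact: exprn_continuous.
Qed.

Lemma cont_weighted_phi z : upper z -> {for z, continuous weighted_phi}.
Proof.
move=> uz; apply: continuousM; last exact: cont_Imk.
by apply: cont_cabs_comp; exact: upper_cont.
Qed.

Lemma measurable_weighted_phi : measurable_fun setT (upext weighted_phi).
Proof. by apply: measurable_upext => z; exact: cont_weighted_phi. Qed.

Lemma measurable_W : measurable_fun setT (upext W).
Proof.
have [hfp _ _ _] := es_plus es; have [hfm _ _ _] := es_minus es.
apply: measurable_upext => z uz; apply: continuousM; last exact: cont_Imk.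
apply: continuousM; last by apply: cont_cabs_comp; exact: upper_cont.
apply: (@continuousD _ _ _ (fun z : C => 1 + cabs (Lambda fp z)) (fun z => cabs (Lambda fm z))).
  apply: (@continuousD _ _ _ (fun _ : C => 1 : R) (fun z => cabs (Lambda fp z))); first exact: cst_continuous.
  by apply: cont_cabs_comp; exact: cont_Lambda.
by apply: cont_cabs_comp; exact: cont_Lambda.
Qed.

Lemma upext_ge0 (f : C -> R) p : (forall z, upper z -> 0 <= f z) -> 0 <= upext f p.
Proof. by move=> f0; rewrite /upext; case: ifP => // p0; exact: f0. Qed.

Lemma weighted_phi_ge0 z : upper z -> 0 <= weighted_phi z.
Proof. by move=> uz; rewrite mulr_ge0 ?cabs_ge0// exprn_ge0// ltW. Qed.

Lemma W_ge0 z : upper z -> 0 <= W z.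
Proof.
by move=> uz; rewrite /W -mulrA mulr_ge0 ?weighted_phi_ge0// !addr_ge0 ?cabs_ge0.
Qed.

(* The weight 1 + |L t| dominates the coefficients both of the series of L and of
   that of the constant 1. *)
Definition term_mass (D : set T2) (t : M2) (p : T2) : \bar R :=
  ((\1_D p)%:E * ((1 + cabs (L t)) * upext weighted_phi (mob t p))%:E)%E.

Lemma measurable_term_mass D t : measurable D -> measurable_fun setT (term_mass D t).
Proof.
move=> mD; apply: emeasurable_funM; first exact: measurable_indicE.
apply/measurable_EFinP; apply: measurable_funM; first exact: measurable_cst.
exact: (measurableT_comp measurable_weighted_phi (@measurable_mob R _)).
Qed.

Lemma term_mass_ge0 D t p : (0 <= term_mass D t p)%E.
Proof.
apply: indic_mule_ge0; rewrite lee_fin mulr_ge0 ?addr_ge0 ?cabs_ge0//.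
by apply: upext_ge0; exact: weighted_phi_ge0.
Qed.

Lemma term_mass_summable (T : set M2) (D : set T2) (B : R) :
  coset_transversal G0 G T -> measurable D -> (forall p, D p -> 0 < p.2) ->
  finite_set (returns G D) -> 0 <= B ->
  (forall p, D p -> cabs (Lambda fp (toC p)) <= B /\ cabs (Lambda fm (toC p)) <= B) ->
  (\esum_(t in T) hyp_int (term_mass D t) < +oo)%E.
Proof.
move=> tT mD Dpos fE B0 hB.
have [F FF Ffin] := Wint.
pose F2 : set T2 := [set p | F (toC p)].
have mF2 : measurable F2 by exact: fundamental_measurable FF.
pose Phi0 p : \bar R := ((\1_F2 p)%:E * (upext W p)%:E)%E.
have mP0 : measurable_fun setT Phi0.
  apply: emeasurable_funM; first exact: measurable_indicE.
  by apply/measurable_EFinP; exact: measurable_W.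
have P00 p : (0 <= Phi0 p)%E.
  by apply: indic_mule_ge0; rewrite lee_fin; apply: upext_ge0; exact: W_ge0.
pose Phi p : \bar R := ((1 + 2 * B)%:E * Phi0 p)%E.
have b0 : 0 <= 1 + 2 * B by rewrite addr_ge0// mulr_ge0.
have HIfin : (hyp_int Phi0 < +oo)%E.
  suff -> : hyp_int Phi0 = hyp_integral F W by [].
  rewrite /hyp_int /hyp_integral [RHS]integral_mkcond; apply: eq_integral => p _.
  rewrite /patch /Phi0 indicE; case: ifPn => [/set_mem Fp|nF].
    rewrite mul1e /upext.
    have p0 : 0 < p.2 by exact: (fundamental_upper FF Fp).
    by rewrite p0 /posinv p0 -EFinM exprVn.
  by rewrite !mul0e.
have H : (\esum_(t in T) hyp_int (term_mass D t) <=
   (#|` fset_set (returns G D)|)%:R%:E * hyp_int Phi)%E.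
  apply: (@unfold_cosets _ G G0) => //.
  - exact: (discrete_countable fG).
  - by apply: emeasurable_funM => //; exact: measurable_cst.
  - by move=> p; rewrite mule_ge0.
  - by move=> t; exact: measurable_term_mass.
  - by move=> t p; exact: term_mass_ge0.
  - by move=> t p nD; rewrite /term_mass indicE memNset// mul0e.
  move=> t p Tt Dp; have Gt := Defs.transversal_sub tT Tt.
  have p0 := Dpos p Dp; have dt := psl2_det sG Gt.
  have ut : upper (moebius t (toC p)) by exact: moebius_upper.
  (* The point t p is moved by d in [G0] into the fundamental set, the only place where [W] is known
     to be integrable. *)
  have [w [[Fw [d d0 wE]] _]] := fundamental_repr FF ut.
  have dd := psl2_det sG0 d0.
  exists d => //.
  have Eg : moebius (d *m t) (toC p) = w by rewrite wE moebiusM.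
  have uw : upper w by rewrite wE; exact: moebius_upper.
  have tw : toC (mob (d *m t) p) = w by rewrite toC_mob.
  rewrite /term_mass /Phi /Phi0 indicE mem_set// mul1e.
  have -> : (\1_F2 (mob (d *m t) p) : R) = 1 by rewrite indicE mem_set// /F2 /= tw.
  rewrite mul1e -EFinM lee_fin /upext.
  have -> : 0 < (mob t p).2 by apply: mob_pos.
  have -> : 0 < (mob (d *m t) p).2 by apply: mob_pos => //; rewrite det_mulmx dd dt mulr1.
  rewrite tw toC_mob.
  have -> : weighted_phi (moebius t (toC p)) = weighted_phi w.
    by rewrite /weighted_phi -(phi_inv d0 ut) cabs_slash// -wE.
  (* As [L] vanishes on [G0], the period formula may be applied to d t instead of t, and so
     evaluated at w. *)
  have LE : L t = L (d *m t) by rewrite (hom0_mul hL (G0G d0) Gt) (L0 d0) add0r.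
  have up : upper (toC p) by exact: p0.
  have := cabs_Lambda_bound (psl2_mul sG (G0G d0) Gt) up; rewrite Eg -LE => Lt.
  have [h1 h2] := hB p Dp; have a0 := weighted_phi_ge0 uw.
  have -> : W w = (1 + cabs (Lambda fp w) + cabs (Lambda fm w)) * weighted_phi w.
    by rewrite /W /weighted_phi mulrA.
  rewrite [leRHS]mulrA; apply: ler_wpM2r => //.
  by apply: one_plus_L_bound Lt h1 h2 B0; exact: cabs_ge0.
apply: (le_lt_trans H); rewrite hyp_int_scale// lte_mul_pinfty ?lee_fin ?ler0n//.
by apply: lte_mul_pinfty => //; rewrite lee_fin.
Qed.

(** * From masses to majorants of the terms *)

Hypothesis k4 : (4 <= k)%N.

(** The image s D. Positive height is imposed because [mob] is a geometric action only on the
    half-plane. *)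
Definition moved_set (s : M2) (D : set T2) : set T2 :=
  [set q | 0 < q.2 /\ D (mob (invmx s) q)].

Lemma measurable_moved_set s D : measurable D -> measurable (moved_set s D).
Proof.
move=> mD; have -> : moved_set s D = [set q : T2 | 0 < q.2] `&` (mob (invmx s) @^-1` D) by [].
apply: measurableI.
  by apply: measurable_open_rect => p /= p0; exists p.2 => // q _; rewrite ltr_norml => /andP[]; lra.
by rewrite -[X in measurable X]setTI; apply: measurable_mob.
Qed.

Lemma hyp_int_moved_set s D t : \det s = 1 -> G t -> measurable D ->
  hyp_int (term_mass (moved_set s D) t) =
  hyp_int (fun p => (\1_D p)%:E * ((1 + cabs (L t)) * upext weighted_phi (mob (t *m s) p))%:E)%E.
Proof.
move=> ds Gt mD; have dt := psl2_det sG Gt.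
rewrite -(hyp_int_mob ds (measurable_term_mass _ (measurable_moved_set s mD)) (term_mass_ge0 _ _)).
apply: eq_hyp_int => p p0; rewrite /term_mass mobM//; congr (_%:E * _)%E.
rewrite !indicE; congr (nat_of_bool _)%:R; apply/idP/idP => /set_mem.
  by rewrite /moved_set /= mobVK// => -[_ ?]; exact: mem_set.
by move=> Dp; apply: mem_set; rewrite /moved_set /= mobVK//; split => //; exact: mob_pos.
Qed.

(** [submean_area] for phi|(t s) on the square, followed by the comparison of dx dy with y^(k/2) dmu
    on [D], where y >= m. *)
Lemma term_bound s (D : set T2) (m : R) (z0 : C) (r : R) t : \det s = 1 -> G t -> measurable D -> 0 < m ->
  (forall p, D p -> m <= p.2) -> 0 < r -> r < complex.Im z0 -> sqbox_points z0 r `<=` D ->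
  (((1 + cabs (L t)) * cabs (slash k phi (t *m s) z0))%:E <=
   (32 / (cabs csq * r ^+ 2) / m ^+ (k./2 - 2))%:E * hyp_int (term_mass (moved_set s D) t))%E.
Proof.
move=> ds Gt mD m0 Dm r0 rz sub; have dt := psl2_det sG Gt.
have dts : \det (t *m s) = 1 by rewrite det_mulmx dt ds mulr1.
have hf : holomorphic (slash k phi (t *m s)) by exact: holomorphic_slash.
set f := slash k phi (t *m s) in hf *.
have l0 : 0 <= 1 + cabs (L t) by rewrite addr_ge0 ?cabs_ge0.
have c0 : 0 <= 32 / (cabs csq * r ^+ 2).
  by rewrite divr_ge0 ?mulr_ge0 ?cabs_ge0 ?exprn_ge0// ltW.
have mj0 : 0 < m ^+ (k./2 - 2) by rewrite exprn_gt0.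
have k2 : (2 <= k./2)%N by rewrite (half_leq k4).
pose Wt (p : T2) : \bar R :=
  ((\1_D p)%:E * ((1 + cabs (L t)) * upext weighted_phi (mob (t *m s) p))%:E)%E.
have mW : measurable_fun setT Wt.
  apply: emeasurable_funM; first exact: measurable_indicE.
  apply/measurable_EFinP; apply: measurable_funM; first exact: measurable_cst.
  exact: (measurableT_comp measurable_weighted_phi (@measurable_mob R _)).
have W0 p : (0 <= Wt p)%E.
  apply: indic_mule_ge0; rewrite lee_fin mulr_ge0//; apply: upext_ge0; exact: weighted_phi_ge0.
rewrite hyp_int_moved_set// -[X in hyp_int X]/Wt EFinM.
apply: (le_trans (lee_wpmul2l _ (submean_area hf r0 rz))); first by rewrite lee_fin.
rewrite muleCA [X in (_ <= X * _)%E]EFinM -muleA; apply: lee_wpmul2l; first by rewrite lee_fin.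
rewrite -ge0_integralZl//; last 2 first.
- exact: measurable_boxfun.
- by move=> p _; exact: boxfun_ge0.
rewrite /hyp_int -ge0_integralZl//; last 3 first.
- exact: measurable_hyp_int.
- by move=> p _; exact: (hyp_int_ge0_fun p W0).
- by rewrite lee_fin invr_ge0 ltW.
apply: ge0_le_integral => //.
- by move=> p _; rewrite mule_ge0 ?boxfun_ge0// lee_fin.
- by apply: emeasurable_funM; [exact: measurable_cst|exact: measurable_boxfun].
- by apply: emeasurable_funM; [exact: measurable_cst|exact: measurable_hyp_int].
move=> p _; rewrite /boxfun indicE; have [bp|bp] := boolP (p \in sqbox_points z0 r); last first.
  rewrite mul0r mule0; apply: mule_ge0; first by rewrite lee_fin invr_ge0 ltW.
  exact: (hyp_int_ge0_fun p W0).
have Dp := sub _ (set_mem bp); have mp := Dm p Dp.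
have p0 : 0 < p.2 by exact: lt_le_trans mp.
rewrite /Wt indicE (mem_set Dp) mul1e mul1r -!EFinM lee_fin /upext p0.
have -> : 0 < (mob (t *m s) p).2 by exact: mob_pos.
have up : upper (toC p) by exact: p0.
rewrite toC_mob /weighted_phi -(cabs_slash _ ek dts up) -/f /posinv p0.
rewrite -!mulrA mulrCA; apply: ler_wpM2l => //.
rewrite mulrCA; rewrite -[leLHS]mulr1; apply: ler_wpM2l; first exact: cabs_ge0.
change (complex.Im (toC p)) with p.2.
(* Here k >= 4 is used: the exponent k/2 - 2 is a true difference, and y^2 absorbs the density of
   dmu. *)
have -> : p.2 ^+ k./2 = p.2 ^+ (k./2 - 2) * p.2 ^+ 2 by rewrite -exprD subnK.
rewrite -mulrA -exprMn mulfV ?expr1n ?mulr1 ?gt_eqF// ler_pdivlMl// mulr1.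
by apply: lerXn2r mp; rewrite nnegrE ltW.
Qed.

(** The bound of [term_bound] does not involve the centre of the square, so it serves all z in [K]
    at once. *)
Lemma majorant T s (D : set T2) (m r : R) (K : set C) : coset_transversal G0 G T ->
  \det s = 1 -> measurable D -> 0 < m -> (forall p, D p -> m <= p.2) -> 0 < r ->
  (\esum_(t in T) hyp_int (term_mass (moved_set s D) t) < +oo)%E ->
  (forall z, K z -> r < complex.Im z /\ sqbox_points z r `<=` D) ->
  exists a : M2 -> R, [/\ forall t, 0 <= a t,
    forall t z, T t -> K z -> (1 + cabs (L t)) * cabs (slash k phi (t *m s) z) <= a t &
    (\esum_(t in T) (a t)%:E < +oo)%E].
Proof.
move=> tT ds mD m0 Dm r0 fin KD.
pose c := 32 / (cabs csq * r ^+ 2) / m ^+ (k./2 - 2).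
have c0 : 0 <= c.
  by rewrite divr_ge0 ?divr_ge0 ?mulr_ge0 ?cabs_ge0 ?exprn_ge0// ltW.
have h0 t : (0 <= hyp_int (term_mass (moved_set s D) t))%E.
  by apply: integral_ge0 => p _; apply: hyp_int_ge0_fun => q; exact: term_mass_ge0.
have hf t : T t -> hyp_int (term_mass (moved_set s D) t) \is a fin_num.
  move=> Tt; rewrite ge0_fin_numE//.
  exact: (le_lt_trans (@esum_ge1 _ _ T (fun t => hyp_int (term_mass (moved_set s D) t)) t Tt)).
exists (fun t => c * fine (hyp_int (term_mass (moved_set s D) t))); split.
- by move=> t; rewrite mulr_ge0// fine_ge0.
- move=> t z Tt /KD[rz sub]; rewrite -lee_fin [leRHS]EFinM fineK ?hf//.
  apply: term_bound => //; exact: (Defs.transversal_sub tT).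
- have -> : (\esum_(t in T) (c * fine (hyp_int (term_mass (moved_set s D) t)))%:E =
    \esum_(t in T) (c%:E * hyp_int (term_mass (moved_set s D) t)))%E.
    by apply: eq_esum => t Tt; rewrite EFinM fineK ?hf.
  apply: (@le_lt_trans _ _ (c%:E * \esum_(t in T) hyp_int (term_mass (moved_set s D) t))%E); last first.
    by apply: lte_mul_pinfty => //; rewrite lee_fin.
  apply: ge_ereal_sup => _ [X [fX XT] <-].
  rewrite fsbig_finite// -ge0_sume_distrr//; apply: lee_wpmul2l; first by rewrite lee_fin.
  by apply: esum_ge; exists X => //; rewrite fsbig_finite.
Qed.

Definition box_points (X m M : R) : set T2 := [set p | boxC (- X) X m M (toC p)].

Lemma measurable_box_points X m M : measurable (box_points X m M).
Proof.
have -> : box_points X m M = (`[- X, X]%classic : set (measurableTypeR R)) `*`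
   (`[m, M]%classic : set (measurableTypeR R)).
  by apply/seteqP; split=> -[x y]; rewrite /box_points /boxC /= !in_itv.
by apply: measurableX; exact: measurable_itv.
Qed.

Lemma box_returns X m M : 0 < m -> finite_set (returns G (box_points X m M)).
Proof.
move=> m0; apply: sub_finite_set (discrete_finite _ fG) => g [Gg [p Dp Dgp]].
split => //; apply: (box_return_bound m0 (psl2_det sG Gg) Dp).
by move: Dgp; rewrite /box_points /= toC_mob.
Qed.

Lemma moved_set1 (D : set T2) : (forall p, D p -> 0 < p.2) -> moved_set 1%:M D = D.
Proof.
move=> D0; have m1 (p : T2) : mob (invmx 1%:M) p = p.
  by apply: toC_inj; rewrite toC_mob invmx1 moebius1.
apply/seteqP; split=> [p [_]|p Dp]; first by rewrite m1.
by split; [exact: D0|rewrite m1].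
Qed.

Lemma box_majorant T (X m M : R) : coset_transversal G0 G T -> 0 < m ->
  exists a : M2 -> R, [/\ forall t, 0 <= a t,
    forall t z, T t -> boxC (- X) X m M z -> (1 + cabs (L t)) * cabs (slash k phi t z) <= a t &
    (\esum_(t in T) (a t)%:E < +oo)%E].
Proof.
move=> tT m0.
have [hfp _ _ _] := es_plus es; have [hfm _ _ _] := es_minus es.
(* The margins around the box exceed m / 4, the half-side of the squares used below. *)
pose D := box_points (X + m) (m / 2) (M + m).
have m2 : 0 < m / 2 by rewrite divr_gt0.
have D0 p : D p -> m / 2 <= p.2 by case=> _ /andP[].
have Dp0 p : D p -> 0 < p.2 by move/D0; exact: lt_le_trans.
have bnd f : holomorphic f -> exists B, forall p, D p -> cabs (Lambda f (toC p)) <= B.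
  move=> hf; have [B hB] : exists B, forall z, boxC (- (X + m)) (X + m) (m / 2) (M + m) z ->
      `|cabs (Lambda f z)| <= B.
    apply: compact_cont_bounded; first exact: boxC_compact.
    move=> z [_ /andP[h _]]; apply: cont_cabs_comp; apply: cont_Lambda => //.
    exact: lt_le_trans h.
  by exists B => p Dp; apply: (le_trans (ler_norm _)); exact: hB.
have [B1 hB1] := bnd _ hfp; have [B2 hB2] := bnd _ hfm.
pose B := Num.max 0 (Num.max B1 B2).
have fin : (\esum_(t in T) hyp_int (term_mass (moved_set 1%:M D) t) < +oo)%E.
  rewrite moved_set1//; apply: (@term_mass_summable _ _ B) => //.
  - exact: measurable_box_points.
  - exact: box_returns.
  - by rewrite le_max lexx.
  move=> p Dp; split; [apply: (le_trans (hB1 p Dp))|apply: (le_trans (hB2 p Dp))].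
    by rewrite /B !le_max lexx orbT.
  by rewrite /B !le_max lexx !orbT.
have r0 : 0 < m / 4 by rewrite divr_gt0.
have [] := @majorant T 1%:M D (m / 2) (m / 4) (boxC (- X) X m M) tT (det1 _ _)
  (measurable_box_points _ _ _) m2 D0 r0 fin.
  move=> z [/andP[x1 x2] /andP[y1 y2]]; split; first lra.
  by move=> p [/andP[u1 u2] /andP[v1 v2]]; split; apply/andP; split; move: u1 u2 v1 v2 => /=; lra.
move=> a [a0 ha fa]; exists a; split => // t z Tt bz.
by have := ha t z Tt bz; rewrite mulmx1.
Qed.

(** * Independence of the coset representatives *)

Definition rep T (g : M2) : M2 := xget g [set t | T t /\ exists2 d, G0 d & g = d *m t].

Lemma repP T g : coset_transversal G0 G T -> G g ->
  T (rep T g) /\ exists2 d, G0 d & g = d *m rep T g.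
Proof.
move=> tT Gg; have [t [[Tt td] _]] := Defs.transversal_repr tT Gg.
by apply: (@xgetPex _ g [set t | T t /\ exists2 d, G0 d & g = d *m t]); exists t.
Qed.

Lemma rep_unique T g t d : coset_transversal G0 G T -> G g -> T t -> G0 d -> g = d *m t ->
  rep T g = t.
Proof.
move=> tT Gg Tt d0 gE; have [t0 [_ U]] := Defs.transversal_repr tT Gg.
by rewrite -(U t) ?(U (rep T g))//; [exact: repP|split=> //; exists d].
Qed.

Lemma mulmxKV2 (g : M2) : \det g = 1 -> forall h : M2, h *m invmx g *m g = h.
Proof. by move=> dg h; rewrite -mulmxA mulVmx ?mulmx1// det_neq0_unit. Qed.

Lemma mulmxK2 (g : M2) : \det g = 1 -> forall h : M2, h *m g *m invmx g = h.
Proof. by move=> dg h; rewrite -mulmxA mulmxV ?mulmx1// det_neq0_unit. Qed.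

Lemma rep_bij T T' g t : coset_transversal G0 G T -> coset_transversal G0 G T' -> G g -> T t ->
  T' (rep T' (t *m g)) /\ rep T (rep T' (t *m g) *m invmx g) = t.
Proof.
move=> tT tT' Gg Tt; have Gt := Defs.transversal_sub tT Tt.
have Gtg := psl2_mul sG Gt Gg; have [Tr [d d0 E]] := repP tT' Gtg; split => //.
have dg := psl2_det sG Gg; have dd := psl2_det sG0 d0.
apply: (@rep_unique T _ t (invmx d) tT) => //.
- by apply: psl2_mul => //; [exact: (Defs.transversal_sub tT' Tr)|exact: psl2_inv].
- exact: psl2_inv.
rewrite -[t in RHS](mulmxK2 dg) [in RHS]E !mulmxA mulVmx ?mul1mx//.
exact: det_neq0_unit.
Qed.

(** Right multiplication by g permutes the cosets, and w depends on the coset only. The case g = 1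
    changes the transversal, the case T = T' gives the action of g on the series. *)
Lemma hassum_coset T T' g (w : M2 -> C) s :
  coset_transversal G0 G T -> coset_transversal G0 G T' -> G g ->
  (forall d x, G0 d -> G x -> w (d *m x) = w x) ->
  hassum T' w s -> hassum T (fun t => w (t *m g)) s.
Proof.
move=> tT tT' Gg hw h.
apply: (@eq_hassum R _ _ (fun t => w (rep T' (t *m g)))).
  move=> t Tt; have Gtg := psl2_mul sG (Defs.transversal_sub tT Tt) Gg.
  have [Tr [d d0 E]] := repP tT' Gtg.
  by rewrite [in RHS]E hw//; exact: (Defs.transversal_sub tT' Tr).
apply: (@hassum_reindex R _ T T' _ (fun t => rep T (t *m invmx g))) h => t Tt.
  exact: rep_bij.
have := rep_bij tT' tT (psl2_inv sG Gg) Tt.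
by rewrite invmxK.
Qed.

Lemma transversal_exists : exists T, coset_transversal G0 G T.
Proof.
pose cos (t : M2) : set M2 := [set x | exists2 d, G0 d & x = d *m t].
have cosE d t : G0 d -> cos (d *m t) = cos t.
  move=> d0; apply/seteqP; split=> [_ [e e0 ->]|_ [e e0 ->]].
    by exists (e *m d); [exact: psl2_mul|rewrite mulmxA].
  exists (e *m invmx d); first by apply: psl2_mul => //; exact: psl2_inv.
  by rewrite mulmxA mulmxKV2// (psl2_det sG0 d0).
pose c t := xget 1%:M (cos t).
have cP t : exists2 d, G0 d & c t = d *m t.
  by apply: (@xgetPex _ 1%:M (cos t)); exists t; exists 1%:M; rewrite ?mul1mx//; exact: psl2_1.
exists [set t | G t /\ c t = t]; split; first by move=> t [].
move=> g Gg; have [d d0 cE] := cP g; exists (c g); split.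
  split; last first.
    exists (invmx d); first exact: psl2_inv.
    by rewrite cE mulmxA mulVmx ?mul1mx// det_neq0_unit ?(psl2_det sG0 d0).
  split; first by rewrite cE; apply: psl2_mul => //; exact: G0G.
  by rewrite {1}/c {1}cE cosE.
by move=> t [[Gt ct] [e e0 gE]]; rewrite gE /c cosE.
Qed.

Lemma slash_phi_coset d x z : G0 d -> G x -> upper z ->
  slash k phi (d *m x) z = slash k phi x z.
Proof.
move=> d0 Gx uz; have dx := psl2_det sG Gx.
rewrite slashM ?(psl2_det sG0 d0)// {1}/slash phi_inv//; exact: moebius_upper.
Qed.

Lemma L_coset d x : G0 d -> G x -> L (d *m x) = L x.
Proof. by move=> d0 Gx; rewrite (hom0_mul hL (G0G d0) Gx) L0// add0r. Qed.

Lemma compact_in_box (K : set C) : compact K -> K `<=` upper ->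
  exists X m M, 0 < m /\ K `<=` boxC (- X) X m M.
Proof.
move=> cK Ku.
have [X hX] := @compact_cont_bounded R K (fun z => complex.Re z) cK (fun z _ => @continuous_Re R z).
have [M hM] := @compact_cont_bounded R K (fun z => complex.Im z) cK (fun z _ => @continuous_Im R z).
have [N hN] : exists N, forall z, K z -> `|(complex.Im z)^-1| <= N.
  apply: compact_cont_bounded => // z Kz.
  apply: (@continuous_comp _ _ _ (fun z : C => complex.Im z) (fun y : R => y^-1) z).
    exact: continuous_Im.
  by apply: inv_continuous; rewrite gt_eqF//; exact: Ku.
exists X, (Num.max 1 N)^-1, M; split; first by rewrite invr_gt0 lt_max ltr01.
move=> z Kz; have y0 := Ku z Kz; split; first by rewrite -ler_norml hX.
apply/andP; split; last by apply: (le_trans (ler_norm _)); exact: hM.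
rewrite -[leRHS]invrK lef_pV2 ?posrE ?invr_gt0 ?lt_max ?ltr01//.
by rewrite le_max (le_trans (ler_norm _) (hN z Kz)) orbT.
Qed.

(** * Normal convergence with general coefficients l, later l = L and l = 1 *)

Section OneSeries.

Variable l : M2 -> C.

Hypothesis lL : forall t, G t -> cabs (l t) <= 1 + cabs (L t).

Hypothesis l_coset : forall d x, G0 d -> G x -> l (d *m x) = l x.

Lemma series_majorant T (X m M : R) : coset_transversal G0 G T -> 0 < m ->
  exists a : M2 -> R, [/\ forall t, 0 <= a t,
    forall t z, T t -> boxC (- X) X m M z -> cabs (l t * slash k phi t z) <= a t &
    (\esum_(t in T) (a t)%:E < +oo)%E].
Proof.
move=> tT m0; have [a [a0 ha fa]] := box_majorant X M tT m0; exists a; split=> // t z Tt bz.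
apply: (le_trans _ (ha t z Tt bz)); rewrite cabsM; apply: ler_wpM2r; first exact: cabs_ge0.
by apply: lL; exact: (Defs.transversal_sub tT Tt).
Qed.

(** The value is defined by one transversal, and [hassum_coset] with g = 1 transfers it to all
    others. *)
Lemma series_exists : exists P : C -> C, forall T z, coset_transversal G0 G T -> upper z ->
  hassum T (fun t => l t * slash k phi t z) (P z).
Proof.
have [T0 tT0] := transversal_exists.
pose P z := xget 0 [set s | hassum T0 (fun t => l t * slash k phi t z) s].
exists P => T z tT uz.
have h0 : hassum T0 (fun t => l t * slash k phi t z) (P z).
  apply: (@xgetPex _ 0 [set s | hassum T0 (fun t => l t * slash k phi t z) s]).
  have [X [m [M [m0 sub]]]] : exists X m M, 0 < m /\ [set z] `<=` boxC (- X) X m M.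
    by apply: compact_in_box; [exact: compact_set1|move=> _ ->].
  have [a [a0 ha fa]] := series_majorant X M tT0 m0.
  by apply: (hassum_exists a0 _ fa) => t Tt; apply: ha => //; exact: sub.
apply: (@eq_hassum R _ _ (fun t => l (t *m 1%:M) * slash k phi (t *m 1%:M) z)).
  by move=> t _; rewrite mulmx1.
apply: (hassum_coset tT tT0 (psl2_1 sG) _ h0) => d x d0 Gx.
by rewrite (l_coset d0 Gx) (slash_phi_coset d0 Gx uz).
Qed.

Variable P : C -> C.

Hypothesis hP : forall T z, coset_transversal G0 G T -> upper z ->
  hassum T (fun t => l t * slash k phi t z) (P z).

Lemma series_unif T (X m M : R) : coset_transversal G0 G T -> 0 < m ->
  unif_on (boxC (- X) X m M) T (fun t z => l t * slash k phi t z) P.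
Proof.
move=> tT m0; have [a [a0 ha fa]] := series_majorant X M tT m0.
apply: (weierstrass_test a0 ha fa) => z [_ /andP[mz _]]; apply: hP => //.
exact: lt_le_trans mz.
Qed.

Lemma unif_onW (K K' : set C) T u : K `<=` K' -> unif_on K' T u P -> @unif_on R M2 K T u P.
Proof.
by move=> KK h e e0; have [A0 s0 H] := h e e0; exists A0 => // A sA iA z /KK; exact: H.
Qed.

Lemma series_holomorphic : holomorphic P.
Proof.
have [T tT] := transversal_exists.
apply: (@unif_on_holomorphic _ _ T (fun t z => l t * slash k phi t z)).
  move=> t Tt z uz; apply: derivableM; first exact: derivable_cst.
  by apply: holomorphic_slash => //; exact: (psl2_det sG (Defs.transversal_sub tT Tt)).
move=> z S S0 Sz; have [||X [m [M [m0 sub]]]] := @compact_in_box (sqbox z S).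
- exact: boxC_compact.
- by move=> w; exact: sqbox_upper.
by apply: (unif_onW sub); exact: series_unif.
Qed.

Lemma series_abs_unif T : coset_transversal G0 G T ->
  abs_unif_cvg_sum T (fun t z => l t * slash k phi t z) P.
Proof.
move=> tT; split=> [z uz|K cK Ku].
  have [X [m [M [m0 sub]]]] : exists X m M, 0 < m /\ [set z] `<=` boxC (- X) X m M.
    by apply: compact_in_box; [exact: compact_set1|move=> _ ->].
  have [a [a0 ha fa]] := series_majorant X M tT m0.
  apply: le_lt_trans fa; apply: le_esum => t Tt; rewrite lee_fin.
  by apply: ha => //; exact: sub.
have [X [m [M [m0 sub]]]] := compact_in_box cK Ku.
apply: (@unif_on_cvg R _ K T (fun t z => l t * slash k phi t z) P); apply: (unif_onW sub); exact: series_unif.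
Qed.

End OneSeries.

Lemma hassum_le (T : set M2) (v : M2 -> C) (b : M2 -> \bar R) s : hassum T v s ->
  (forall t, 0 <= b t)%E -> (forall t, T t -> ((cabs (v t))%:E <= b t)%E) ->
  ((cabs s)%:E <= \esum_(t in T) b t)%E.
Proof.
move=> h b0 vb; apply/lee_addgt0Pr => e e0; have [A sA H] := h e e0.
apply: (@le_trans _ _ ((\sum_(t <- A) cabs (v t))%:E + e%:E)%E).
  rewrite -EFinD lee_fin.
  have -> : s = \sum_(t <- A) v t - (\sum_(t <- A) v t - s) by rewrite subKr.
  apply: (le_trans (cabsB _ _)); apply: lerD; first exact: cabs_sum.
  exact: (H _ sA (fsubset_refl _)).
apply: leeD => //; apply: esum_ge; exists [set` A]; first by split.
rewrite fsbig_finite// set_fsetK -sumEFin big_seq [leRHS]big_seq.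
by apply: lee_sum => t tA; apply: vb; exact: sA.
Qed.

(** The total weighted integral of the terms over s D, with [D] given in the coordinate of the
    cusp. *)
Definition mass (T : set M2) (s : M2) (D : set T2) : \bar R :=
  (\esum_(t in T) hyp_int (term_mass (moved_set s D) t))%E.

Lemma hyp_int_term_mass_ge0 D t : (0 <= hyp_int (term_mass D t))%E.
Proof. by apply: integral_ge0 => p _; apply: hyp_int_ge0_fun => q; exact: term_mass_ge0. Qed.

Lemma mass_ge0 T s D : (0 <= mass T s D)%E.
Proof. by apply: esum_ge0 => t _; exact: hyp_int_term_mass_ge0. Qed.

(** Termwise, the indicators of two disjoint subsets of [D] add up to at most that of [D]. With [B]
    empty this is monotonicity. *)
Lemma mass_add T s (A B D : set T2) : measurable A -> measurable B -> measurable D ->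
  (forall p, A p -> ~ B p) -> A `<=` D -> B `<=` D ->
  (mass T s A + mass T s B <= mass T s D)%E.
Proof.
move=> mA mB mD AB AD BD; rewrite /mass -esumD; last 2 first.
- by move=> t _; exact: hyp_int_term_mass_ge0.
- by move=> t _; exact: hyp_int_term_mass_ge0.
have mt E t : measurable E -> measurable_fun setT (term_mass (moved_set s E) t).
  by move=> mE; apply: measurable_term_mass; exact: measurable_moved_set.
apply: le_esum => t _; rewrite /hyp_int -ge0_integralD//; last 4 first.
- by move=> p _; apply: hyp_int_ge0_fun => q; exact: term_mass_ge0.
- by apply: measurable_hyp_int; exact: mt.
- by move=> p _; apply: hyp_int_ge0_fun => q; exact: term_mass_ge0.
- by apply: measurable_hyp_int; exact: mt.
apply: ge0_le_integral => //.
- by move=> p _; apply: adde_ge0; apply: hyp_int_ge0_fun => q; exact: term_mass_ge0.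
- by apply: emeasurable_funD; apply: measurable_hyp_int; exact: mt.
- by apply: measurable_hyp_int; exact: mt.
move=> p _; rewrite -ge0_muleDl; [|exact: term_mass_ge0|exact: term_mass_ge0].
apply: lee_wpmul2r; first by rewrite lee_fin exprn_ge0// posinv_ge0.
have x0 : (0 <= ((1 + cabs (L t)) * upext weighted_phi (mob t p))%:E :> \bar R)%E.
  by rewrite lee_fin mulr_ge0 ?addr_ge0 ?cabs_ge0//; apply: upext_ge0; exact: weighted_phi_ge0.
rewrite /term_mass -ge0_muleDl ?lee_fin ?indicE ?ler0n//.
apply: ler_wpM2r => //.
have [Ap|nA] := pselect (moved_set s A p).
  rewrite mem_set// memNset; last by move: Ap => [_ Ap] [_] /(AB _ Ap).
  by rewrite mem_set ?addr0//; move: Ap => [p0 /AD].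
rewrite memNset// add0r; have [Bp|nB] := pselect (moved_set s B p).
  by rewrite !mem_set//; move: Bp => [p0 /BD].
by rewrite (memNset nB) ler0n.
Qed.

Lemma mass_le T s (A D : set T2) : measurable A -> measurable D -> A `<=` D ->
  (mass T s A <= mass T s D)%E.
Proof.
move=> mA mD AD.
have H : (mass T s A + mass T s set0 <= mass T s D)%E.
  by apply: mass_add => // p _ [].
by apply: le_trans H; apply: leeDl; exact: mass_ge0.
Qed.

(** * Exponential decay at one cusp *)

Section OneCusp.

Variables (l : M2 -> C) (P : C -> C) (a : option R) (s : M2) (T : set M2).

Hypothesis lL : forall t, G t -> cabs (l t) <= 1 + cabs (L t).

Hypothesis hP : forall T z, coset_transversal G0 G T -> upper z ->
  hassum T (fun t => l t * slash k phi t z) (P z).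

Hypothesis P_holo : holomorphic P.

Hypothesis P_parabolic : forall g, G g -> parabolic g -> forall z, upper z ->
  slash k P g z = P z.

Hypothesis ca : cusp G a.

Hypothesis hs : scaling_matrix G a s.

Hypothesis tT : coset_transversal G0 G T.

Let ds : \det s = 1 := scaling_det hs.

Let h := slash k P s.

Lemma holomorphic_at_cusp : holomorphic h.
Proof. exact: holomorphic_slash. Qed.

Lemma hassum_slash g z : \det g = 1 -> upper z ->
  hassum T (fun t => l t * slash k phi (t *m g) z) (slash k P g z).
Proof.
move=> dg uz; have -> : slash k P g z = autj g z ^- k * P (moebius g z) by rewrite /slash mulrC.
apply: eq_hassum (hassumZ (autj g z ^- k) (hP tT (moebius_upper dg uz))) => t Tt.
have dt := psl2_det sG (Defs.transversal_sub tT Tt).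
rewrite slashM// -[slash k (slash k phi t) g z]/(slash k phi t (moebius g z) * autj g z ^- k).
by rewrite mulrCA [X in _ = _ * X]mulrC.
Qed.

Lemma mass_strip_finite : (mass T s (strip 2) < +oo)%E.
Proof.
have [B1 hB1] := Lambda_cusp_bounded (es_plus es) ca hs.
have [B2 hB2] := Lambda_cusp_bounded (es_minus es) ca hs.
apply: (@term_mass_summable T _ (Num.max 0 (Num.max B1 B2))) => //.
- by apply: measurable_moved_set; exact: measurable_strip.
- by move=> p [].
- exact: strip_returns fG hs.
- by rewrite le_max lexx.
move=> p [p0 Dp].
have E : toC p = moebius s (toC (mob (invmx s) p)) by rewrite -toC_mob mobKV.
rewrite E; split; [apply: (le_trans (hB1 _ Dp))|apply: (le_trans (hB2 _ Dp))].
  by rewrite !le_max lexx orbT.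
by rewrite !le_max lexx !orbT.
Qed.

Definition cusp_const (r : R) : R := 32 / (cabs csq * r ^+ 2).

(** [term_bound] is summed over the cosets. As [D] lies above height 1, it is used with m = 1 and
    the power of m disappears. *)
Lemma cusp_bound (D : set T2) (z : C) (r : R) : measurable D -> (forall p, D p -> 1 <= p.2) ->
  0 < r -> r < complex.Im z -> sqbox_points z r `<=` D ->
  ((cabs (h z))%:E <= (cusp_const r)%:E * mass T s D)%E.
Proof.
move=> mD D1 r0 rz sub.
have uz : upper z by exact: lt_trans rz.
have c0 : 0 <= cusp_const r.
  by rewrite divr_ge0 ?mulr_ge0 ?cabs_ge0 ?exprn_ge0// ltW.
have e0 t : (0 <= (cusp_const r)%:E * hyp_int (term_mass (moved_set s D) t))%E.
  by rewrite mule_ge0 ?lee_fin// hyp_int_term_mass_ge0.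
have H : ((cabs (h z))%:E <= \esum_(t in T) ((cusp_const r)%:E * hyp_int (term_mass (moved_set s D) t)))%E.
  apply: (hassum_le (hassum_slash ds uz) e0) => t Tt.
  have Gt := Defs.transversal_sub tT Tt.
  have := term_bound ds Gt mD ltr01 D1 r0 rz sub.
  rewrite expr1n divr1; apply: le_trans; rewrite lee_fin cabsM.
  by apply: ler_wpM2r; [exact: cabs_ge0|exact: lL].
apply: (le_trans H); apply: ge_ereal_sup => _ [X [fX XT] <-].
rewrite fsbig_finite// -ge0_sume_distrr; last by move=> t _; exact: hyp_int_term_mass_ge0.
by apply: lee_wpmul2l; [rewrite lee_fin|apply: esum_ge; exists X => //; rewrite fsbig_finite].
Qed.

(** Some g in [G] is conjugate by s to the unit translation. It has trace 2 and is neither 1 nor -1,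
    so it is parabolic and P|g = P. *)
Lemma periodic_at_cusp z : upper z -> h (z + 1) = h z.
Proof.
move=> uz; have [g Gg gE] := conj_translation hs.
have dg := psl2_det sG Gg.
have [t1 t2 t3 t4] := @translationE R 1.
have E : g *m s = s *m @translation R 1.
  by rewrite -gE /conj_mx !mulmxA mulmxV ?mul1mx// det_neq0_unit.
have dT : \det (@translation R 1) = 1 by rewrite -gE det_conj.
have pg : parabolic g.
  have gs : g = s *m @translation R 1 *m invmx s by rewrite -E mulmxK2.
  split => //.
  - move=> g1; move: t2; rewrite -gE g1 /conj_mx mulmx1 mulVmx ?det_neq0_unit// !mxE /=.
    by move/eqP; rewrite eq_sym oner_eq0.
  - move=> g1; move: t2; rewrite -gE g1 /conj_mx mulmxN mulmx1 mulNmx mulVmx ?det_neq0_unit// !mxE /=.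
    by move/eqP; rewrite oppr0 eq_sym oner_eq0.
  - rewrite gs mxtrace_mulC mulmxA mulVmx ?mul1mx ?det_neq0_unit//.
    rewrite /mxtrace !big_ord_recl big_ord0 addr0.
    have -> : lift ord0 ord0 = 1 :> 'I_2 by apply/val_inj.
    by rewrite t1 t4 -[1 + 1]/(2%:R) ger0_norm.
have us := moebius_upper ds uz.
have -> : h z = slash k P (g *m s) z.
  by rewrite slashM// /h /slash -[P (moebius s z)](P_parabolic Gg pg us).
rewrite E slashM// /slash -/h /moebius /autj t1 t2 t3 t4 !mul1r mul0r add0r.
by rewrite divr1 expr1n invr1 mulr1.
Qed.

Lemma sqbox_points_strip (x y r Y : R) : 0 <= x <= 1 -> r <= 1 -> Y + r <= y ->
  sqbox_points (x +i* y) r `<=` strip Y.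
Proof.
move=> /andP[x0 x1] r1 Yy [u v] [/= /andP[u1 u2] /andP[v1 v2]].
by split; rewrite /=; [apply/andP; split; lra|lra].
Qed.

(** By periodicity x may be taken in [0, 1]; at height at least 3, a square of half-side 1 then lies
    in [strip 2], whose mass is finite. *)
Lemma bounded_at_cusp : exists M, forall z, 3 <= complex.Im z -> cabs (h z) <= M.
Proof.
exists (fine ((cusp_const 1)%:E * mass T s (strip 2))) => -[x y] /= y3.
have per z : 3 <= complex.Im z -> h (z + 1) = h z.
  by move=> z3; apply: periodic_at_cusp; rewrite /upper /=; lra.
have [x' /andP[x0 x1] ->] := periodic_shift x per y3.
have xI : 0 <= x' <= 1 by rewrite x0 ltW.
have c0 : 0 <= cusp_const 1.
  by rewrite divr_ge0 ?mulr_ge0 ?cabs_ge0 ?exprn_ge0.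
have fin : ((cusp_const 1)%:E * mass T s (strip 2))%E \is a fin_num.
  rewrite ge0_fin_numE ?mule_ge0 ?lee_fin ?mass_ge0//.
  by apply: lte_mul_pinfty; rewrite ?lee_fin//; exact: mass_strip_finite.
rewrite -lee_fin fineK//; apply: cusp_bound => //=.
- exact: measurable_strip.
- by move=> p [_ p2]; lra.
- lra.
- by apply: sqbox_points_strip => //; lra.
Qed.

(* Disjoint boxes going up the strip have summable masses, and each of them bounds
   the mean, which does not depend on the height. *)
Lemma mean_zero_at_cusp y : 3 <= y -> cint01 (fun t => h (t +i* y)) = 0.
Proof.
move=> y3.
have per z : 3 <= complex.Im z -> h (z + 1) = h z.
  by move=> z3; apply: periodic_at_cusp; rewrite /upper /=; lra.
have dh z : 3 <= complex.Im z -> derivable h z 1.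
  by move=> z3; apply: holomorphic_at_cusp; rewrite /upper /=; lra.
pose kap := cabs (cint01 (fun t => h (t +i* y))).
have kapE y' : 3 <= y' -> kap = cabs (cint01 (fun t => h (t +i* y'))).
  move=> y'3; have E := @mean_const R h 3 y y' dh per y3 y'3; exact: (f_equal cabs E).
pose Db (Y : R) : set T2 := [set p | boxC (-1) 2 Y (Y + 1) (toC p)].
have mDb Y : measurable (Db Y).
  have -> : Db Y = (`[-1, 2]%classic : set (measurableTypeR R)) `*`
     (`[Y, Y + 1]%classic : set (measurableTypeR R)).
    by apply/seteqP; split=> -[u v]; rewrite /Db /boxC /= !in_itv.
  by apply: measurableX; exact: measurable_itv.
(* Squares of half-side 1/2 centred at height Y + 1/2, with 0 <= x <= 1, fit in the box [Db Y] of
   height 1. *)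
pose c := cusp_const 2^-1.
have c0 : 0 <= c by rewrite divr_ge0 ?mulr_ge0 ?cabs_ge0 ?exprn_ge0.
have box_lower Y : 3 <= Y -> (kap%:E <= (2 * c)%:E * mass T s (Db Y))%E.
  move=> Y3; have Y3' : 3 <= Y + 2^-1 by lra.
  have mfin : mass T s (Db Y) \is a fin_num.
    rewrite ge0_fin_numE ?mass_ge0//; apply: le_lt_trans mass_strip_finite.
    apply: mass_le => //; first exact: measurable_strip.
    by move=> p [h0 /andP[h1 _]]; split=> //; lra.
  rewrite (kapE _ Y3') -(fineK mfin) -EFinM lee_fin -mulrA.
  apply: cint01_bound.
    have -> : (fun t => h (t +i* (Y + 2^-1))) = (fun t => h (seg (0 +i* (Y + 2^-1)) (1 +i* (Y + 2^-1)) t)).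
      apply/funext => t; congr h; apply/eqP; rewrite eq_complex seg_Re seg_Im /=.
      by apply/andP; split; apply/eqP; ring.
    apply: cont01_seg => t t01; apply: derivable_contC; apply: dh.
    by rewrite seg_Im /= subrr mulr0 addr0.
  move=> t tI; rewrite -lee_fin EFinM fineK//; apply: cusp_bound => //=.
  - by move=> p [_ /andP[]]; lra.
  - lra.
  - move: tI => /andP[t0 t1] [u v] [/= /andP[u1 u2] /andP[v1 v2]].
    by split; apply/andP; split => /=; lra.
(* The next box starts at height Y + 2 rather than Y + 1, so that the closed boxes are disjoint. As
   N is arbitrary and the mass finite, kap is 0. *)
have strip_lower N Y : 3 <= Y -> ((N%:R * kap)%:E <= (2 * c)%:E * mass T s (strip Y))%E.
  elim: N Y => [|N IH] Y Y3; first by rewrite mul0r mule_ge0 ?lee_fin ?mass_ge0// mulr_ge0.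
  rewrite -natr1 mulrDl mul1r addrC EFinD.
  apply: (@le_trans _ _ ((2 * c)%:E * (mass T s (Db Y) + mass T s (strip (Y + 2))))%E).
    rewrite ge0_muleDr ?mass_ge0//; apply: leeD; first exact: box_lower.
    by apply: IH; lra.
  apply: lee_wpmul2l; first by rewrite lee_fin mulr_ge0.
  apply: mass_add => //.
  - exact: measurable_strip.
  - exact: measurable_strip.
  - by move=> p [_ /andP[_ /= h1]] [_ h2]; lra.
  - by move=> p [h0 /andP[h1 _]]; split.
  - by move=> p [h0 h1]; split=> //; lra.
have fin3 : (mass T s (strip 3) < +oo)%E.
  apply: le_lt_trans mass_strip_finite; apply: mass_le; try exact: measurable_strip.
  by move=> p [h0 h1]; split=> //; lra.
have fn : mass T s (strip 3) \is a fin_num by rewrite ge0_fin_numE ?mass_ge0.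
apply/eqP; rewrite -cabs_eq0; apply/negPn/negP => kn.
have kp : 0 < kap by rewrite lt_neqAle eq_sym kn cabs_ge0.
have := strip_lower (Num.truncn (2 * c * fine (mass T s (strip 3)) / kap)).+1 3 (lexx _).
rewrite -(fineK fn) -EFinM lee_fin leNgt -ltr_pdivrMr// => /negP; apply.
by rewrite truncnS_gt.
Qed.

Lemma cusp_decay : exists c B : R, 0 < c /\
    \forall y \near +oo, forall x : R, cabs (h (x +i* y)) <= B * expR (- (c * y)).
Proof.
have per z : 3 <= complex.Im z -> h (z + 1) = h z.
  by move=> z3; apply: periodic_at_cusp; rewrite /upper /=; lra.
have dh z : 3 <= complex.Im z -> derivable h z 1.
  by move=> z3; apply: holomorphic_at_cusp; rewrite /upper /=; lra.
have [M hM] := bounded_at_cusp.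
have [c [B [c0 H]]] := periodic_decay dh per mean_zero_at_cusp hM.
exists c, B; split => //; exists 3; split; first by rewrite num_real.
by move=> y y3 x; apply: H; exact: ltW.
Qed.

End OneCusp.

(** * The transformation law and the conclusion *)

Lemma slash_series_coset (l : M2 -> C) P T g z :
  (forall d x, G0 d -> G x -> l (d *m x) = l x) ->
  (forall T z, coset_transversal G0 G T -> upper z ->
    hassum T (fun t => l t * slash k phi t z) (P z)) ->
  coset_transversal G0 G T -> G g -> upper z ->
  hassum T (fun t => l (t *m g) * slash k phi (t *m g) z) (P z).
Proof.
move=> hl hP tT Gg uz.
apply: (hassum_coset (w := fun x => l x * slash k phi x z) tT tT Gg _ (hP T z tT uz)).
by move=> d x d0 Gx; rewrite (hl d x d0 Gx) (slash_phi_coset d0 Gx uz).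
Qed.

Lemma cusp_form2_series : exists P : C -> C, cusp_form 2 k G P /\
  forall T, coset_transversal G0 G T -> abs_unif_cvg_sum T (pseries_term k phi L) P.
Proof.
have lL t : G t -> cabs (L t) <= 1 + cabs (L t) by move=> _; rewrite lerDr.
have l1 t : G t -> cabs (1 : C) <= 1 + cabs (L t).
  by move=> _; rewrite cabs1 lerDl cabs_ge0.
have [P hP] := series_exists lL L_coset.
have [P0 hP0] := series_exists l1 (fun _ _ _ _ => erefl).
have [T tT] := transversal_exists.
have P_holo := series_holomorphic lL hP.
have P0_holo := series_holomorphic l1 hP0.
have P0_inv g z : G g -> upper z -> slash k P0 g z = P0 z.
  move=> Gg uz; have dg := psl2_det sG Gg.
  apply: (hassum_unique (hassum_slash hP0 tT dg uz)).
  exact: (slash_series_coset (l := fun=> 1) (fun _ _ _ _ => erefl) hP0 tT Gg uz).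
have P_slash g z : G g -> upper z -> slash k P g z = P z - L g * P0 z.
  move=> Gg uz; have dg := psl2_det sG Gg.
  apply: (hassum_unique (hassum_slash hP tT dg uz)).
  have h1 := slash_series_coset L_coset hP tT Gg uz.
  have h2 := slash_series_coset (l := fun=> 1) (fun _ _ _ _ => erefl) hP0 tT Gg uz.
  (* L(t) = L(t g) - L(g) writes the sum for P|g in terms of the reindexed sums for P and P0. *)
  apply: eq_hassum (hassum_linear (L g) h1 h2) => t Tt.
  by rewrite (hom0_mul hL (Defs.transversal_sub tT Tt) Gg) mul1r -mulrBl addrK.
have P_par g : G g -> parabolic g -> forall z, upper z -> slash k P g z = P z.
  by move=> Gg pg z uz; rewrite P_slash// (hom0_parabolic hL)// mul0r subr0.
have P0_par g : G g -> parabolic g -> forall z, upper z -> slash k P0 g z = P0 z.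
  by move=> Gg pg z uz; exact: P0_inv.
exists P; split; last by move=> T' tT'; exact: series_abs_unif.
split; first exact: P_holo; last 2 first.
- by move=> g Gg pg z uz; rewrite P_par// subrr.
- move=> a ca s hs; exact: (cusp_decay lL hP P_holo P_par ca hs tT).
move=> g Gg; have dg := psl2_det sG Gg.
(* On the half-plane f = - L(g) P0, so f is invariant under [G] and inherits the decay of P0 at the
   cusps: it lies in S^1. *)
pose f z := slash k P g z - P z.
have fE z : upper z -> f z = - (L g * P0 z).
  by move=> uz; rewrite /f P_slash// addrAC subrr sub0r.
have fs s z : \det s = 1 -> upper z -> slash k f s z = - (L g * slash k P0 s z).
  by move=> ds uz; rewrite /slash fE ?mulNr ?mulrA//; exact: moebius_upper.
have f_inv x z : G x -> upper z -> slash k f x z - f z = 0.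
  by move=> Gx uz; rewrite fs ?(psl2_det sG Gx)// P0_inv// fE// subrr.
split.
- move=> z uz; apply: derivableB; last exact: P_holo.
  exact: holomorphic_slash.
- by move=> x Gx z uz; exact: f_inv.
- by move=> x Gx _ z uz; exact: f_inv.
move=> a ca s hs; have ds := scaling_det hs.
have [c [B [c0 [Y [_ hY]]]]] := cusp_decay l1 hP0 P0_holo P0_par ca hs tT.
exists c, (cabs (L g) * B); split => //.
(* Heights are kept positive because the formula for f holds only on the half-plane. *)
exists (Num.max 0 Y); split; first by rewrite num_real.
move=> y; rewrite gt_max => /andP[y0 yY] x; rewrite -/f fs// cabsN cabsM -mulrA.
by apply: ler_wpM2l; [exact: cabs_ge0|exact: hY].
Qed.

End Setting.

End Main.

Unset Implicit Arguments.

Theorem theorem2 (R : realType) (G G0 : set 'M[R]_2) (k : nat)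
    (phi : Cplx R -> Cplx R) (L : 'M[R]_2 -> Cplx R)
    (fp fm : Cplx R -> Cplx R) :
  fuchsian_first_kind G ->
  finite_covolume G ->
  (4 <= k)%N -> ~~ odd k ->
  psl2_subgroup G0 -> G0 `<=` G ->
  holomorphic phi ->
  (forall g z, G0 g -> upper z -> slash k phi g z = phi z) ->
  hom0 G L ->
  (forall g, G0 g -> L g = 0) ->
  eichler_shimura G L fp fm ->
  quotient_integral_finite G0
    (fun z => (1 + cabs (Lambda fp z) + cabs (Lambda fm z)) * cabs (phi z) *
              complex.Im z ^+ k./2) ->
  exists P : Cplx R -> Cplx R,
    cusp_form 2 k G P /\
    forall T : set 'M[R]_2, coset_transversal G0 G T ->
      abs_unif_cvg_sum T (pseries_term k phi L) P.
Proof.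
move=> fG _ k4 ek sG0 G0G hphi phi_inv hL L0 es Wint.
exact: (cusp_form2_series fG ek sG0 G0G hphi phi_inv hL L0 es Wint k4).
Qed.
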